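(* Let $p$ be a prime and let $U_4(\mathbb{F}_p)$ be the group of $4\times 4$ upper unitriangular matrices with entries in $\mathbb{F}_p$. (1) If $p=2$, then there is a homotopy equivalence \[ \mathscr{C}(\mathcal{N}_3,U_4(\mathbb{F}_2))\simeq \bigvee^3 S^2 . \] (2) If $p>2$, then there is a homotopy equivalence \[ \mathscr{C}(\mathcal{N}_3,U_4(\mathbb{F}_p))\simeq \bigvee^{p^2(p-1)^3}S^1\ \vee\ \bigvee^{(p-1)^3}S^2 . \]
   Context: For a group $G$ and a family $\mathcal{F}$ of subgroups of $G$, the coset poset $\mathscr{C}(\mathcal{F},G)$ is the set of left cosets $\{gH\mid g\in G,\ H\in\mathcal{F}\}$ partially ordered by inclusion; the same symbol denotes the geometric realization of its order complex (the simplicial complex whose $n$-simplices are the strictly increasing chains of $n+1$ cosets). $\mathcal{N}_{3}$ denotes the family of all subgroups of $G$ that are nilpotent of class at most $2$. Upper unitriangular means upper triangular with ones on the diagonal. $\bigvee^m X$ denotes the wedge of $m$ copies of $X$. *)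

(* Defs.v *)
From HB Require Import structures.
From mathcomp Require Import all_boot all_order all_algebra all_fingroup.
From mathcomp Require Import nilpotent.
From mathcomp Require Import all_classical all_reals topology normedtype.
From mathcomp Require Import homotopy.
Set Implicit Arguments.
Unset Strict Implicit.
Unset Printing Implicit Defensive.
Import Order.TTheory GRing.Theory Num.Theory.
Import numFieldTopology.Exports numFieldNormedType.Exports.
Local Open Scope classical_set_scope.
Local Open Scope ring_scope.

Section Unitriangular.
Variables (n : nat) (F : finComUnitRingType).

Definition upper_unitriangular (m : nat) (A : 'M[F]_m) : bool :=
  [forall i : 'I_m, forall j : 'I_m, (j <= i)%N ==> (A i j == (i == j)%:R)].

Definition unitriangular_set : {set {'GL_n[F]}} :=
  [set g | upper_unitriangular (GLval g)]%SET.

Lemma unitriangular_group_set : group_set unitriangular_set.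
Proof.
apply/group_setP; split=> [|x y].
  rewrite inE; apply/'forall_forallP => i j; apply/implyP => _.
  by rewrite GL_1E mxE.
rewrite !inE => /'forall_'forall_implyP Ux /'forall_'forall_implyP Uy.
apply/'forall_'forall_implyP => i j le_ji; rewrite GL_ME mxE.
rewrite (bigD1 i) //= (eqP (Ux i i (leqnn i))) eqxx mul1r (eqP (Uy i j le_ji)).
rewrite big1 ?addr0 // => k ki; have [lt_ki|le_ik] := ltnP k i.
  by rewrite (eqP (Ux i k (ltnW lt_ki))) eq_sym (negPf ki) mul0r.
rewrite (eqP (Uy k j (leq_trans le_ji le_ik))).
have /negPf-> : k != j; last by rewrite mulr0.
apply: contra ki => /eqP kj; rewrite kj in le_ik *.
by rewrite -val_eqE eqn_leq le_ji.
Qed.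

Canonical unitriangular_group := Group unitriangular_group_set.

End Unitriangular.

Section CosetPoset.
Variable gT : finGroupType.

(* the family N_q : nilpotent subgroups of class at most q - 1 *)
Definition nilpotent_family (q : nat) (G : {group gT}) : {set {group gT}} :=
  [set H : {group gT} | [&& H \subset G, nilpotent H & (nil_class H < q)%N]]%SET.

(* the order on the coset poset is [\subset] *)
Definition coset_poset (Fam : {set {group gT}}) (G : {group gT}) :
    {set {set gT}} :=
  [set (x *: (H : {group gT}))%g | x in G, H in Fam]%SET.

End CosetPoset.

Definition order_complex (V : finType) (le : rel V) (P : {set V}) :
    {set {set V}} :=
  [set s : {set V} | [&& s != finset.set0, s \subset P &
     [forall x in s, forall y in s, le x y || le y x]]]%SET.

(* Barycentric coordinates in R^V. Since V is finite, the subspace topology is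
   the coherent (weak) topology of the complex. *)
Definition realization (R : realType) (V : finType) (K : {set {set V}}) :
    set {ptws V -> R} :=
  [set x : {ptws V -> R} | [/\ forall v, 0 <= x v, \sum_v x v = 1 &
     [set v | x v != 0]%SET \in K]].
Arguments realization R {V} K.

Definition coset_space (R : realType) (gT : finGroupType)
    (Fam : {set {group gT}}) (G : {group gT}) : topologicalType :=
  realization R (order_complex (fun A B : {set gT} => A \subset B)
                               (coset_poset Fam G)).

Definition sphere (R : realType) (n : nat) : set 'rV[R]_n.+1 :=
  [set x : 'rV[R]_n.+1 | \sum_i x ord0 i ^+ 2 = 1].
Arguments sphere : clear implicits.

Lemma sphere_base_subproof (R : realType) (n : nat) :
  delta_mx ord0 ord0 \in sphere R n.
Proof.
apply/mem_set; rewrite /sphere /= big_ord_recl big1 => [|i _].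
  by rewrite mxE !eqxx expr1n addr0.
by rewrite mxE andbC /= expr0n.
Qed.

Definition sphere_base (R : realType) (n : nat) : sphere R n :=
  SigSub (sphere_base_subproof R n).

(* The wedge over i of the spheres S^(d i). The library's wedge is empty when I
   is empty. *)
Definition sphere_wedge (R : realType) (I : choiceType) (d : I -> nat) :
    topologicalType :=
  wedge (fun i => sphere_base R (d i)).

Definition homotopic (R : realType) (X Y : topologicalType) (f g : X -> Y) :
    Prop :=
  exists H : X * R -> Y,
    [/\ {within [set: X] `*` `[0, 1], continuous H},
        forall x, H (x, 0) = f x & forall x, H (x, 1) = g x].

Definition homotopy_equivalent (R : realType) (X Y : topologicalType) : Prop :=
  exists (f : X -> Y) (g : Y -> X),
    [/\ continuous f, continuous g,
        homotopic R (g \o f) idfun & homotopic R (f \o g) idfun].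

(* Main.v *)
(* Let (a, b, c) be the superdiagonal of an element of G = U4(F_p). A subgroup H
   of G has class at most 2 iff the trilinear form
   (a b' - a' b) c'' - (b c' - b' c) a'' vanishes on its image in F_p^3. Hence the
   maximal such subgroups are the preimages of the planes a = 0, b = 0, c = 0 and,
   for p odd, of the lines b = s a, c = t a with s, t nonzero; for p = 2 the lines
   are absorbed by the plane a = c.

   Sending a coset to the first of the maximal cosets that contain it, in a
   suitable order, identifies the coset poset up to homotopy with a small flag
   complex: for p odd, the join of three sets of p points (the cosets of the
   planes) with one more vertex per coset of a line, joined to all the cosets of
   a = 0; for p = 2, the join of {a + c = i}, {a = i, c = i} and {b = i}. Deleting
   the open triangles, and the open edges ending at lines, that avoid chosen base
   vertices leaves a contractible complex; collapsing it gives the wedge. *)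
Require Import Defs.
From mathcomp Require Import all_boot all_order all_algebra all_fingroup.
From mathcomp Require Import nilpotent ring lra.
From mathcomp Require Import all_classical all_reals topology normedtype homotopy.
Set Implicit Arguments.
Unset Strict Implicit.
Unset Printing Implicit Defensive.
Import Order.TTheory GRing.Theory Num.Theory.
Import numFieldTopology.Exports numFieldNormedType.Exports.
Local Open Scope classical_set_scope.
Local Open Scope ring_scope.

(** * Continuity and homotopies *)

(** The trilinear form is the corner entry of a double commutator, so membership in the family
    depends only on the image of a subgroup in F_p^3, and the cosets that matter are preimages of
    affine subspaces. The order of the maximal cosets is what keeps the complex small. A line meets
    a coset of b = 0 or c = 0 in one point of F_p^3, and a point is already assigned to its coset of
    a = 0; hence lines are joined to cosets of a = 0 only. Likewise, for p = 2, cosets of a = 0 and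
    c = 0 are never joined, since their intersection lies in a coset of a + c = 0. In the other
    direction a simplex goes to the intersection of its cosets; this reverses inclusion, so the
    inverse map has to pass through the barycentric subdivision. The numbers of spheres are products
    of numbers of vertices: (p - 1) non-base cosets of a = 0 times p^2 (p - 1)^2 lines, and (p -
    1)^3 triangles, or 1 * 3 * 1 triangles when p = 2. All homotopies are explicit formulas in
    barycentric coordinates, so that continuity is checked one coordinate at a time. *)

Section RealFunctions.
Variables (R : realType) (Z : topologicalType).
Implicit Types f g : Z -> R.

Lemma continuous_addf f g :
  continuous f -> continuous g -> continuous (fun z => f z + g z).
Proof. by move=> cf cg z; apply: continuousD; [exact: cf|exact: cg]. Qed.

Lemma continuous_oppf f : continuous f -> continuous (fun z => - f z).
Proof. by move=> cf z; apply: continuousN; exact: cf. Qed.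

Lemma continuous_subf f g :
  continuous f -> continuous g -> continuous (fun z => f z - g z).
Proof. by move=> cf cg; apply: continuous_addf => //; exact: continuous_oppf. Qed.

Lemma continuous_mulf f g :
  continuous f -> continuous g -> continuous (fun z => f z * g z).
Proof. by move=> cf cg z; apply: continuousM; [exact: cf|exact: cg]. Qed.

Lemma continuous_divf f g : (forall z, g z != 0) ->
  continuous f -> continuous g -> continuous (fun z => f z / g z).
Proof.
move=> g0 cf cg; apply: continuous_mulf => // z.
by apply: continuousV; [exact: g0|exact: cg].
Qed.

Lemma continuous_minf f g :
  continuous f -> continuous g -> continuous (fun z => Num.min (f z) (g z)).
Proof. by move=> cf cg z; apply: continuous_min; [exact: cf|exact: cg]. Qed.

Lemma continuous_maxf f g :
  continuous f -> continuous g -> continuous (fun z => Num.max (f z) (g z)).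
Proof. by move=> cf cg z; apply: continuous_max; [exact: cf|exact: cg]. Qed.

Lemma continuous_cstf (c : R) : continuous (fun _ : Z => c).
Proof. by move=> z; exact: cst_continuous. Qed.

Lemma continuous_bigf (op : R -> R -> R) (idx : R) (I : Type) (r : seq I)
    (P : pred I) (F : I -> Z -> R) :
  (forall f g, continuous f -> continuous g ->
     continuous (fun z => op (f z) (g z))) ->
  (forall i, P i -> continuous (F i)) ->
  continuous (fun z => \big[op/idx]_(i <- r | P i) F i z).
Proof.
move=> cop cF; elim: r => [|i r IH].
  rewrite (_ : (fun z => _) = fun=> idx); first exact: continuous_cstf.
  by apply/funext => z; rewrite big_nil.
rewrite (_ : (fun z => _) = fun z => if P i then
    op (F i z) (\big[op/idx]_(j <- r | P j) F j z)
    else \big[op/idx]_(j <- r | P j) F j z); last first.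
  by apply/funext => z; rewrite big_cons.
by case Pi: (P i) => //; apply: cop => //; exact: cF.
Qed.

Lemma continuous_sumf (I : Type) (r : seq I) (P : pred I) (F : I -> Z -> R) :
  (forall i, P i -> continuous (F i)) ->
  continuous (fun z => \sum_(i <- r | P i) F i z).
Proof. by apply: continuous_bigf => f g; exact: continuous_addf. Qed.

Lemma continuous_prodf (I : Type) (r : seq I) (P : pred I) (F : I -> Z -> R) :
  (forall i, P i -> continuous (F i)) ->
  continuous (fun z => \prod_(i <- r | P i) F i z).
Proof. by apply: continuous_bigf => f g; exact: continuous_mulf. Qed.

End RealFunctions.

Section ContinuousInto.
Variables (Z : topologicalType).

Lemma continuous_pairf (X Y : topologicalType) (f : Z -> X) (g : Z -> Y) :
  continuous f -> continuous g -> continuous (fun z => (f z, g z)).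
Proof. by move=> cf cg z; apply: cvg_pair; [exact: cf|exact: cg]. Qed.

Lemma continuous_fstf (Y : topologicalType) : continuous (fun z : Z * Y => z.1).
Proof. by move=> z; exact: cvg_fst. Qed.

Lemma continuous_sndf (Y : topologicalType) : continuous (fun z : Z * Y => z.2).
Proof. by move=> z; exact: cvg_snd. Qed.

Lemma continuous_compf (X Y : topologicalType) (f : Z -> X) (g : X -> Y) :
  continuous f -> continuous g -> continuous (fun z => g (f z)).
Proof. by move=> cf cg z; apply: continuous_comp; [exact: cf|exact: cg]. Qed.

Lemma continuous_set_type (X : topologicalType) (A : set X) (f : Z -> A) :
  continuous (fun z => set_val (f z)) -> continuous f.
Proof. exact: (@continuous_comp_initial A Z X set_val). Qed.

Lemma continuous_set_val (X : topologicalType) (A : set X) :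
  continuous (fun x : A => set_val x).
Proof. exact: (@initial_continuous A X set_val). Qed.

Lemma continuous_prod_topology (I : choiceType) (T : I -> topologicalType)
    (f : Z -> prod_topology T) :
  (forall i, continuous (fun z => f z i)) -> continuous f.
Proof.
move=> cf z; apply/cvg_sup => i U [V] [[W oW <-]] Wfz VU.
by apply: (filterS VU); apply: (cf i); exact: open_nbhs_nbhs.
Qed.

Lemma continuous_row (R : realType) (n : nat) (f : Z -> 'rV[R]_n) :
  (forall i, continuous (fun z => f z ord0 i)) -> continuous f.
Proof.
move=> cf z A [P nP PA].
have : \forall z' \near z, forall i j, P i j (f z' i j).
  apply: filter_forall => i; apply: filter_forall => j.
  by rewrite (ord1 i); apply: cf; have := nP ord0 j.
by apply: filterS => z' Pz'; exact: PA.
Qed.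

End ContinuousInto.

(** * Points of a realization as barycentric coordinates *)

Section Realization.
Variables (R : realType) (V : finType).
Implicit Types K : {set {set V}}.

Definition bary K (x : realization R K) (v : V) : R := (set_val x : V -> R) v.

Lemma baryP K (x : realization R K) : realization R K (bary x).
Proof. exact: set_valP. Qed.

Lemma bary_inj K (x y : realization R K) : bary x =1 bary y -> x = y.
Proof. by move=> xy; apply: val_inj; apply/funext. Qed.

Lemma continuous_bary K v : continuous (fun x : realization R K => bary x v).
Proof.
move=> x; apply: (@continuous_comp _ {ptws V -> R} _ set_val (fun y => y v)).
  exact: continuous_set_val.
exact: (@proj_continuous V (fun=> R) v).
Qed.

Definition to_realization (Z : Type) K (f : Z -> V -> R)
    (fK : forall z, realization R K (f z)) (z : Z) : realization R K :=
  SigSub (mem_set (fK z)).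

Lemma bary_to_realization (Z : Type) K (f : Z -> V -> R)
    (fK : forall z, realization R K (f z)) z :
  bary (to_realization fK z) = f z.
Proof. by []. Qed.

Lemma continuous_to_realization (Z : topologicalType) K (f : Z -> V -> R)
    (fK : forall z, realization R K (f z)) :
  (forall v, continuous (fun z => f z v)) -> continuous (to_realization fK).
Proof.
move=> cf; apply: continuous_set_type.
by apply: (@continuous_prod_topology _ V (fun=> R)).
Qed.

Lemma bary_ge0 K (x : realization R K) v : 0 <= bary x v.
Proof. by have [] := baryP x. Qed.

Lemma bary_sum K (x : realization R K) : \sum_v bary x v = 1.
Proof. by have [] := baryP x. Qed.

Lemma bary_supp K (x : realization R K) : [set v | bary x v != 0]%SET \in K.
Proof. by have [] := baryP x. Qed.

Definition down_closed K :=
  forall s s' : {set V}, s \in K -> s' \subset s -> s' != finset.set0 -> s' \in K.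

(** Down-closure turns an upper bound [s] for the support into membership of the support itself,
    which is non-empty because the coordinates sum to 1. *)
Lemma realization_in K (f : V -> R) (s : {set V}) : down_closed K ->
  (forall v, 0 <= f v) -> \sum_v f v = 1 -> s \in K ->
  (forall v, f v != 0 -> v \in s) -> realization R K f.
Proof.
move=> dK f0 f1 sK fs; split => //.
apply: (dK s) => //; first by apply/fintype.subsetP => v; rewrite inE; exact: fs.
apply/negP => /eqP z; have := oner_neq0 R; rewrite -f1 big1 ?eqxx // => v _.
apply/eqP/negPn/negP => fv; have : v \in [set v | f v != 0]%SET by rewrite inE.
by rewrite z inE.
Qed.

Lemma order_complex_down_closed (le : rel V) (P : {set V}) :
  down_closed (order_complex le P).
Proof.
move=> s s'; rewrite !inE => /and3P[_ sP cs] ss' ->/=.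
rewrite (fintype.subset_trans ss' sP)/=; apply/'forall_implyP => x xs'.
apply/'forall_implyP => y ys'.
have /'forall_implyP/(_ x (fintype.subsetP ss' _ xs'))/'forall_implyP := cs.
by apply; exact: (fintype.subsetP ss').
Qed.

End Realization.

(** * Homotopies and quotients of compact spaces *)

Section Homotopy.
Variable R : realType.

Lemma homotopic_of_continuous (X Y : topologicalType) (f g : X -> Y)
    (H : X * R -> Y) : continuous H ->
  (forall x, H (x, 0) = f x) -> (forall x, H (x, 1) = g x) -> homotopic R f g.
Proof. by move=> cH H0 H1; exists H; split => //; exact: continuous_subspaceT. Qed.

(** The retraction of the line onto the unit interval. Precomposing the time of a homotopy with it
    gives a map continuous on all of [X * R], so that subspace continuity need not be carried
    along. *)
Definition clamp (t : R) : R := Num.max 0 (Num.min t 1).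

Lemma clamp_itv t : 0 <= clamp t <= 1.
Proof. by rewrite /clamp le_max lexx ge_max ge_min lexx orbT ler01. Qed.

Lemma clamp_ge0 t : 0 <= clamp t. Proof. by case/andP: (clamp_itv t). Qed.

Lemma clamp0 t : t <= 0 -> clamp t = 0.
Proof. by move=> t0; rewrite /clamp min_l ?max_l //; apply: le_trans t0 _. Qed.

Lemma clamp1 t : 1 <= t -> clamp t = 1.
Proof. by move=> t1; rewrite /clamp min_r // max_r. Qed.

Lemma continuous_clamp (Z : topologicalType) (f : Z -> R) :
  continuous f -> continuous (fun z => clamp (f z)).
Proof.
move=> cf; apply: continuous_maxf; first exact: continuous_cstf.
by apply: continuous_minf => //; exact: continuous_cstf.
Qed.

Lemma continuous_homotopy_clamp (X Y : topologicalType) (H : X * R -> Y) :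
  {within [set: X] `*` `[0, 1], continuous H} ->
  continuous (fun z : X * R => H (z.1, clamp z.2)).
Proof.
move=> /subspace_sigL_continuousP cH.
have in01 (z : X * R) : (z.1, clamp z.2) \in [set: X] `*` `[0, 1].
  by apply/mem_set; split => //=; rewrite in_itv; exact: clamp_itv.
pose k (z : X * R) : [set: X] `*` `[0, 1] := SigSub (in01 z).
have ck : continuous k.
  have c2 : continuous (fun z : X * R => clamp z.2).
    by apply: continuous_clamp => u; exact: cvg_snd.
  apply: continuous_set_type.
  exact: (continuous_pairf (@continuous_fstf X R) c2).
exact: (continuous_compf ck cH).
Qed.

Lemma homotopic_trans (X Y : topologicalType) (f g h : X -> Y) :
  homotopic R f g -> homotopic R g h -> homotopic R f h.
Proof.
move=> [H [cH H0 H1]] [G [cG G0 G1]].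
pose HG z := if z.2 <= 2^-1 then H (z.1, clamp (2 * z.2))
             else G (z.1, clamp (2 * z.2 - 1)).
apply: (homotopic_of_continuous (H := HG)); last 2 first.
- by move=> x; rewrite /HG /= invr_ge0 ler0n mulr0 clamp0.
- by move=> x; rewrite /HG /= ifF; [rewrite clamp1 //; lra|apply/negP; lra].
have c2 : continuous (fun z : X * R => z.2) by move=> u; exact: cvg_snd.
have aff (a b : R) : continuous (fun z : X * R => (z.1, a * z.2 + b)).
  have c : continuous (fun z : X * R => a * z.2 + b).
    apply: continuous_addf; last exact: continuous_cstf.
    by apply: continuous_mulf => //; exact: continuous_cstf.
  exact: (continuous_pairf (@continuous_fstf _ _) c).
have cH' : continuous (fun z : X * R => H (z.1, clamp (2 * z.2))).
  rewrite (_ : (fun z => _) = fun z : X * R => H (z.1, clamp (2 * z.2 + 0))).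
    exact: (continuous_compf (aff 2 0) (continuous_homotopy_clamp cH)).
  by apply/funext => z; rewrite addr0.
have cG' : continuous (fun z : X * R => G (z.1, clamp (2 * z.2 - 1))).
  exact: (continuous_compf (aff 2 (-1)) (continuous_homotopy_clamp cG)).
apply/continuous_subspace_setT.
rewrite (_ : [set: X * R] = [set z | z.2 <= 2^-1] `|` [set z | 2^-1 <= z.2]); last first.
  by apply/seteqP; split => // z _ /=; case: (leP z.2 2^-1) => h1; [left|right; exact: ltW].
apply: withinU_continuous.
- exact: (@preimage_closed _ _ (fun z : X * R => z.2) [set t : R | t <= 2^-1]).
- exact: (@preimage_closed _ _ (fun z : X * R => z.2) [set t : R | 2^-1 <= t]).
- apply: (@subspace_eq_continuous _ _ _ (fun z : X * R => H (z.1, clamp (2 * z.2)))).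
    by move=> z; rewrite /HG /from_subspace inE /= => ->.
  exact: continuous_subspaceT.
- apply: (@subspace_eq_continuous _ _ _ (fun z : X * R => G (z.1, clamp (2 * z.2 - 1)))).
    move=> z; rewrite /HG /from_subspace inE /= => h1; case: ifP => // h2.
    have -> : z.2 = 2^-1 by apply/eqP; rewrite eq_le h1 h2.
    by rewrite divff ?pnatr_eq0 // subrr (clamp1 (lexx 1)) (clamp0 (lexx 0)) H1 G0.
  exact: continuous_subspaceT.
Qed.

Lemma homotopic_compl (X Y Z : topologicalType) (f g : X -> Y) (h : Y -> Z) :
  continuous h -> homotopic R f g -> homotopic R (h \o f) (h \o g).
Proof.
move=> ch [H [cH H0 H1]].
apply: (homotopic_of_continuous (H := fun z => h (H (z.1, clamp z.2)))).
- exact: (continuous_compf (continuous_homotopy_clamp cH) ch).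
- by move=> x /=; rewrite clamp0 // H0.
- by move=> x /=; rewrite clamp1 // H1.
Qed.

Lemma homotopic_compr (X Y Z : topologicalType) (f g : X -> Y) (h : Z -> X) :
  continuous h -> homotopic R f g -> homotopic R (f \o h) (g \o h).
Proof.
move=> ch [H [cH H0 H1]].
apply: (homotopic_of_continuous (H := fun z => H (h z.1, clamp z.2))).
- have cp : continuous (fun z : Z * R => (h z.1, z.2)).
    apply: continuous_pairf; last exact: continuous_sndf.
    exact: (continuous_compf (@continuous_fstf Z R) ch).
  exact: (continuous_compf cp (continuous_homotopy_clamp cH)).
- by move=> x /=; rewrite clamp0 // H0.
- by move=> x /=; rewrite clamp1 // H1.
Qed.

Lemma homotopy_equivalent_trans (X Y Z : topologicalType) :
  homotopy_equivalent R X Y -> homotopy_equivalent R Y Z ->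
  homotopy_equivalent R X Z.
Proof.
move=> [f [g [cf cg gf fg]]] [f' [g' [cf' cg' gf' fg']]].
exists (f' \o f), (g \o g'); split.
- exact: continuous_compf cf cf'.
- exact: continuous_compf cg' cg.
- apply: homotopic_trans gf.
  exact: (homotopic_compl cg (homotopic_compr cf gf')).
- apply: homotopic_trans fg'.
  exact: (homotopic_compl cf' (homotopic_compr cg' fg)).
Qed.

(* The quotient map [q] is not known to be open or closed; near-covering
   compactness of [X] replaces the tube lemma. *)
Lemma continuous_fiberwise (X W Z Y : topologicalType) (q : X -> W) (s : W -> X)
    (F : X * Z -> Y) :
  compact [set: X] -> hausdorff_space W -> continuous q -> cancel s q ->
  continuous F -> (forall x y z, q x = q y -> F (x, z) = F (y, z)) ->
  continuous (fun wz : W * Z => F (s wz.1, wz.2)).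
Proof.
move=> cX hW cq sK cF Fq [w0 z0] U /= nU.
have : \forall wz \near (w0, z0), forall x, q x = wz.1 -> U (F (x, wz.2)).
  have /compact_near_coveringP/(_ _ (nbhs (w0, z0))
    (fun wz x => q x = wz.1 -> U (F (x, wz.2)))) := cX.
  have nP x : [set: X] x -> \forall x' \near x & wz \near (w0, z0),
      q x' = wz.1 -> U (F (x', wz.2)).
    move=> _; have [qx|/eqP qx] := eqVneq (q x) w0.
      have : \forall y \near (x, z0), U (F y).
        by apply: cF; rewrite (Fq _ (s w0)) // sK.
      case=> -[A B] /= [nA nB] AB.
      exists (A, [set wz | B wz.2]) => /=.
        by split => //; exact: (@continuous_sndf W Z (w0, z0) B nB).
      by move=> [x' [w z]] /= [Ax Bz] _; exact: (AB (x', z)).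
    have := hW; rewrite open_hausdorff => /(_ (q x) w0) [|[A B] /= [xA wB]].
      exact/eqP.
    move=> [oA oB AB].
    exists (q @^-1` A, [set wz | B wz.1]) => /=.
      split; first by apply: cq; apply: open_nbhs_nbhs; split => //; exact: set_mem.
      apply: (@continuous_fstf W Z (w0, z0) B).
      by apply: open_nbhs_nbhs; split => //; exact: set_mem.
    move=> [x' [w z]] /= [Ax Bw] qw; exfalso.
    by have : (A `&` B) w by [split => //; rewrite -qw]; rewrite (eqP AB).
  by move/(_ _ nP); apply: filterS => wz h x; exact: h.
by apply: filterS => -[w z] /= h; apply: h; rewrite sK.
Qed.

(** Since [H (-, 1)] is constant on the fibres of [q], it descends to a map from [W] to [X]. Run
    backwards, [H] and the homotopy it induces on [W] show that this map is inverse to [q]. This is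
    the usual argument for collapsing a contractible subspace, with [H] in the role of the extended
    homotopy. *)
Lemma homotopy_equivalent_quotient (X W : topologicalType) (q : X -> W)
    (H : X * R -> X) :
  compact [set: X] -> hausdorff_space W -> continuous q ->
  (forall w, exists x, q x = w) -> continuous H ->
  (forall x, H (x, 0) = x) ->
  (forall x y t, q x = q y -> q (H (x, t)) = q (H (y, t))) ->
  (forall x y, q x = q y -> H (x, 1) = H (y, 1)) ->
  homotopy_equivalent R X W.
Proof.
move=> cX hW cq qsurj cH H0 Hq H1.
(* The section [s] is chosen pointwise and may be discontinuous; every map built from it is constant
   along the fibres of [q], hence continuous by [continuous_fiberwise]. *)
have [s sK] : {s : W -> X | cancel s q}.
  by exists (fun w => projT1 (cid (qsurj w))) => w; case: cid.
have rev (Y : topologicalType) : continuous (fun z : Y * R => (z.1, 1 - z.2)).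
  have c : continuous (fun z : Y * R => 1 - z.2).
    apply: continuous_subf; first exact: continuous_cstf.
    by move=> u; exact: cvg_snd.
  exact: (continuous_pairf (@continuous_fstf _ _) c).
exists q, (fun w => H (s w, 1)); split => //.
- have cF := @continuous_fiberwise X W R X q s (fun z => H (z.1, 1)) cX hW cq sK.
  have c1 : continuous (fun z : X * R => H (z.1, 1)).
    apply: (continuous_compf (f := fun z : X * R => (z.1, 1 : R)) _ cH).
    by apply: continuous_pairf; [exact: continuous_fstf|exact: continuous_cstf].
  have {}cF := cF c1 (fun x y _ => H1 x y).
  apply: (continuous_compf (f := fun w : W => (w, 0 : R)) _ cF).
  by apply: continuous_pairf; [move=> w; exact: cvg_id|exact: continuous_cstf].
- apply: (homotopic_of_continuous (H := fun z => H (z.1, 1 - z.2))).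
  + exact: (continuous_compf (rev X) cH).
  + by move=> x /=; rewrite subr0; apply: H1; rewrite sK.
  + by move=> x /=; rewrite subrr H0.
- have cF := @continuous_fiberwise X W R W q s (q \o H) cX hW cq sK.
  have c1 : continuous (q \o H).
    exact: continuous_compf cH cq.
  have {}cF := cF c1 Hq.
  apply: (homotopic_of_continuous (H := fun z => q (H (s z.1, 1 - z.2)))).
  + exact: (continuous_compf (rev W) cF).
  + by move=> x /=; rewrite subr0.
  + by move=> x /=; rewrite subrr H0 sK.
Qed.

Lemma homotopic_straight_line (Z : topologicalType) (V : finType)
    (K : {set {set V}}) (f g : Z -> realization R K) :
  down_closed K -> continuous f -> continuous g ->
  (forall z, exists2 s, s \in K &
     forall v, bary (f z) v != 0 \/ bary (g z) v != 0 -> v \in s) ->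
  homotopic R f g.
Proof.
move=> dK cf cg fg.
pose F (z : Z * R) v :=
  (1 - clamp z.2) * bary (f z.1) v + clamp z.2 * bary (g z.1) v.
have FK z : realization R K (F z).
  have [s sK sfg] := fg z.1.
  have /andP[c0 c1] := clamp_itv z.2.
  apply: (realization_in dK (s := s)) => //.
  - by move=> v; rewrite addr_ge0 // mulr_ge0 ?bary_ge0 // subr_ge0.
  - by rewrite big_split -!mulr_sumr !bary_sum /= !mulr1 subrK.
  move=> v Fv; apply: sfg; have [fv|] := eqVneq (bary (f z.1) v) 0; last by left.
  by right; apply: contra_neq Fv => gv; rewrite /F fv gv !mulr0 addr0.
have c1 v (h : Z -> realization R K) : continuous h ->
    continuous (fun z : Z * R => bary (h z.1) v).
  move=> ch; have cb := continuous_compf ch (@continuous_bary R V K v).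
  exact: (continuous_compf (@continuous_fstf Z R) cb).
have c2 : continuous (fun z : Z * R => clamp z.2).
  by apply: continuous_clamp => u; exact: cvg_snd.
apply: (homotopic_of_continuous (H := to_realization FK)).
- apply: continuous_to_realization => v; apply: continuous_addf.
    apply: continuous_mulf; last exact: c1.
    by apply: continuous_subf => //; exact: continuous_cstf.
  by apply: continuous_mulf; [exact: c2|exact: c1].
- move=> z; apply: bary_inj => v.
  by rewrite bary_to_realization /F /= clamp0 // subr0 mul1r mul0r addr0.
- move=> z; apply: bary_inj => v.
  by rewrite bary_to_realization /F /= clamp1 // subrr mul1r mul0r add0r.
Qed.

End Homotopy.

(** * From a poset to a flag complex *)

Section Normalization.
Variables (R : realType) (T : finType).
Implicit Types f : T -> R.

(** Points are described by weights up to a positive factor and rescaled at the end, so that only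
    signs, supports and continuity have to be controlled. *)
Definition normalize f (a : T) : R := f a / \sum_b f b.

Lemma sum_gt0_of_ge0 f a :
  (forall b, 0 <= f b) -> f a != 0 -> 0 < \sum_b f b.
Proof.
move=> f0 fa; rewrite (bigD1 a) //= ltr_wpDr ?sumr_ge0 // lt_def fa f0.
by [].
Qed.

Lemma normalize_sum1 f : \sum_b f b = 1 -> normalize f = f.
Proof. by move=> f1; apply/funext => a; rewrite /normalize f1 divr1. Qed.

Lemma realization_normalize (le : rel T) (P : {set T}) f :
  (forall a, 0 <= f a) -> (exists a, f a != 0) ->
  (forall a, f a != 0 -> a \in P) ->
  (forall a b, f a != 0 -> f b != 0 -> le a b || le b a) ->
  realization R (order_complex le P) (normalize f).
Proof.
move=> f0 [a fa] fP fle.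
have S0 : 0 < \sum_b f b by exact: sum_gt0_of_ge0 fa.
have nE b : (normalize f b != 0) = (f b != 0).
  by rewrite mulf_eq0 invr_eq0 (gt_eqF S0) orbF.
split.
- by move=> b; rewrite divr_ge0 // ltW.
- by rewrite -mulr_suml divff // gt_eqF.
rewrite inE; apply/and3P; split.
- by apply/set0Pn; exists a; rewrite inE nE.
- by apply/fintype.subsetP => b; rewrite inE nE; exact: fP.
apply/'forall_implyP => b; rewrite inE nE => fb.
by apply/'forall_implyP => c; rewrite inE nE; exact: fle.
Qed.

Lemma continuous_normalize (Z : topologicalType) (F : Z -> T -> R) a :
  (forall z b, 0 <= F z b) -> (forall z, exists b, F z b != 0) ->
  (forall b, continuous (fun z => F z b)) ->
  continuous (fun z => normalize (F z) a).
Proof.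
move=> F0 Fn cF; apply: continuous_divf => //; last first.
  by apply: continuous_sumf => b _; exact: cF.
by move=> z; have [b Fb] := Fn z; rewrite gt_eqF //; exact: sum_gt0_of_ge0 Fb.
Qed.

End Normalization.

(** * Barycentric subdivision through superlevel sets *)

Section LevelSets.
Variables (R : realType) (V : finType).
Implicit Types (y : V -> R) (s : {set V}).

(* Up to a positive factor, the barycentric coordinate of [y] at the vertex [s]
   of the barycentric subdivision: it is positive exactly when [s] is a
   superlevel set of [y] contained in the support. *)
Definition level_weight y s : R :=
  \prod_(v in s) (y v * \prod_(w in ~: s) Num.max 0 (y v - y w)).

Lemma level_weight_ge0 y s : (forall v, 0 <= y v) -> 0 <= level_weight y s.
Proof.
move=> y0; apply: prodr_ge0 => v _; rewrite mulr_ge0 //.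
by apply: prodr_ge0 => w _; rewrite le_max lexx.
Qed.

Lemma level_weight_supp y s v : level_weight y s != 0 -> v \in s -> y v != 0.
Proof. by move=> /prodf_neq0 + vs => /(_ _ vs); rewrite mulf_eq0 negb_or => /andP[]. Qed.

Lemma level_weight_lt y s v w :
  level_weight y s != 0 -> v \in s -> w \notin s -> y w < y v.
Proof.
move=> /prodf_neq0 + vs ws => /(_ _ vs); rewrite mulf_eq0 negb_or => /andP[_].
move=> /prodf_neq0 /(_ w); rewrite inE ws => /(_ isT).
by apply: contra_neqT; rewrite -leNgt => vw; rewrite max_l // subr_le0.
Qed.

Lemma level_weight_nested y s s' :
  level_weight y s != 0 -> level_weight y s' != 0 ->
  (s \subset s') || (s' \subset s).
Proof.
move=> ns ns'; case: (boolP (s \subset s')) => //= /fintype.subsetPn[v vs vs'].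
apply/fintype.subsetP => w ws'; apply/negPn/negP => ws.
have := level_weight_lt ns vs ws.
by rewrite ltNge (ltW (level_weight_lt ns' ws' vs')).
Qed.

(** The support is itself a superlevel set. Hence the weights of a point of the complex never vanish
    together, and they can be normalized. *)
Lemma level_weight_support y : (forall v, 0 <= y v) ->
  level_weight y [set v | y v != 0]%SET != 0.
Proof.
move=> y0; apply/prodf_neq0 => v; rewrite inE => yv.
rewrite mulf_neq0 //; apply/prodf_neq0 => w; rewrite !inE negbK => /eqP ->.
by rewrite subr0 max_r.
Qed.

Lemma continuous_level_weight (Z : topologicalType) (F : Z -> V -> R) s :
  (forall v, continuous (fun z => F z v)) ->
  continuous (fun z => level_weight (F z) s).
Proof.
move=> cF; apply: continuous_prodf => v _; apply: continuous_mulf => //.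
apply: continuous_prodf => w _; apply: continuous_maxf.
  exact: continuous_cstf.
exact: continuous_subf.
Qed.

End LevelSets.

Section Pushforward.
Variables (R : realType) (T V : finType) (phi : T -> V).

Definition pushforward (y : T -> R) (v : V) : R := \sum_(a | phi a == v) y a.

Lemma pushforward_ge0 y v : (forall a, 0 <= y a) -> 0 <= pushforward y v.
Proof. by move=> y0; exact: sumr_ge0. Qed.

Lemma pushforward_sum y : \sum_v pushforward y v = \sum_a y a.
Proof. by rewrite (partition_big phi predT). Qed.

Lemma pushforward_supp y v :
  pushforward y v != 0 -> exists2 a, phi a = v & y a != 0.
Proof.
case: (boolP [exists a, (phi a == v) && (y a != 0)]).
  by move=> /existsP[a /andP[/eqP pa ya]] _; exists a.
rewrite negb_exists => /forallP h; rewrite /pushforward big1 ?eqxx // => a pa.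
by move: (h a); rewrite pa negbK => /eqP.
Qed.

Lemma continuous_pushforward (Z : topologicalType) (F : Z -> T -> R) v :
  (forall a, continuous (fun z => F z a)) ->
  continuous (fun z => pushforward (F z) v).
Proof. by move=> cF; apply: continuous_sumf => a _; exact: cF. Qed.

End Pushforward.

(** * Cutting the mass of a chain at a given level *)

Section TopMass.
Variables (R : realType) (T : finType) (le : rel T).
Implicit Types x : T -> R.

Definition mass_above x a : R := \sum_(b | (b != a) && le a b) x b.

(* Order the mass of a chain from its top element downwards and keep the first
   [t] units. *)
Definition top_mass x (t : R) a : R :=
  Num.min (mass_above x a + x a) t - Num.min (mass_above x a) t.

Lemma mass_above_ge0 x a : (forall b, 0 <= x b) -> 0 <= mass_above x a.
Proof. by move=> x0; exact: sumr_ge0. Qed.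

Lemma top_mass_ge0 x t a : (forall b, 0 <= x b) -> 0 <= top_mass x t a.
Proof.
move=> x0; have := x0 a; rewrite /top_mass.
by case: (leP (mass_above x a + x a) t); case: (leP (mass_above x a) t); lra.
Qed.

Lemma top_mass_le x t a : (forall b, 0 <= x b) -> top_mass x t a <= x a.
Proof.
move=> x0; have := x0 a; rewrite /top_mass.
by case: (leP (mass_above x a + x a) t); case: (leP (mass_above x a) t); lra.
Qed.

Lemma top_mass_supp x t a : (forall b, 0 <= x b) -> top_mass x t a != 0 -> x a != 0.
Proof.
move=> x0; apply: contra_neq => xa; apply/eqP; rewrite eq_le top_mass_ge0 //.
by rewrite andbT -xa top_mass_le.
Qed.

Lemma top_mass0 x a : (forall b, 0 <= x b) -> top_mass x 0 a = 0.
Proof.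
by move=> x0; rewrite /top_mass !min_r ?subrr // ?addr_ge0 // mass_above_ge0.
Qed.

(** On a chain the intervals from [mass_above x a] to [mass_above x a + x a] are stacked from the
    top element downwards: that of [b] cannot start before that of the larger [a] ends. *)
Lemma mass_above_lt x a b : reflexive le -> antisymmetric le -> transitive le ->
  (forall c, 0 <= x c) -> le b a -> a != b ->
  mass_above x a + x a <= mass_above x b.
Proof.
move=> rle ale tle x0 ba nab.
rewrite addrC /mass_above [X in _ <= X](bigD1 a) /=; last by rewrite nab.
rewrite lerD2l big_mkcond [X in _ <= X]big_mkcond /=; apply: ler_sum => c _.
case: ifP => [/andP[ca ac]|_]; last by case: ifP.
rewrite (tle _ _ _ ba ac) ca !andbT; case: eqVneq => //= cb.
by move: nab; rewrite (ale a b) ?eqxx // -{1}cb ac ba.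
Qed.

Lemma mass_above_le_sum x a : (forall c, 0 <= x c) ->
  mass_above x a + x a <= \sum_b x b.
Proof.
move=> x0; rewrite addrC [X in _ <= X](bigD1 a) //= lerD2l.
rewrite /mass_above big_mkcond [X in _ <= X]big_mkcond /=; apply: ler_sum => c _.
by case: eqVneq => //= _; case: ifP.
Qed.

Lemma top_mass1 x a : (forall b, 0 <= x b) -> \sum_b x b = 1 -> top_mass x 1 a = x a.
Proof.
move=> x0 x1; have h := mass_above_le_sum a x0; rewrite x1 in h.
rewrite /top_mass !min_l //; first by rewrite addrC addKr.
by apply: le_trans h; rewrite lerDl.
Qed.

(** The cut at level [t] passes through at most one element of a chain: what lies strictly above it
    is taken whole, and nothing strictly below it is taken. So an element with mass left is below
    every element from which mass was taken. *)
Lemma top_mass_order x t a b :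
  reflexive le -> antisymmetric le -> transitive le -> (forall c, 0 <= x c) ->
  x a != top_mass x t a -> top_mass x t b != 0 ->
  le a b || le b a -> le a b.
Proof.
move=> rle ale tle x0 na nb /orP[//|ba].
case: (eqVneq a b) => [->|nab]; first exact: rle.
have h := mass_above_lt rle ale tle x0 ba nab.
have ht : t < mass_above x a + x a.
  rewrite ltNge; apply: contra_neqN na => ht.
  rewrite /top_mass !min_l //; first by rewrite addrC addKr.
  by apply: le_trans ht; rewrite lerDl.
have hb : mass_above x b < t.
  rewrite ltNge; apply: contra_neqN nb => hb.
  rewrite /top_mass !min_r ?subrr //.
  by apply: le_trans hb _; rewrite lerDl.
by have := lt_trans hb ht; rewrite ltNge h.
Qed.

Lemma continuous_top_mass (Z : topologicalType) (F : Z -> T -> R) (t : Z -> R) a :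
  (forall b, continuous (fun z => F z b)) -> continuous t ->
  continuous (fun z => top_mass (F z) (t z) a).
Proof.
move=> cF ct.
have cm : continuous (fun z => mass_above (F z) a).
  by apply: continuous_sumf => b _; exact: cF.
apply: continuous_subf; apply: continuous_minf => //.
exact: continuous_addf.
Qed.

End TopMass.

(** * Comparison of an order complex with a complex of vertices *)

Section PosetNerve.
Variables (R : realType) (T V : finType) (le : rel T) (P : {set T}).
Variables (K : {set {set V}}) (phi : T -> V) (meet : {set V} -> T).
Hypotheses (le_refl : reflexive le) (le_asym : antisymmetric le).
Hypothesis le_tr : transitive le.
Hypotheses (K_down : down_closed K) (K_set0 : finset.set0 \notin K).
Hypothesis phi_simplicial : forall s, s \in order_complex le P -> phi @: s \in K.
Hypothesis meetP : forall s, s \in K -> meet s \in P.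
Hypothesis meet_anti : forall s s', s' \in K -> s \in K -> s \subset s' ->
  le (meet s') (meet s).
Hypothesis le_meet : forall (s : {set T}) (a : T) (s' : {set V}), s \in order_complex le P ->
  (forall b, b \in s -> le a b) -> s' != finset.set0 -> s' \subset phi @: s ->
  le a (meet s').
Hypothesis phi_meet : forall s, s \in K -> phi (meet s) \in s.

Let D := order_complex le P.

(** Barycentric subdivision followed by the linear extension of [meet]: each superlevel set [s] of
    [y] gives its weight to [meet s]. Superlevel sets are nested, so their meets form a chain. *)
Let lift (y : V -> R) (a : T) : R := \sum_(s in K | meet s == a) level_weight y s.

Let lift_ge0 y a : (forall v, 0 <= y v) -> 0 <= lift y a.
Proof. by move=> y0; apply: sumr_ge0 => s _; exact: level_weight_ge0. Qed.

Let lift_supp y a : lift y a != 0 ->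
  exists s, [/\ s \in K, meet s = a & level_weight y s != 0].
Proof.
case: (boolP [exists s, [&& s \in K, meet s == a & level_weight y s != 0]]).
  by move=> /existsP[s /and3P[sK /eqP ms ls]] _; exists s.
rewrite negb_exists => /forallP h; rewrite /lift big1 ?eqxx // => s /andP[sK ms].
by move: (h s); rewrite sK ms negbK => /eqP.
Qed.

Let lift_neq0 y : (forall v, 0 <= y v) -> [set v | y v != 0]%SET \in K ->
  lift y (meet [set v | y v != 0]%SET) != 0.
Proof.
move=> y0 yK; rewrite /lift (bigD1 [set v | y v != 0]%SET) /=; last by rewrite yK eqxx.
rewrite gt_eqF // ltr_wpDr //.
  by apply: sumr_ge0 => s _; exact: level_weight_ge0.
by rewrite lt_def level_weight_support // level_weight_ge0.
Qed.

Let continuous_lift (Z : topologicalType) (F : Z -> V -> R) a :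
  (forall v, continuous (fun z => F z v)) -> continuous (fun z => lift (F z) a).
Proof.
by move=> cF; apply: continuous_sumf => s _; exact: continuous_level_weight.
Qed.

Let level_neq0 s : s \in K -> s != finset.set0.
Proof. by apply: contraTneq => ->. Qed.

Let lift_le y a b : lift y a != 0 -> lift y b != 0 -> le a b || le b a.
Proof.
move=> /lift_supp[s [sK <- ls]] /lift_supp[s' [s'K <- ls']].
by case/orP: (level_weight_nested ls ls') => ss; apply/orP; [right|left];
  exact: meet_anti.
Qed.

Let lift_in y a : lift y a != 0 -> a \in P.
Proof. by move=> /lift_supp[s [sK <- _]]; exact: meetP. Qed.

Let fE (x : realization R D) : realization R K (pushforward phi (bary x)).
Proof.
apply: (realization_in K_down (s := phi @: [set a | bary x a != 0]%SET)).
- by move=> v; apply: pushforward_ge0 => a; exact: bary_ge0.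
- by rewrite pushforward_sum bary_sum.
- by apply: phi_simplicial; exact: bary_supp.
by move=> v /pushforward_supp[a <- xa]; apply: imset_f; rewrite inE.
Qed.

Let gE (x : realization R K) : realization R D (normalize (lift (bary x))).
Proof.
apply: realization_normalize.
- by move=> a; apply: lift_ge0 => v; exact: bary_ge0.
- by eexists; apply: lift_neq0; [move=> v; exact: bary_ge0|exact: bary_supp].
- by move=> a; exact: lift_in.
- by move=> a b; exact: lift_le.
Qed.

Let f := to_realization fE.
Let g := to_realization gE.

(** The top [t] units of mass are replaced by the lift of their image. Working from the top is
    essential: what remains lies below every element already moved, so by [le_meet] it lies below
    every new element, and the support stays a chain. *)
Let homotopy_mass (z : realization R D * R) (a : T) : R :=
  bary z.1 a - top_mass le (bary z.1) (clamp z.2) a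
  + lift (pushforward phi (top_mass le (bary z.1) (clamp z.2))) a.

Let top_ge0 (z : realization R D * R) a :
  0 <= top_mass le (bary z.1) (clamp z.2) a.
Proof. by apply: top_mass_ge0 => b; exact: bary_ge0. Qed.

Let rest_ge0 (z : realization R D * R) a :
  0 <= bary z.1 a - top_mass le (bary z.1) (clamp z.2) a.
Proof. by rewrite subr_ge0; apply: top_mass_le => b; exact: bary_ge0. Qed.

Let pushed_ge0 (z : realization R D * R) v :
  0 <= pushforward phi (top_mass le (bary z.1) (clamp z.2)) v.
Proof. exact: pushforward_ge0. Qed.

Let homotopy_mass_ge0 z a : 0 <= homotopy_mass z a.
Proof. by rewrite addr_ge0 ?lift_ge0. Qed.

Let top_chain (z : realization R D * R) b :
  top_mass le (bary z.1) (clamp z.2) b != 0 ->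
  [set a | top_mass le (bary z.1) (clamp z.2) a != 0]%SET \in order_complex le P.
Proof.
move=> nb; apply: (order_complex_down_closed (bary_supp z.1)).
  apply/fintype.subsetP => a; rewrite !inE; apply: top_mass_supp.
  by move=> c; exact: bary_ge0.
by apply/set0Pn; exists b; rewrite inE.
Qed.

Let pushed_supp (z : realization R D * R) v :
  pushforward phi (top_mass le (bary z.1) (clamp z.2)) v != 0 ->
  v \in phi @: [set a | top_mass le (bary z.1) (clamp z.2) a != 0]%SET.
Proof. by move=> /pushforward_supp[a <- na]; apply: imset_f; rewrite inE. Qed.

Let homotopy_mass_supp z a : homotopy_mass z a != 0 ->
  bary z.1 a - top_mass le (bary z.1) (clamp z.2) a != 0 \/
  lift (pushforward phi (top_mass le (bary z.1) (clamp z.2))) a != 0.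
Proof.
move=> h; case: (eqVneq (lift (pushforward phi
  (top_mass le (bary z.1) (clamp z.2))) a) 0) => [l0|]; last by right.
by left; move: h; rewrite /homotopy_mass l0 addr0.
Qed.

Let rest_supp (z : realization R D * R) a :
  bary z.1 a - top_mass le (bary z.1) (clamp z.2) a != 0 -> bary z.1 a != 0.
Proof.
apply: contra_neq => xa; apply/eqP; rewrite eq_le rest_ge0 andbT xa.
by rewrite sub0r oppr_le0 top_ge0.
Qed.

Let bary_comparable (x : realization R D) a b :
  bary x a != 0 -> bary x b != 0 -> le a b || le b a.
Proof.
move=> xa xb; have := bary_supp x; rewrite !inE => /and3P[_ _].
move=> /'forall_implyP/(_ a); rewrite inE => /(_ xa)/'forall_implyP/(_ b).
by rewrite inE => /(_ xb).
Qed.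

Let rest_le_lift (z : realization R D * R) a b :
  bary z.1 a - top_mass le (bary z.1) (clamp z.2) a != 0 ->
  lift (pushforward phi (top_mass le (bary z.1) (clamp z.2))) b != 0 -> le a b.
Proof.
move=> ra /lift_supp[s [sK <- ls]].
have ss : s \subset phi @: [set a | top_mass le (bary z.1) (clamp z.2) a != 0]%SET.
  apply/fintype.subsetP => v vs; apply: pushed_supp; exact: level_weight_supp ls vs.
have [v vs] := set0Pn _ (level_neq0 sK).
have /imsetP[c] := fintype.subsetP ss _ vs; rewrite inE => nc _.
apply: (le_meet (top_chain nc) _ (level_neq0 sK) ss) => d; rewrite inE => nd.
apply: (top_mass_order le_refl le_asym le_tr _ _ nd).
- by move=> ?; exact: bary_ge0.
- by rewrite -subr_eq0.
apply: bary_comparable; first exact: rest_supp ra.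
by apply: (top_mass_supp _ nd) => ?; exact: bary_ge0.
Qed.

Let homotopy_mass_neq0 z : exists a, homotopy_mass z a != 0.
Proof.
have neq0 a : bary z.1 a - top_mass le (bary z.1) (clamp z.2) a != 0 ->
    homotopy_mass z a != 0.
  move=> ra; rewrite /homotopy_mass gt_eqF // ltr_pwDl ?lift_ge0 //.
  by rewrite lt_def ra rest_ge0.
case: (boolP [exists a, bary z.1 a - top_mass le (bary z.1) (clamp z.2) a != 0]).
  by move=> /existsP[a ra]; exists a; exact: neq0.
rewrite negb_exists => /forallP all0.
have tE a : top_mass le (bary z.1) (clamp z.2) a = bary z.1 a.
  by apply/eqP; rewrite eq_sym -subr_eq0; have := all0 a; rewrite negbK.
have tf : top_mass le (bary z.1) (clamp z.2) = bary z.1 by exact/funext.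
exists (meet [set v | pushforward phi (bary z.1) v != 0]%SET).
rewrite /homotopy_mass tf subrr add0r; have [h0 _ hK] := fE z.1.
exact: lift_neq0.
Qed.

Let HE z : realization R D (normalize (homotopy_mass z)).
Proof.
apply: realization_normalize => //.
- move=> a /homotopy_mass_supp[ra|/lift_in //].
  have := bary_supp z.1; rewrite inE => /and3P[_ /fintype.subsetP sP _].
  by apply: sP; rewrite inE; exact: rest_supp ra.
move=> a b /homotopy_mass_supp[ra|la] /homotopy_mass_supp[rb|lb].
- by apply: bary_comparable; [exact: rest_supp ra|exact: rest_supp rb].
- by rewrite (rest_le_lift ra lb).
- by rewrite (rest_le_lift rb la) orbT.
- exact: lift_le la lb.
Qed.

(** By [phi_meet], [f (g x)] lies in the simplex of [x], and a straight line suffices. In the other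
    direction a chain and the lift of its image need not lie in a common chain, and [homotopy_mass]
    moves one to the other gradually. *)
Theorem homotopy_equivalent_poset_nerve :
  homotopy_equivalent R (realization R (order_complex le P)) (realization R K).
Proof.
have cb1 a : continuous (fun z : realization R D * R => bary z.1 a).
  exact: (continuous_compf (@continuous_fstf _ _) (@continuous_bary R T D a)).
have cc : continuous (fun z : realization R D * R => clamp z.2).
  by apply: continuous_clamp; exact: continuous_sndf.
have cf : continuous f.
  apply: continuous_to_realization => v; apply: continuous_pushforward => a.
  exact: continuous_bary.
have cg : continuous g.
  apply: continuous_to_realization => a; apply: continuous_normalize.
  - by move=> z b; apply: lift_ge0 => v; exact: bary_ge0.
  - by move=> z; eexists; apply: lift_neq0; [move=> v; exact: bary_ge0|exact: bary_supp].
  by move=> b; apply: continuous_lift => v; exact: continuous_bary.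
exists f, g; split => //.
- apply: (@homotopic_trans _ _ _ _ (to_realization HE \o (fun x => (x, 1 : R)))).
    rewrite (_ : to_realization HE \o _ = g \o f).
      (* Both maps are now the same, and the straight line only serves as reflexivity. *)
      apply: homotopic_straight_line.
      + exact: order_complex_down_closed.
      + exact: (continuous_compf cf cg).
      + exact: (continuous_compf cf cg).
      by move=> x; eexists; [exact: (bary_supp (g (f x)))|move=> v []; rewrite inE].
    apply/funext => x; apply: bary_inj => a /=.
    rewrite !bary_to_realization /homotopy_mass /= clamp1 //.
    have -> : top_mass le (bary x) 1 = bary x.
      by apply/funext => b; apply: top_mass1; [move=> c; exact: bary_ge0|exact: bary_sum].
    congr (normalize _ a); apply/funext => b.
    by rewrite subrr add0r.
  apply: (homotopic_of_continuous (H := fun z => to_realization HE (z.1, 1 - z.2))).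
  + have cr : continuous (fun z : realization R D * R => (z.1, 1 - z.2)).
      apply: continuous_pairf; first exact: continuous_fstf.
      by apply: continuous_subf; [exact: continuous_cstf|exact: continuous_sndf].
    apply: (continuous_compf cr); apply: continuous_to_realization => a.
    apply: continuous_normalize => // b; apply: continuous_addf.
      by apply: continuous_subf => //; exact: continuous_top_mass.
    apply: continuous_lift => v; apply: continuous_pushforward => c.
    exact: continuous_top_mass.
  + by move=> x /=; rewrite subr0.
  move=> x; apply: bary_inj => a.
  rewrite bary_to_realization /homotopy_mass /= subrr clamp0 //.
  have -> : top_mass le (bary x) 0 = fun=> 0.
    by apply/funext => b; apply: top_mass0 => c; exact: bary_ge0.
  rewrite -[RHS](congr1 (@^~ a) (normalize_sum1 (bary_sum x))).
  congr (normalize _ a); apply/funext => b.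
  rewrite subr0 (_ : lift _ b = 0) ?addr0 //; apply/eqP/negPn/negP => /lift_supp[s [sK _ ls]].
  have [v vs] := set0Pn _ (level_neq0 sK).
  have := level_weight_supp ls vs; rewrite /pushforward big1 ?eqxx //.
- apply: homotopic_straight_line => //; first exact: (continuous_compf cg cf).
    by move=> x; exact: cvg_id.
  move=> x; exists [set v | bary x v != 0]%SET; first exact: bary_supp.
  move=> v [|]; last by rewrite inE.
  move=> /pushforward_supp[a <-] /=; rewrite /g bary_to_realization /normalize.
  rewrite mulf_eq0 negb_or => /andP[/lift_supp[s [sK <- ls]] _].
  by rewrite inE; exact: level_weight_supp ls (phi_meet sK).
Qed.

End PosetNerve.

(** * The quotient of a simplex by its boundary *)

Section SimplexToSphere.
Variables (R : realType) (n : nat).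
Implicit Types y : 'I_n.+1 -> R.

(** On the simplex this vanishes exactly on the boundary. The start value [y ord0] is neutral, being
    one of the terms of the minimum. *)
Definition face_dist y : R := \big[Num.min/y ord0]_j y j.

Lemma face_dist_le y j : face_dist y <= y j.
Proof. exact: bigmin_le. Qed.

Lemma face_dist_attained y : exists j, face_dist y = y j.
Proof.
have /bigmin_leP[h|[j _ h]] := lexx (face_dist y).
  by exists ord0; apply/eqP; rewrite eq_le face_dist_le h.
by exists j; apply/eqP; rewrite eq_le face_dist_le h.
Qed.

Lemma face_dist_ge0 y : (forall j, 0 <= y j) -> 0 <= face_dist y.
Proof. by move=> y0; have [j ->] := face_dist_attained y. Qed.

Definition edge_norm y : R :=
  \sum_j (y j - y ord0) ^+ 2 + (1 - \sum_j y j) ^+ 2.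

Definition sphere_den y : R := edge_norm y + face_dist y ^+ 2.

(* Inverse stereographic projection of [(y j - y ord0) / face_dist y]: it maps
   the open simplex bijectively onto the sphere minus its base point, and the
   boundary to the base point. The slack [1 - \sum_j y j] only keeps the
   denominator positive away from the simplex. *)
Definition simplex_sphere y : 'rV[R]_n.+1 :=
  \row_j (if j == ord0 then (edge_norm y - face_dist y ^+ 2) / sphere_den y
          else 2 * face_dist y * (y j - y ord0) / sphere_den y).

(** What a point of a whole complex looks like from the vertices of one maximal cell: its
    coordinates there sum to 1 if it lies in the open cell, and otherwise one of them is 0. *)
Definition admissible y :=
  (forall j, 0 <= y j) /\ (face_dist y = 0 \/ \sum_j y j = 1).

Lemma edge_norm_ge0 y : 0 <= edge_norm y.
Proof. by rewrite addr_ge0 ?sqr_ge0 // sumr_ge0 // => j _; rewrite sqr_ge0. Qed.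

(** If the denominator vanished, the coordinates would be equal and have minimum 0, yet sum to 1. *)
Lemma sphere_den_gt0 y : admissible y -> 0 < sphere_den y.
Proof.
move=> [y0 ym]; rewrite lt_def addr_ge0 ?edge_norm_ge0 ?sqr_ge0 // andbT.
rewrite paddr_eq0 ?edge_norm_ge0 ?sqr_ge0 // sqrf_eq0 paddr_eq0 ?sqr_ge0 //; last first.
  by rewrite sumr_ge0 // => j _; rewrite sqr_ge0.
apply/negP => /andP[/andP[/eqP e /eqP s] /eqP m].
have yE j : y j = y ord0.
  apply/eqP; rewrite -subr_eq0 -sqrf_eq0; apply/eqP.
  exact: (psumr_eq0P (fun j _ => sqr_ge0 (y j - y ord0)) e).
have [j mj] := face_dist_attained y.
have yj k : y k = 0 by rewrite yE -(yE j) -mj.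
move: s; rewrite big1 => [|k _]; last exact: yj.
by rewrite subr0 expr1n => /eqP; rewrite oner_eq0.
Qed.

Lemma simplex_sphereP y : admissible y -> sphere R n (simplex_sphere y).
Proof.
move=> ay; have d0 := sphere_den_gt0 ay; case: ay => y0 ym.
rewrite /sphere /= big_ord_recl !mxE eqxx.
have E : \sum_(i < n) simplex_sphere y ord0 (lift ord0 i) ^+ 2 =
    4 * face_dist y ^+ 2 * edge_norm y / sphere_den y ^+ 2.
  rewrite (eq_bigr (fun i => 4 * face_dist y ^+ 2 / sphere_den y ^+ 2 *
    (y (lift ord0 i) - y ord0) ^+ 2)); last first.
    move=> i _; rewrite mxE eq_sym eq_liftF.
    rewrite !exprMn exprVn -[2 ^+ 2]natrX; ring.
  rewrite -mulr_sumr; case: ym => [->|s1]; first by rewrite expr0n /= !(mulr0, mul0r).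
  rewrite /edge_norm s1 subrr expr0n addr0 big_ord_recl subrr expr0n add0r /=.
  ring.
rewrite E expr_div_n -mulrDl.
have -> : (edge_norm y - face_dist y ^+ 2) ^+ 2 + 4 * face_dist y ^+ 2 * edge_norm y
  = sphere_den y ^+ 2 by rewrite /sphere_den; ring.
by rewrite divff // expf_neq0 // gt_eqF.
Qed.

Lemma simplex_sphere_base y : admissible y ->
  (simplex_sphere y = delta_mx ord0 ord0) <-> (face_dist y = 0).
Proof.
move=> ay; have d0 := sphere_den_gt0 ay; split => [h|m0]; last first.
  apply/rowP => j; rewrite !mxE eqxx /=; case: eqP => _.
    by rewrite m0 expr0n subr0 /sphere_den m0 expr0n addr0 divff // gt_eqF //;
      move: d0; rewrite /sphere_den m0 expr0n addr0.
  by rewrite m0 mulr0 !mul0r.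
have := congr1 (fun M : 'rV_n.+1 => M ord0 ord0) h; rewrite !mxE eqxx /=.
move/divr1_eq; rewrite /sphere_den => e.
by apply/eqP; rewrite -sqrf_eq0; apply/eqP; lra.
Qed.

Lemma simplex_sphere_inj y y' : admissible y -> admissible y' ->
  face_dist y != 0 -> face_dist y' != 0 ->
  simplex_sphere y = simplex_sphere y' -> y =1 y'.
Proof.
move=> ay ay' m0 m0' h.
have s1 : \sum_j y j = 1 by case: ay => _ [e|//]; rewrite e eqxx in m0.
have s1' : \sum_j y' j = 1 by case: ay' => _ [e|//]; rewrite e eqxx in m0'.
have d0 := sphere_den_gt0 ay; have d0' := sphere_den_gt0 ay'.
have hj j := congr1 (fun M : 'rV_n.+1 => M ord0 j) h.
(* Coordinate 0 of the image is [1 - 2 * k], so [k] can be read off, and after it the ratios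
   [(y j - y ord0) / face_dist y] from the other coordinates. *)
pose k := face_dist y ^+ 2 / sphere_den y.
have k' : k = face_dist y' ^+ 2 / sphere_den y'.
  have := hj ord0; rewrite !mxE eqxx.
  have E (z : 'I_n.+1 -> R) : 0 < sphere_den z ->
      (edge_norm z - face_dist z ^+ 2) / sphere_den z =
      1 - 2 * (face_dist z ^+ 2 / sphere_den z).
    by move=> z0; rewrite /sphere_den; field; rewrite -/(sphere_den z) gt_eqF.
  by rewrite !E // /k; lra.
have k0 : k != 0 by apply: mulf_neq0; [exact: expf_neq0|rewrite invr_neq0 // gt_eqF].
have ratio j : (y j - y ord0) / face_dist y = (y' j - y' ord0) / face_dist y'.
  case: (eqVneq j ord0) => [->|j0]; first by rewrite !subrr !mul0r.
  have := hj j; rewrite !mxE (negPf j0).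
  have E (z : 'I_n.+1 -> R) : face_dist z != 0 -> 0 < sphere_den z ->
      2 * face_dist z * (z j - z ord0) / sphere_den z =
      2 * (face_dist z ^+ 2 / sphere_den z) * ((z j - z ord0) / face_dist z).
    by move=> z0 z1; field; rewrite z0 gt_eqF.
  rewrite !E // -k' -/k => /(mulfI _); apply.
  by rewrite mulf_neq0 ?pnatr_eq0.
pose c := y ord0 / face_dist y - y' ord0 / face_dist y'.
have rc j : y j / face_dist y = y' j / face_dist y' + c.
  by have := ratio j; rewrite !mulrBl /c; lra.
have mp : 0 < face_dist y by rewrite lt_def m0 face_dist_ge0 //; case: ay.
have mp' : 0 < face_dist y' by rewrite lt_def m0' face_dist_ge0 //; case: ay'.
(* The vectors [y / face_dist y] and [y' / face_dist y'] differ by the constant [c], and both have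
   minimum 1. *)
have c0 : c = 0.
  have [j ej] := face_dist_attained y; have [j' ej'] := face_dist_attained y'.
  have h1 : 1 <= y' j / face_dist y' by rewrite ler_pdivlMr // mul1r face_dist_le.
  have h2 : 1 <= y j' / face_dist y by rewrite ler_pdivlMr // mul1r face_dist_le.
  have := rc j; have := rc j'; rewrite -ej -ej' !divff //; lra.
have mE : face_dist y = face_dist y'.
  apply: invr_inj; rewrite -[LHS]mul1r -[RHS]mul1r -{1}s1 -s1' !mulr_suml.
  by apply: eq_bigr => j _; rewrite rc c0 addr0.
move=> j; have := rc j; rewrite c0 addr0 mE => /(mulIf _); apply.
by rewrite invr_eq0.
Qed.

Lemma simplex_sphere_surj (s : 'rV[R]_n.+1) : sphere R n s ->
  s != delta_mx ord0 ord0 ->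
  exists y, [/\ 0 < face_dist y, \sum_j y j = 1 & simplex_sphere y = s].
Proof.
rewrite /sphere /= => s1 sb.
have sumE : \sum_(i < n) s ord0 (lift ord0 i) ^+ 2 = 1 - s ord0 ord0 ^+ 2.
  by rewrite -s1 big_ord_recl addrC addKr.
have s0 : s ord0 ord0 != 1.
  apply: contra_neq sb => e; apply/rowP => j; rewrite !mxE eqxx /=.
  case: (unliftP ord0 j) => [i ->|->]; last by rewrite e eqxx.
  rewrite eq_sym eq_liftF /=; apply/eqP; rewrite -sqrf_eq0; apply/eqP.
  apply: (psumr_eq0P (P := predT) (F := fun i => s ord0 (lift ord0 i) ^+ 2)) => //.
    by move=> i0 _; rewrite sqr_ge0.
  by rewrite sumE e expr1n subrr.
have s2 : s ord0 ord0 <= 1.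
  rewrite leNgt; apply/negP => s2.
  have : 0 <= 1 - s ord0 ord0 ^+ 2.
    by rewrite -sumE sumr_ge0 // => i _; rewrite sqr_ge0.
  rewrite subr_ge0 leNgt => /negP; apply.
  by rewrite expr_gt1 //; apply: le_trans (ltW s2).
have s3 : 0 < 1 - s ord0 ord0 by rewrite subr_gt0 lt_def eq_sym s0.
(* [z] is the stereographic projection of [s], so [(y j - y ord0) / face_dist y] has to equal [z j].
   Translating [z] to minimum 0, adding 1 and dividing by the sum [S] achieves this, with
   [face_dist y] equal to [S^-1]. *)
pose z (j : 'I_n.+1) : R := if j == ord0 then 0 else s ord0 j / (1 - s ord0 ord0).
pose w j := z j - face_dist z.
have w0 j : 0 <= w j by rewrite subr_ge0 face_dist_le.
pose S := n.+1%:R + \sum_j w j.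
have S0 : 0 < S by rewrite ltr_pwDl ?ltr0n // sumr_ge0.
pose y j := (1 + w j) / S.
have fy : face_dist y = S^-1.
  apply/eqP; rewrite eq_le; apply/andP; split.
    have [j ej] := face_dist_attained z.
    by have := face_dist_le y j; rewrite /y /w -ej subrr addr0 mul1r.
  have [j ->] := face_dist_attained y.
  by apply: ler_peMl; [rewrite invr_ge0 ltW|rewrite lerDl].
have sy : \sum_j y j = 1.
  rewrite -mulr_suml big_split /= sumr_const card_ord -/S divff //.
  by rewrite gt_eqF.
have dy j : y j - y ord0 = z j / S.
  have z0 : z ord0 = 0 by rewrite /z eqxx.
  by rewrite /y /w z0 -mulrBl; congr (_ / S); lra.
exists y; split => //; first by rewrite fy invr_gt0.
have zE : \sum_j z j ^+ 2 = (1 + s ord0 ord0) / (1 - s ord0 ord0).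
  rewrite big_ord_recl {1}/z eqxx expr0n add0r.
  rewrite (eq_bigr (fun i => s ord0 (lift ord0 i) ^+ 2 * (1 - s ord0 ord0) ^- 2)); last first.
    by move=> i _; rewrite /z eq_sym eq_liftF expr_div_n.
  rewrite -mulr_suml sumE; field; by rewrite gt_eqF.
have eE : edge_norm y = (1 + s ord0 ord0) / (1 - s ord0 ord0) / S ^+ 2.
  rewrite /edge_norm sy subrr expr0n addr0 -zE mulr_suml.
  by apply: eq_bigr => j _; rewrite dy expr_div_n.
have dE : sphere_den y = 2 / (1 - s ord0 ord0) / S ^+ 2.
  by rewrite /sphere_den eE fy; field; rewrite !gt_eqF.
apply/rowP => j; rewrite mxE dE; case: eqP => [->|/eqP j0].
  by rewrite eE fy; field; rewrite !gt_eqF.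
rewrite dy fy /z (negPf j0); field; by rewrite !gt_eqF.
Qed.

Lemma continuous_face_dist (Z : topologicalType) (F : Z -> 'I_n.+1 -> R) :
  (forall j, continuous (fun z => F z j)) ->
  continuous (fun z => face_dist (F z)).
Proof.
move=> cF; rewrite /face_dist.
have bigE (r : seq 'I_n.+1) : continuous (fun z => \big[Num.min/F z ord0]_(j <- r) F z j).
  elim: r => [|j r IH].
    by rewrite (_ : (fun z => _) = fun z => F z ord0) //; apply/funext => z; rewrite big_nil.
  rewrite (_ : (fun z => _) = fun z =>
    Num.min (F z j) (\big[Num.min/F z ord0]_(j <- r) F z j)); last first.
    by apply/funext => z; rewrite big_cons.
  exact: continuous_minf.
exact: bigE.
Qed.

Lemma continuous_simplex_sphere (Z : topologicalType) (F : Z -> 'I_n.+1 -> R) :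
  (forall z, admissible (F z)) -> (forall j, continuous (fun z => F z j)) ->
  continuous (fun z => simplex_sphere (F z)).
Proof.
move=> aF cF; apply: continuous_row => j.
have cm := continuous_face_dist cF.
have cm2 : continuous (fun z => face_dist (F z) ^+ 2) by exact: continuous_mulf.
have ce : continuous (fun z => edge_norm (F z)).
  apply: continuous_addf; last first.
    have c1 : continuous (fun z => 1 - \sum_j F z j).
      by apply: continuous_subf; [exact: continuous_cstf|exact: continuous_sumf].
    exact: (continuous_mulf c1 c1).
  apply: continuous_sumf => i _.
  have c1 : continuous (fun z => F z i - F z ord0) by exact: continuous_subf.
  exact: (continuous_mulf c1 c1).
have cd : continuous (fun z => sphere_den (F z)) by exact: continuous_addf.
have dn z : sphere_den (F z) != 0 by rewrite gt_eqF // sphere_den_gt0.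
case: (eqVneq j ord0) => [->|j0].
  rewrite (_ : (fun z => _) = fun z =>
    (edge_norm (F z) - face_dist (F z) ^+ 2) / sphere_den (F z)).
    by apply: continuous_divf => //; exact: continuous_subf.
  by apply/funext => z; rewrite mxE eqxx.
rewrite (_ : (fun z => _) = fun z =>
  2 * face_dist (F z) * (F z j - F z ord0) / sphere_den (F z)).
  apply: continuous_divf => //; apply: continuous_mulf; last exact: continuous_subf.
  by apply: continuous_mulf => //; exact: continuous_cstf.
by apply/funext => z; rewrite mxE (negPf j0).
Qed.

End SimplexToSphere.

(** * Collapsing a contractible subcomplex *)

Section Compactness.

Lemma compact_set_type (X : topologicalType) (A : set X) :
  compact A -> compact [set: A].
Proof.
move=> cA F PF _; pose G := (fun x : A => set_val x) @ F.
have GA : G A by rewrite /G /fmap /=; apply: filterS filterT => x _; exact: set_valP.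
have [a [Aa ca]] := cA G _ GA.
exists (SigSub (mem_set Aa)); split => // U V FU [_ [[W oW <-] /= Wa WV]].
have GU : G ((fun x : A => set_val x) @` U).
  by rewrite /G /fmap /=; apply: filterS FU => x Ux; exists x.
have [|_ [[x Ux <-] Wx]] := ca _ W GU; first exact: open_nbhs_nbhs.
by exists x; split => //; exact: WV.
Qed.

(** A finite wedge at closed base points has the topology induced from the product, so that
    continuity can be tested in each factor. *)
Lemma continuous_into_wedge (Z : topologicalType) (I : choiceType)
    (X : I -> topologicalType) (p0 : forall i, X i) (q : Z -> wedge p0) :
  finite_set [set: I] -> (forall i, closed [set p0 i]) ->
  (forall i, continuous (fun z => wedge_prod (q z) i)) -> continuous q.
Proof.
move=> fI cp cq z A nA.
have cpq : continuous (fun z => wedge_prod (q z)).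
  exact: continuous_prod_topology.
have := wedge_prod_open fI cp nA.
move=> /nbhs_subspace_ex[|U nU UE]; first by exists (q z).
have : nbhs z ((fun z => wedge_prod (q z)) @^-1` U) by exact: cpq.
apply: filterS => z' /= Uz'.
have : (U `&` range (@wedge_prod _ _ p0)) (wedge_prod (q z')).
  by split => //; exists (q z').
by rewrite -UE => -[[a Aa /wedge_prod_inj <-]].
Qed.

Section CompactRealization.
Variables (R : realType) (V : finType) (K : {set {set V}}).
Import ArrowAsProduct.

(** Prescribing the exact support is not a closed condition; down-closure rewrites the realization
    as a finite union of closed simplices in the cube. *)
Lemma compact_realization : down_closed K -> compact [set: realization R K].
Proof.
move=> dK; apply: compact_set_type.
have cc v : continuous (fun x : {ptws V -> R} => x v).
  exact: (@proj_continuous V (fun=> R) v).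
pose C (s : {set V}) : set {ptws V -> R} :=
  [set x | [/\ forall v, 0 <= x v, \sum_v x v = 1 & forall v, v \notin s -> x v = 0]].
have clC s : closed (C s).
  have -> : C s = \bigcap_v [set x : {ptws V -> R} | 0 <= x v] `&`
      [set x : {ptws V -> R} | \sum_v x v = 1] `&`
      \bigcap_(v in [set v | v \notin s]) [set x : {ptws V -> R} | x v = 0].
    apply/seteqP; split => x /=.
      move=> [x0 x1 xs]; split; last by move=> v; exact: xs.
      by split => // v _; exact: x0.
    by move=> [[x0 x1] xs]; split => // v; exact: (x0 v).
  apply: closedI; first apply: closedI.
  - apply: closed_bigI => v _.
    apply: (@preimage_closed _ _ (fun x : {ptws V -> R} => x v) [set t | 0 <= t]) => // x _; exact: cc.
  - apply: (@preimage_closed _ _ (fun x : {ptws V -> R} => \sum_v x v) [set t | t = 1]).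
      move=> x _; have cs : continuous (fun x : {ptws V -> R} => \sum_v x v).
        by apply: continuous_sumf => v _; exact: cc.
      exact: cs.
    exact: closed_eq.
  - apply: closed_bigI => v _.
    apply: (@preimage_closed _ _ (fun x : {ptws V -> R} => x v) [set t | t = 0]) => // x _; exact: cc.
apply: (subclosed_compact _ (@tychonoff V (fun=> R) (fun=> `[0, 1]%classic)
  (fun=> @segment_compact R 0 1))); last first.
  move=> x [x0 x1 _] v /=; rewrite in_itv /= x0 /= -x1 (bigD1 v) //= lerDl.
  exact: sumr_ge0.
have -> : realization R K = \bigcup_(s in [set s | s \in K]) C s.
  apply/seteqP; split => x.
    move=> [x0 x1 xK]; exists [set v | x v != 0]%SET => //; split => // v.
    by rewrite inE negbK => /eqP.
  move=> [s /= sK [x0 x1 xs]]; apply: (realization_in dK (s := s)) => // v.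
  by apply: contra_neqT; exact: xs.
by apply: closed_bigcup => // s _; exact: clC.
Qed.

End CompactRealization.

Lemma hausdorff_sphere (R : realType) (n : nat) : hausdorff_space (sphere R n).
Proof.
move=> x y cl; apply: val_inj.
apply: (@norm_hausdorff R 'rV[R]_n.+1) => U W nU nW.
have [||z [Uz Wz]] := cl (set_val @^-1` U) (set_val @^-1` W).
- exact: (@continuous_set_val _ (sphere R n) x U).
- exact: (@continuous_set_val _ (sphere R n) y W).
by exists (set_val z).
Qed.

End Compactness.

(** * Extending a homotopy over open cells *)

Section AttachCells.
Variables (R : realType) (V I : finType) (K : {set {set V}}).
Variables (d : I -> nat) (c : forall i, 'I_(d i).+1 -> V).
Variables (h : (V -> R) -> R -> V -> R) (x0 : V -> R) (i0 : I).

Let cell i : {set V} := [set c j | j : 'I_(d i).+1]%SET.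
(** Because a cell is a maximal simplex ([cell_max]), a point of the realization has positive depth
    exactly when its support is [cell i]; thus at most one depth is non-zero. *)
Let depth i (x : V -> R) : R := face_dist (fun j => x (c (i := i) j)).

Hypothesis K_down : down_closed K.
Hypothesis c_inj : forall i, injective (@c i).
Hypothesis cellK : forall i, cell i \in K.
Hypothesis cell_max : forall i s, s \in K -> cell i \subset s -> s = cell i.
Hypothesis cell_inj : injective cell.

Let skeleton (x : V -> R) := realization R K x /\ forall i, depth i x = 0.

Hypothesis h_continuous : forall (Z : topologicalType) (F : Z -> V -> R) (t : Z -> R) v,
  (forall w, continuous (fun z => F z w)) -> continuous t ->
  continuous (fun z => h (F z) (t z) v).
Hypothesis h0 : forall x, h x 0 = x.
Hypothesis h_skeleton : forall x t, skeleton x -> 0 <= t <= 1 -> skeleton (h x t).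
Hypothesis h1 : forall x, skeleton x -> h x 1 = x0.
Hypothesis x0_skeleton : skeleton x0.

Let depth_ge0 i x : realization R K x -> 0 <= depth i x.
Proof. by case=> xp _ _; apply: face_dist_ge0. Qed.

Let depth_supp i x : realization R K x -> depth i x != 0 ->
  [set v | x v != 0]%SET = cell i.
Proof.
move=> Kx di; have d0 := depth_ge0 i Kx; case: Kx => _ _ Kx.
apply: cell_max => //; apply/fintype.subsetP => _ /imsetP[j _ ->]; rewrite inE gt_eqF //.
apply: (lt_le_trans _ (face_dist_le (fun j => x (c (i := i) j)) j)).
by rewrite -/(depth i x) lt_def di d0.
Qed.

Let depth_uniq i j x : realization R K x -> depth i x != 0 -> depth j x != 0 -> i = j.
Proof.
by move=> Kx di dj; apply: cell_inj; rewrite -(depth_supp Kx di) -(depth_supp Kx dj).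
Qed.

Let sum_cell i (F : V -> R) : \sum_j F (c (i := i) j) = \sum_(v in cell i) F v.
Proof. by rewrite big_imset //= => j k _ _; exact: c_inj. Qed.

Let cell_sum i x : realization R K x -> depth i x != 0 ->
  \sum_j x (c (i := i) j) = 1.
Proof.
move=> Kx di; have [_ <- _] := Kx; rewrite sum_cell [RHS](bigID [in cell i]) /=.
rewrite [X in _ + X]big1 ?addr0 // => v; rewrite -(depth_supp Kx di) inE negbK.
by move/eqP.
Qed.

Let cell_admissible i x : realization R K x -> admissible (fun j => x (c (i := i) j)).
Proof.
move=> Kx; split; first by case: Kx => + _ _; move=> + j; apply.
by case: (eqVneq (depth i x) 0); [left|move=> di; right; exact: cell_sum].
Qed.

Let X := realization R K.
Let W := sphere_wedge R d.

Let sph i (x : X) : sphere R (d i) :=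
  SigSub (mem_set (simplex_sphereP (cell_admissible i (baryP x)))).

Let continuous_sph i : continuous (sph i).
Proof.
apply: continuous_set_type; apply: continuous_simplex_sphere.
  by move=> x; exact: cell_admissible (baryP x).
by move=> j; exact: continuous_bary.
Qed.

Let sph_base i x : sph i x = sphere_base R (d i) <-> depth i (bary x) = 0.
Proof.
rewrite -(simplex_sphere_base (cell_admissible i (baryP x))); split => [|e].
  by move/(congr1 val).
exact: val_inj.
Qed.

(** The base points of all the spheres are one point of the wedge, so any index can name it; [i0]
    does so for the points outside the open cells. *)
Let q (x : X) : W :=
  if [pick i | depth i (bary x) != 0] is Some i
  then wedge_lift (fun i => sphere_base R (d i)) (sph i x)
  else wedge_lift (fun i => sphere_base R (d i)) (sphere_base R (d i0)).

Let qE x i : wedge_prod (q x) i = sph i x.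
Proof.
have base j : depth j (bary x) = 0 -> sph j x = sphere_base R (d j) by move/sph_base.
rewrite /q; case: pickP => [j dj|all0].
  rewrite /wedge_prod wedge_lift_funE; last exact: wedge_prod_pointE.
  case: dfwithP => [//|k jk]; rewrite base //; apply/eqP/negPn/negP => dk.
  by move: jk; rewrite (depth_uniq (baryP x) dj dk) eqxx.
rewrite /wedge_prod wedge_lift_funE; last exact: wedge_prod_pointE.
have bi k : sph k x = sphere_base R (d k).
  by apply: base; have /negbFE/eqP := all0 k.
by case: dfwithP => [|k _]; rewrite bi.
Qed.

Let closed_base i : closed [set sphere_base R (d i)].
Proof. by apply: accessible_closed_set1; apply: hausdorff_accessible; exact: hausdorff_sphere. Qed.

Let continuous_q : continuous q.
Proof.
apply: continuous_into_wedge; [exact: finite_finset|exact: closed_base|].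
move=> i; rewrite (_ : (fun z => _) = sph i); first exact: continuous_sph.
by apply/funext => x; rewrite qE.
Qed.

Let q_skeleton x y : skeleton (bary x) -> skeleton (bary y) -> q x = q y.
Proof.
move=> [_ sx] [_ sy]; apply: wedge_prod_inj; apply: functional_extensionality_dep => i.
by rewrite !qE (sph_base i x).2 // (sph_base i y).2.
Qed.

(** A point outside the skeleton is recovered from [q]: the sphere it is sent to determines the
    cell, and [simplex_sphere] is injective on the interior of that cell. *)
Let q_fiber x y : q x = q y -> x = y \/ (skeleton (bary x) /\ skeleton (bary y)).
Proof.
move=> qxy; have sE i : sph i x = sph i y by rewrite -!qE qxy.
have dE i : (depth i (bary x) == 0) = (depth i (bary y) == 0).
  by apply/eqP/eqP => /sph_base e; apply/sph_base; rewrite -e.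
case: (boolP [exists i, depth i (bary x) != 0]) => [/existsP[i di]|]; last first.
  rewrite negb_exists => /forallP all0; right.
  have ax i : depth i (bary x) == 0 by have := all0 i; rewrite negbK.
  split; split; try exact: baryP; move=> i; apply/eqP => //.
  by rewrite -dE.
left; have di' : depth i (bary y) != 0 by rewrite -dE.
have e : forall j, bary x (c (i := i) j) = bary y (c (i := i) j).
  apply: (simplex_sphere_inj (cell_admissible i (baryP x)) (cell_admissible i (baryP y))) => //.
  exact: (congr1 val (sE i)).
apply: bary_inj => v; case: (boolP (v \in cell i)) => [/imsetP[j _ ->] //|vc].
have out (z : X) : depth i (bary z) != 0 -> bary z v = 0.
  by move=> dz; move: vc; rewrite -(depth_supp (baryP z) dz) inE negbK => /eqP.
by rewrite !out.
Qed.

Let cell_point i (y : 'I_(d i).+1 -> R) (v : V) : R :=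
  \sum_(j | c (i := i) j == v) y j.

Let cell_pointE i y j : cell_point (i := i) y (c j) = y j.
Proof.
rewrite /cell_point (eq_bigl (pred1 j)) ?big_pred1_eq // => k /=.
by rewrite (inj_eq (@c_inj i)).
Qed.

Let q_surj w : exists x, q x = w.
Proof.
have eta (x : V -> R) (Kx : realization R K x) :
    exists x' : X, bary x' = x by exists (SigSub (mem_set Kx)).
have [x0' x0E] := eta _ x0_skeleton.1.
have [i _ [s _ <-]] : (\bigcup_i (wedge_lift (fun i => sphere_base R (d i)) (i := i)) @` setT) w.
  by rewrite wedgeTE.
case: (eqVneq s (sphere_base R (d i))) => [->|sb].
  exists x0'; apply: wedge_prod_inj; apply: functional_extensionality_dep => j.
  rewrite qE (sph_base j x0').2; last by rewrite x0E; case: x0_skeleton.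
  rewrite /wedge_prod wedge_lift_funE; last exact: wedge_prod_pointE.
  by case: dfwithP.
have [|y [y0 y1 ys]] := simplex_sphere_surj (set_valP s).
  by apply: contra_neq sb => e; exact: val_inj.
have yj j : 0 < y j by apply: lt_le_trans y0 (face_dist_le _ j).
have Ky : realization R K (cell_point y).
  apply: (realization_in K_down (s := cell i)) => //.
  - by move=> v; apply: sumr_ge0 => j _; exact: ltW.
  - by rewrite -y1 (partition_big (@c i) predT).
  - move=> v; apply: contra_neqT => vc; rewrite /cell_point big1 // => j /eqP cj.
    by move: vc; rewrite -cj imset_f.
have [x xE] := eta _ Ky; exists x.
have yE : (fun j => bary x (c (i := i) j)) = y.
  by apply/funext => j; rewrite xE cell_pointE.
have dx : depth i (bary x) != 0 by rewrite /depth yE gt_eqF.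
apply: wedge_prod_inj; apply: functional_extensionality_dep => j; rewrite qE.
rewrite /wedge_prod wedge_lift_funE; last exact: wedge_prod_pointE.
case: dfwithP => [|k ik].
  by apply: val_inj; rewrite /= -ys yE.
apply/sph_base/eqP/negPn/negP => dk.
by move: ik; rewrite (depth_uniq (baryP x) dx dk) eqxx.
Qed.

(* The homotopy [h] of the skeleton is extended over the cells: a point at depth
   [m] is first pushed outwards, and starts to follow [h] when it meets the
   boundary of its cell, at time [pace * m]. *)
Let pace : R := #|V|.+1%:R.
Let push_by (x : V -> R) (t : R) i : R := Num.min (t / pace) (depth i x).
Let push_den (x : V -> R) (t : R) : R :=
  1 - \sum_i (d i).+1%:R * push_by x t i.
Let push (x : V -> R) (t : R) (v : V) : R :=
  (x v - \sum_(i | v \in cell i) push_by x t i) / push_den x t.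
Let delay (x : V -> R) : R := pace * \sum_i depth i x.

Let pace_gt0 : 0 < pace. Proof. by rewrite ltr0n. Qed.

Let delay_ge0 x : realization R K x -> 0 <= delay x.
Proof.
move=> Kx; apply: mulr_ge0; first exact: ltW.
by apply: sumr_ge0 => i _; exact: depth_ge0.
Qed.

Let push_by_out i x t : 0 <= t -> depth i x = 0 -> push_by x t i = 0.
Proof. by move=> t0 di; rewrite /push_by di min_r // divr_ge0 // ltW. Qed.

Let push_skeleton x t : 0 <= t -> (forall i, depth i x = 0) -> push x t = x.
Proof.
move=> t0 all0; apply/funext => v.
rewrite /push /push_den !big1 ?subr0 ?divr1 // => i _; rewrite push_by_out ?mulr0 //.
Qed.

Let sum_only (F : I -> R) (Q : pred I) i : (forall j, j != i -> F j = 0) ->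
  \sum_(j | Q j) F j = if Q i then F i else 0.
Proof.
move=> F0; rewrite big_mkcond (bigD1 i) //= big1 ?addr0 // => j ji.
by rewrite F0 //; case: ifP.
Qed.

Section OneCell.
Variables (i : I) (x : V -> R) (t : R).
Hypotheses (Kx : realization R K x) (di : depth i x != 0) (t01 : 0 <= t <= 1).

Let other j : j != i -> depth j x = 0.
Proof.
by move=> ji; apply/eqP/negPn/negP => dj; move: ji; rewrite (depth_uniq Kx dj di) eqxx.
Qed.

Let t0 : 0 <= t. Proof. by case/andP: t01. Qed.

Let push_denE : push_den x t = 1 - (d i).+1%:R * push_by x t i.
Proof.
rewrite /push_den (@sum_only _ _ i) //= => j ji.
by rewrite push_by_out ?mulr0 //; exact: other.
Qed.

Let pushE v :
  push x t v = (x v - if v \in cell i then push_by x t i else 0) / push_den x t.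
Proof.
rewrite /push (@sum_only _ _ i) // => j ji.
by rewrite push_by_out //; exact: other.
Qed.

Let delta_ge0 : 0 <= push_by x t i.
Proof. by rewrite le_min divr_ge0 ?(ltW pace_gt0) //= depth_ge0. Qed.

Let card_cell : #|cell i| = (d i).+1.
Proof. by rewrite card_imset ?card_ord //; exact: c_inj. Qed.

(** This is where the value of [pace] comes from: at most [1 / pace] is removed from each of at most
    [#|V|] vertices, which leaves a positive total to divide by. *)
Let push_den_gt0 : 0 < push_den x t.
Proof.
rewrite push_denE subr_gt0.
have h2 : (d i).+1%:R * push_by x t i <= #|V|%:R / pace.
  apply: ler_pM => //; first by rewrite ler_nat -card_cell max_card.
  rewrite /push_by ge_min ler_piMl //; last by case/andP: t01.
  by rewrite invr_ge0 ltW.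
by apply: le_lt_trans h2 _; rewrite ltr_pdivrMr // mul1r ltr_nat.
Qed.

Lemma push_realization_cell : push_den x t != 0 /\ realization R K (push x t).
Proof.
split; first by rewrite gt_eqF.
have [xp x1 _] := Kx; have xs := depth_supp Kx di.
apply: (realization_in K_down (s := cell i)) => //.
- move=> v; rewrite pushE divr_ge0 ?(ltW push_den_gt0) //.
  case: ifP => [/imsetP[j _ ->]|_]; last by rewrite subr0.
  by rewrite subr_ge0 /push_by ge_min [X in _ || X]face_dist_le orbT.
- under eq_bigr do rewrite pushE.
  rewrite -mulr_suml sumrB x1 -big_mkcond /= sumr_const card_cell -mulr_natl.
  by rewrite -push_denE divff // gt_eqF.
move=> v; apply: contra_neqT => vc; rewrite pushE (negPf vc) subr0.
by move: vc; rewrite -xs inE negbK => /eqP ->; rewrite mul0r.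
Qed.

Let delayE : delay x = pace * depth i x.
Proof. by rewrite /delay (@sum_only _ _ i). Qed.

Lemma push_skeleton_cell : delay x < t -> skeleton (push x t).
Proof.
rewrite delayE => tm; have [_ Kp] := push_realization_cell; split => // k.
apply/eqP/negPn/negP => dk.
have dE : push_by x t i = depth i x.
  by rewrite /push_by min_r // ler_pdivlMr // mulrC ltW.
have [j jE] := face_dist_attained (fun j => x (c (i := i) j)).
have pj : push x t (c j) = 0.
  by rewrite pushE imset_f // dE /depth jE subrr mul0r.
(* Pushing does not enlarge the support, so a cell [k] of positive depth is a face of [cell i],
   hence equal to it by maximality; but coordinate [c j] has become 0. *)
have sub : cell k \subset cell i.
  rewrite -(depth_supp Kp dk); apply/fintype.subsetP => v; rewrite inE.
  apply: contra_neqT => vc; rewrite pushE (negPf vc) subr0.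
  by move: vc; rewrite -(depth_supp Kx di) inE negbK => /eqP ->; rewrite mul0r.
have ik : i = k by apply: cell_inj; exact: cell_max.
have : c j \in [set v | push x t v != 0]%SET.
  by rewrite (depth_supp Kp dk) -ik imset_f.
by rewrite inE pj eqxx.
Qed.

End OneCell.

Let deform (x : V -> R) (t : R) : V -> R := h (push x t) (Num.max 0 (t - delay x)).

Let skeleton_delay x : (forall i, depth i x = 0) -> delay x = 0.
Proof. by move=> all0; rewrite /delay big1 ?mulr0. Qed.

Let deform_skeleton x t : skeleton x -> 0 <= t -> deform x t = h x t.
Proof.
move=> [_ all0] t0.
by rewrite /deform push_skeleton // skeleton_delay // subr0 max_r.
Qed.

(** [h] is under control on the skeleton only. Up to time [delay x] it runs for time 0 and is the
    identity; after that the pushed point already lies in the skeleton. *)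
Let deform_realization x t : realization R K x -> 0 <= t <= 1 ->
  realization R K (deform x t).
Proof.
move=> Kx t01; have /andP[t0 t1] := t01.
case: (boolP [exists i, depth i x != 0]) => [/existsP[i di]|]; last first.
  rewrite negb_exists => /forallP all0.
  have sx : skeleton x by split => // i; apply/eqP; have := all0 i; rewrite negbK.
  by rewrite deform_skeleton //; case: (h_skeleton sx t01).
rewrite /deform; case: (leP t (delay x)) => tm.
  by rewrite max_l ?subr_le0 // h0; case: (push_realization_cell Kx di t01).
have sp := push_skeleton_cell Kx di t01 tm.
rewrite max_r ?subr_ge0 ?ltW //; case: (h_skeleton (t := t - delay x) sp) => //.
by rewrite subr_ge0 ltW //= (le_trans _ t1) // gerBl delay_ge0.
Qed.

Let push_den_neq0 x t : realization R K x -> 0 <= t <= 1 -> push_den x t != 0.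
Proof.
move=> Kx t01; have /andP[t0 t1] := t01.
case: (boolP [exists i, depth i x != 0]) => [/existsP[i di]|]; last first.
  rewrite negb_exists => /forallP all0; rewrite /push_den big1 ?subr0 ?oner_neq0 //.
  move=> i _; rewrite push_by_out ?mulr0 //; apply/eqP; have := all0 i.
  by rewrite negbK.
by case: (push_realization_cell Kx di t01).
Qed.

Let HE (z : X * R) : realization R K (deform (bary z.1) (clamp z.2)).
Proof. by apply: deform_realization; [exact: baryP|exact: clamp_itv]. Qed.

Let continuous_deform v : continuous (fun z : X * R => deform (bary z.1) (clamp z.2) v).
Proof.
have cb w : continuous (fun z : X * R => bary z.1 w).
  exact: (continuous_compf (@continuous_fstf X R) (@continuous_bary R V K w)).
have cc : continuous (fun z : X * R => clamp z.2).
  by apply: continuous_clamp; exact: continuous_sndf.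
have cd i : continuous (fun z : X * R => depth i (bary z.1)).
  by apply: continuous_face_dist => j; exact: cb.
have cp i : continuous (fun z : X * R => push_by (bary z.1) (clamp z.2) i).
  apply: continuous_minf => //; apply: continuous_mulf => //.
  exact: continuous_cstf.
apply: (@h_continuous _ (fun z : X * R => push (bary z.1) (clamp z.2))
  (fun z : X * R => Num.max 0 (clamp z.2 - delay (bary z.1)))).
  move=> w; apply: continuous_divf.
  - by move=> z; apply: push_den_neq0; [exact: baryP|exact: clamp_itv].
  - by apply: continuous_subf => //; apply: continuous_sumf.
  apply: continuous_subf; first exact: continuous_cstf.
  apply: continuous_sumf => i _; apply: continuous_mulf => //.
  exact: continuous_cstf.
apply: continuous_maxf; first exact: continuous_cstf.
apply: continuous_subf => //; apply: continuous_mulf; first exact: continuous_cstf.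
by apply: continuous_sumf.
Qed.

Theorem homotopy_equivalent_attach_cells :
  homotopy_equivalent R (realization R K) (sphere_wedge R d).
Proof.
have HbE z : bary (to_realization HE z) = deform (bary z.1) (clamp z.2) by [].
apply: (homotopy_equivalent_quotient (q := q) (H := to_realization HE)).
- exact: compact_realization.
- by apply: wedge_hausdorff => i; exact: hausdorff_sphere.
- exact: continuous_q.
- exact: q_surj.
- by apply: continuous_to_realization; exact: continuous_deform.
- move=> x; apply: bary_inj => v; rewrite HbE /= clamp0 //.
  rewrite /deform max_l; last first.
    by rewrite sub0r oppr_le0; exact: delay_ge0 (baryP x).
  rewrite h0 /push /push_den !big1 ?subr0 ?divr1 // => i _;
    by rewrite /push_by mul0r min_l ?mulr0 // depth_ge0 //; exact: baryP.
- move=> x y t /q_fiber[-> //|[sx sy]]; apply: q_skeleton.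
    by rewrite HbE /= deform_skeleton ?clamp_ge0 //; apply: h_skeleton => //; exact: clamp_itv.
  by rewrite HbE /= deform_skeleton ?clamp_ge0 //; apply: h_skeleton => //; exact: clamp_itv.
- move=> x y /q_fiber[-> //|[sx sy]]; apply: bary_inj => v.
  by rewrite !HbE /= clamp1 // !deform_skeleton // !h1.
Qed.

End AttachCells.

(** * Contraction of the coloured complex minus its free cells *)

(** The flags mark the base vertices of a triangle. If there is just one, the smaller of the two
    other coordinates is subtracted from both and added twice to the base vertex, so that one of the
    two is emptied. With more base vertices nothing moves. In all cases at most one vertex [k] off
    base keeps mass. *)
Lemma collapse_arith (R : realType) (f0 f1 f2 : bool) (x0 x1 x2 y0 y1 y2 : R) :
  0 <= x0 -> 0 <= x1 -> 0 <= x2 -> [|| f0, f1 | f2] ->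
  let m (f : bool) (x : R) := if f then 0 else x in
  let y (f : bool) (x m' m'' : R) := if f then x + 2 * Num.min m' m''
    else x - Num.min x m' - Num.min x m'' in
  y0 = y f0 x0 (m f1 x1) (m f2 x2) ->
  y1 = y f1 x1 (m f2 x2) (m f0 x0) ->
  y2 = y f2 x2 (m f0 x0) (m f1 x1) ->
  [/\ 0 <= y0, 0 <= y1, 0 <= y2, y0 + y1 + y2 = x0 + x1 + x2 &
    exists2 k, (k < 3)%N & [/\ k != 0%N -> ~~ f0 -> y0 = 0,
      k != 1%N -> ~~ f1 -> y1 = 0 & k != 2%N -> ~~ f2 -> y2 = 0]].
Proof.
move=> p0 p1 p2 f /=.
have [l1 l2] : (forall a : R, 0 <= a -> Num.min a 0 = 0) /\
  (forall a : R, 0 <= a -> Num.min 0 a = 0).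
  by split => a a0; [exact: min_r|exact: min_l].
rewrite ![Num.min x2 _]minC ?[Num.min x1 x0]minC.
case: f0 f1 f2 f => [] [] [] //= _ -> -> ->; rewrite ?minxx ?l1 ?l2 // ?mulr0 ?subr0 ?addr0.
- by split => //; exists 0%N.
- by split => //; exists 2%N.
- by split => //; exists 1%N.
- case: (leP x1 x2) => h; split; try lra.
  + by exists 2%N; split => // *; lra.
  + by exists 1%N; split => // *; lra.
- by split => //; exists 0%N.
- case: (leP x0 x2) => h; split; try lra.
  + by exists 2%N; split => // *; lra.
  + by exists 0%N; split => // *; lra.
- case: (leP x0 x1) => h; split; try lra.
  + by exists 1%N; split => // *; lra.
  + by exists 0%N; split => // *; lra.
Qed.

Section ColouredComplex.
Variables (R : realType) (V : finType) (col : V -> nat) (o : nat -> V).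
Hypothesis col_le3 : forall v, (col v <= 3)%N.
Hypothesis col_o : forall r, (r < 3)%N -> col (o r) = r.

(* Colours 0, 1, 2 span a join of three discrete sets; the vertices of colour 3
   are joined to those of colour 0 only. *)
Definition compatible : rel V :=
  fun u v => (u == v) || ((col u != col v) && (col u + col v <= 3)%N).

Definition coloured_complex : {set {set V}} :=
  order_complex compatible [set: V]%SET.

Let compatible_sym u v : compatible u v = compatible v u.
Proof. by rewrite /compatible eq_sym [col u == _]eq_sym addnC. Qed.

Lemma coloured_complexP (s : {set V}) :
  reflect (s != finset.set0 /\ forall u v, u \in s -> v \in s -> compatible u v)
          (s \in coloured_complex).
Proof.
rewrite inE finset.subsetT /=; apply: (iffP andP) => -[s0 cs]; split => //.
  move=> u v us vs; have /'forall_implyP/(_ u us)/'forall_implyP/(_ v vs) := cs.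
  by rewrite [compatible v u]compatible_sym orbb.
apply/'forall_implyP => u us; apply/'forall_implyP => v vs.
by rewrite cs.
Qed.

Lemma coloured_complex_same_col (s : {set V}) u v :
  s \in coloured_complex -> u \in s -> v \in s -> col u = col v -> u = v.
Proof.
move=> /coloured_complexP[_ cs] us vs cuv; have := cs _ _ us vs.
by rewrite /compatible cuv eqxx orbF => /eqP.
Qed.

Lemma coloured_complex_col_sum (s : {set V}) u v :
  s \in coloured_complex -> u \in s -> v \in s -> col u != col v ->
  (col u + col v <= 3)%N.
Proof.
move=> /coloured_complexP[_ cs] us vs cuv; have := cs _ _ us vs.
by rewrite /compatible cuv /= => /orP[/eqP uv|//]; rewrite uv eqxx in cuv.
Qed.

Let K := coloured_complex.

Let K_down : down_closed K.
Proof. exact: order_complex_down_closed. Qed.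

Let carried (s : {set V}) (x : V -> R) :=
  [/\ forall v, 0 <= x v, \sum_v x v = 1 & forall v, x v != 0 -> v \in s].

Let carried_seg s x y (t : R) : 0 <= t <= 1 -> carried s x -> carried s y ->
  carried s (fun v => (1 - t) * x v + t * y v).
Proof.
move=> /andP[t0 t1] [x0 x1 xs] [y0 y1 ys]; split.
- by move=> v; rewrite addr_ge0 // mulr_ge0 // subr_ge0.
- by rewrite big_split -!mulr_sumr /= x1 y1 !mulr1 subrK.
move=> v n0; case: (eqVneq (x v) 0) => [xv|/xs //].
by apply: ys; apply: contra_neq n0 => yv; rewrite xv yv !mulr0 addr0.
Qed.

Let triangle (u : nat -> V) : {set V} := [set u 0%N; u 1%N; u 2%N]%SET.

Let coloured (u : nat -> V) := forall r, (r < 3)%N -> col (u r) = r.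

Let triangle_mem u r : (r < 3)%N -> u r \in triangle u.
Proof. by case: r => [|[|[|]]] // _; rewrite !inE eqxx ?orbT. Qed.

Let triangleP u v : coloured u -> v \in triangle u -> v = u (col v) /\ (col v < 3)%N.
Proof.
by move=> cu; rewrite !inE => /orP[/orP[]|] /eqP ->; rewrite cu.
Qed.

Let triangleK u : coloured u -> triangle u \in K.
Proof.
move=> cu; apply/coloured_complexP; split; first by apply/set0Pn; exists (u 0%N); exact: triangle_mem.
move=> v w /(triangleP cu)[vE v3] /(triangleP cu)[wE w3].
rewrite /compatible; case: eqVneq => //= vw.
have cvw : col v != col w by apply: contra_neq vw => e; rewrite vE wE e.
by rewrite cvw /=; move: (col v) (col w) v3 w3 cvw => [|[|[|]]] // [|[|[|]]].
Qed.

Let edge_mem l v : (v \in [set o 0%N; l]%SET) = (v == o 0%N) || (v == l).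
Proof. by rewrite !inE. Qed.

Let edgeK l : col l = 3%N -> [set o 0%N; l]%SET \in K.
Proof.
move=> cl; have c0 : col (o 0%N) = 0%N by rewrite col_o.
apply/coloured_complexP; split; first by apply/set0Pn; exists l; rewrite !inE eqxx orbT.
by move=> v w; rewrite !inE => /orP[]/eqP -> /orP[]/eqP ->;
  rewrite /compatible ?eqxx //= ?cl ?c0 ?orbT.
Qed.

(** These simplices span exactly the complement of the open cells: triangles with at least one base
    vertex, and edges from the base vertex of colour 0 to a vertex of colour 3. *)
Let good (s : {set V}) :=
  (exists u, [/\ coloured u, exists2 r, (r < 3)%N & u r = o r & s = triangle u]) \/
  (exists2 l, col l = 3%N & s = [set o 0%N; l]%SET).

Let goodK s : good s -> s \in K.
Proof. by case=> [[u [cu _ ->]]|[l cl ->]]; [exact: triangleK|exact: edgeK]. Qed.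

Section Contraction.

Let mass (x : V -> R) r : R := \sum_(v | (col v == r) && (v != o r)) x v.
Let nx r := if r is 0 then 1%N else if r is 1 then 2%N else 0%N.

(* Collapses the triangles that have exactly one base vertex [o r], away from
   the opposite edge. *)
Let collapse (x : V -> R) (v : V) : R :=
  if col v == 3%N then x v else
  if v == o (col v) then x v + 2 * Num.min (mass x (nx (col v))) (mass x (nx (nx (col v))))
  else x v - Num.min (x v) (mass x (nx (col v)))
           - Num.min (x v) (mass x (nx (nx (col v)))).

(** A vertex off base spans no edge with the base vertex of its own colour, so it moves to that of
    the next colour; colour 3, adjacent to colour 0 only, moves to [o 0%N]. *)
Let slide (v : V) : V :=
  if col v == 3%N then o 0%N else if v == o (col v) then v else o (nx (col v)).

Let slide_collapse (x : V -> R) : V -> R := pushforward slide (collapse x).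

Let vertex0 (v : V) : R := (v == o 0%N)%:R.

(** Three straight-line stages of equal length: collapse, slide, shrink to [o 0%N]. In the
    telescoping sum the end of each finished stage cancels against the start of the next, and
    continuity in both arguments is immediate. *)
Definition contraction (x : V -> R) (t : R) (v : V) : R :=
  x v + clamp (3 * t) * (collapse x v - x v)
  + clamp (3 * t - 1) * (slide_collapse x v - collapse x v)
  + clamp (3 * t - 2) * (vertex0 v - slide_collapse x v).

Let mass_triangle u x r : coloured u -> carried (triangle u) x -> (r < 3)%N ->
  mass x r = if u r == o r then 0 else x (u r).
Proof.
move=> cu [_ _ xs] r3.
have out v : col v = r -> v != u r -> x v = 0.
  move=> cv vu; apply/eqP/negPn/negP => /xs/(triangleP cu)[vE _].
  by move: vu; rewrite {1}vE cv eqxx.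
rewrite /mass; case: eqVneq => [ur|ur].
  by rewrite big1 // => v /andP[/eqP cv vo]; rewrite out // ur.
rewrite (bigD1 (u r)) /=; last by rewrite cu // eqxx ur.
by rewrite big1 ?addr0 // => v /andP[/andP[/eqP cv _] vu]; rewrite out.
Qed.

Let mass_ge0 x r : (forall v, 0 <= x v) -> 0 <= mass x r.
Proof. by move=> x0; exact: sumr_ge0. Qed.

Let nx3 r : (nx r < 3)%N. Proof. by case: r => [|[|]]. Qed.

Let collapse_out u x v : coloured u -> carried (triangle u) x ->
  (exists2 r, (r < 3)%N & u r = o r) -> v \notin triangle u -> collapse x v = 0.
Proof.
move=> cu cx [k k3 uk] vu.
have xv : x v = 0 by apply/eqP; case: cx => _ _ xs; apply: contraNT vu; exact: xs.
rewrite /collapse xv; case: eqVneq => // c3.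
have cv3 : (col v < 3)%N by rewrite ltn_neqAle c3 col_le3.
have [x0 _ _] := cx.
case: eqVneq => [vo|_]; last by rewrite !min_l ?mass_ge0 // !subr0.
(* Outside the triangle, [o (col v)] could gain mass only if both other colours had mass off base.
   One of them is [k], where the triangle has its base vertex. *)
have kv : k != col v.
  apply: contraNneq vu => kv; rewrite vo -kv -uk.
  exact: triangle_mem.
have mk : mass x k = 0 by rewrite (mass_triangle cu cx) // uk eqxx.
have [kE|kE] : k = nx (col v) \/ k = nx (nx (col v)).
- move: k3 cv3 kv; case: (col v) => [|[|[|]]] //=; case: (k) => [|[|[|]]] //; by auto.
- by rewrite -kE mk min_l ?mass_ge0 // mulr0 addr0.
- by rewrite -kE mk min_r ?mass_ge0 // mulr0 addr0.
Qed.

Let collapseE u x r : coloured u -> carried (triangle u) x -> (r < 3)%N ->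
  collapse x (u r) = if u r == o r
    then x (u r) + 2 * Num.min (mass x (nx r)) (mass x (nx (nx r)))
    else x (u r) - Num.min (x (u r)) (mass x (nx r))
                 - Num.min (x (u r)) (mass x (nx (nx r))).
Proof. by move=> cu cx r3; rewrite /collapse cu // ltn_eqF. Qed.

Let sum_triangle u (f : V -> R) : coloured u ->
  (forall v, v \notin triangle u -> f v = 0) ->
  \sum_v f v = f (u 0%N) + f (u 1%N) + f (u 2%N).
Proof.
move=> cu f0.
have neq i j : (i < 3)%N -> (j < 3)%N -> i != j -> u j != u i.
  by move=> i3 j3; apply: contra_neq => e; rewrite -(cu i) // -(cu j) // e.
rewrite (bigID [in triangle u]) /= [X in _ + X]big1 ?addr0; last by move=> v; exact: f0.
rewrite (bigD1 (u 0%N)) /=; last exact: triangle_mem.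
rewrite (bigD1 (u 1%N)) /=; last by rewrite triangle_mem // neq.
rewrite (bigD1 (u 2%N)) /=; last by rewrite triangle_mem // !neq.
rewrite big1 ?addr0 ?addrA // => v.
by rewrite !inE; case: eqP => //=; case: eqP => //=; case: eqP.
Qed.

Let collapse_triangle u x : coloured u -> carried (triangle u) x ->
  (exists2 r, (r < 3)%N & u r = o r) ->
  carried (triangle u) (collapse x) /\
  exists2 k, (k < 3)%N & forall r, (r < 3)%N -> r != k -> u r != o r ->
     collapse x (u r) = 0.
Proof.
move=> cu cx uo; have [x0 x1 xs] := cx.
have fE := fun r r3 => collapseE (r := r) cu cx r3.
have mE := fun r r3 => mass_triangle (r := r) cu cx r3.
have xsum := sum_triangle cu (fun v vu => contraNeq (fun n => xs v n) vu).
have csum := sum_triangle cu (fun v => collapse_out (v := v) cu cx uo).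
move: (x0 (u 0%N)) (x0 (u 1%N)) (x0 (u 2%N)) => p0 p1 p2.
have E0 := fE 0%N isT; have E1 := fE 1%N isT; have E2 := fE 2%N isT.
rewrite /= !mE // in E0 E1 E2.
suff [c0 c1 ck] : [/\ forall r, (r < 3)%N -> 0 <= collapse x (u r),
    collapse x (u 0%N) + collapse x (u 1%N) + collapse x (u 2%N) =
    x (u 0%N) + x (u 1%N) + x (u 2%N) &
    exists2 k, (k < 3)%N & forall r, (r < 3)%N -> r != k -> u r != o r ->
     collapse x (u r) = 0].
  split => //; split.
  - move=> v; case: (boolP (v \in triangle u)) => [/(triangleP cu)[vE v3]|vu].
      by rewrite vE; exact: (c0 _ v3).
    by rewrite (collapse_out cu cx uo vu).
  - by rewrite csum c1 -xsum.
  - by move=> v; apply: contraNT => vu; apply/eqP; exact: collapse_out vu.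
have flags : [|| u 0%N == o 0%N, u 1%N == o 1%N | u 2%N == o 2%N].
  by case: uo => -[|[|[|]]] // _ ->; rewrite eqxx ?orbT.
have [y0 y1 y2 ysum [k k3 [z0 z1 z2]]] := collapse_arith p0 p1 p2 flags E0 E1 E2.
split => //; first by case=> [|[|[|]]].
exists k => // -[|[|[|]]] // _; rewrite eq_sym; [exact: z0|exact: z1|exact: z2].
Qed.

Let collapse_edge l x : col l = 3%N -> carried [set o 0%N; l]%SET x -> collapse x = x.
Proof.
move=> cl [x0 x1 xs].
have out v : v != o 0%N -> col v != 3%N -> x v = 0.
  move=> v0 v3; apply/eqP/negPn/negP => /xs; rewrite !inE (negPf v0) /= => /eqP vl.
  by move: v3; rewrite vl cl.
have m0 r : (r < 3)%N -> mass x r = 0.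
  move=> r3; rewrite /mass big1 // => v /andP[/eqP cv vr].
  rewrite out //; last by rewrite cv ltn_eqF.
  by apply: contra_neq vr => v0; move: cv; rewrite v0 col_o // => <-.
apply/funext => v; rewrite /collapse; case: eqVneq => // c3.
rewrite !m0 ?nx3 // minxx mulr0 addr0 !min_r // !subr0.
by case: ifP.
Qed.

Let vertex0_carried (s : {set V}) : o 0%N \in s -> carried s vertex0.
Proof.
move=> s0; split => [v||v]; first by rewrite ler0n.
  by rewrite (bigD1 (o 0%N)) //= big1 /vertex0 ?eqxx ?addr0 // => v /negPf ->.
by rewrite /vertex0 pnatr_eq0 eqb0 negbK => /eqP ->.
Qed.

Let o_coloured : coloured o. Proof. exact: col_o. Qed.

Let slide_carried (s s' : {set V}) y : carried s y -> (forall v, v \in s -> y v != 0 -> slide v \in s') ->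
  carried s' (pushforward slide y).
Proof.
move=> [y0 y1 ys] sl; split.
- by move=> v; exact: pushforward_ge0.
- by rewrite pushforward_sum.
by move=> v /pushforward_supp[w <- yw]; apply: sl => //; exact: ys.
Qed.

(* The successive straight-line segments of [contraction] stay in good simplices. *)
Let contraction_stages s x : good s -> carried s x ->
  exists s1 s2, [/\ good s1, good s2,
    [/\ carried s (collapse x), carried s1 (collapse x) &
        carried s1 (slide_collapse x)] &
    carried s2 (slide_collapse x) /\ carried s2 vertex0].
Proof.
case=> [[u [cu uo ->]]|[l cl ->]] cx; last first.
  have cE := collapse_edge cl cx.
  have sl : carried [set o 0%N; l]%SET (slide_collapse x).
    rewrite /slide_collapse cE; apply: (slide_carried cx) => v.
    rewrite !inE /slide => /orP[]/eqP -> _; rewrite ?cl ?eqxx //.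
    by rewrite !col_o //= !eqxx.
  exists [set o 0%N; l]%SET, [set o 0%N; l]%SET.
  have g : good [set o 0%N; l]%SET by right; exists l.
  split => //; rewrite ?cE //; split => //.
  by apply: vertex0_carried; rewrite !inE eqxx.
have [cc [k k3 ck]] := collapse_triangle cu cx uo.
(* After the collapse at most [u k] carries mass off base. Putting base vertices at the other two
   colours gives a triangle that also contains the target of the slide. *)
pose u' r := if r == k then u r else o r.
have cu' : coloured u' by move=> r r3; rewrite /u'; case: eqP => _; [exact: cu|exact: col_o].
have cc' : carried (triangle u') (collapse x).
  have [c0 c1 cs] := cc; split => // v nv; have /(triangleP cu)[vE v3] := cs _ nv.
  suff -> : v = u' (col v) by exact: triangle_mem.
  rewrite /u'; case: eqVneq => // vk.
  rewrite {1}vE; apply/eqP; apply: contra_neqT nv => uv.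
  by rewrite vE; exact: ck.
have slE v : v \in triangle u' -> slide v \in triangle u' /\ slide v \in triangle o.
  move=> /(triangleP cu')[vE v3]; rewrite /slide (ltn_eqF v3).
  case: (eqVneq v (o (col v))) => [vo|vo].
    split; last by rewrite vo; exact: triangle_mem.
    by rewrite {1}vE; exact: triangle_mem.
  have vk : col v = k.
    by apply/eqP; apply: contra_neqT vo => vk; rewrite {1}vE /u' (negPf vk).
  split; last exact: triangle_mem (nx3 _).
  have -> : o (nx (col v)) = u' (nx (col v)).
    by rewrite /u' vk; case: eqVneq => // e; move: k3 e; case: (k) => [|[|[|]]].
  exact: triangle_mem (nx3 _).
exists (triangle u'), (triangle o); split.
- left; exists u'; split => //; exists (nx k); first exact: nx3.
  by rewrite /u'; case: eqVneq => // e; move: k3 e; case: (k) => [|[|[|]]].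
- by left; exists o; split => //; exists 0%N.
- by split => //; apply: (slide_carried cc') => v /slE[].
split; first by apply: (slide_carried cc') => v /slE[].
by apply: vertex0_carried; exact: triangle_mem.
Qed.

Lemma contraction0 x : contraction x 0 = x.
Proof.
apply/funext => v; rewrite /contraction mulr0 !sub0r !clamp0 ?oppr_le0 //.
by rewrite !mul0r !addr0.
Qed.

Let contraction1 x : contraction x 1 = vertex0.
Proof.
apply/funext => v; rewrite /contraction mulr1 !clamp1; lra.
Qed.

Let contraction_good s x t : good s -> carried s x -> 0 <= t <= 1 ->
  exists2 s', good s' & carried s' (contraction x t).
Proof.
move=> gs cx /andP[t0 t1].
have [s1 [s2 [g1 g2 [cc cc1 sc1] [sc2 v2]]]] := contraction_stages gs cx.
have segE (y z : V -> R) (c : R) : (fun v => (1 - c) * y v + c * z v) =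
    (fun v => y v + c * (z v - y v)) by apply/funext => v; ring.
case: (leP (3 * t) 1) => h1.
  exists s => //; rewrite (_ : contraction x t =
    fun v => (1 - clamp (3 * t)) * x v + clamp (3 * t) * collapse x v).
    exact: carried_seg (clamp_itv _) cx cc.
  rewrite segE; apply/funext => v; rewrite /contraction.
  by rewrite (@clamp0 _ (_ - 1)) ?(@clamp0 _ (_ - 2)) ?mul0r ?addr0 //; lra.
case: (leP (3 * t) 2) => h2.
  exists s1 => //; rewrite (_ : contraction x t =
    fun v => (1 - clamp (3 * t - 1)) * collapse x v + clamp (3 * t - 1) * slide_collapse x v).
    exact: carried_seg (clamp_itv _) cc1 sc1.
  rewrite segE; apply/funext => v; rewrite /contraction.
  by rewrite (@clamp1 _ (3 * t)) ?(@clamp0 _ (_ - 2)); lra.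
exists s2 => //; rewrite (_ : contraction x t =
    fun v => (1 - clamp (3 * t - 2)) * slide_collapse x v + clamp (3 * t - 2) * vertex0 v).
  exact: carried_seg (clamp_itv _) sc2 v2.
rewrite segE; apply/funext => v; rewrite /contraction.
by rewrite (@clamp1 _ (3 * t)) ?(@clamp1 _ (_ - 1)); lra.
Qed.

Let continuous_contraction (Z : topologicalType) (F : Z -> V -> R) (t : Z -> R) v :
  (forall w, continuous (fun z => F z w)) -> continuous t ->
  continuous (fun z => contraction (F z) (t z) v).
Proof.
move=> cF ct.
have cm r : continuous (fun z => mass (F z) r) by apply: continuous_sumf => w _; exact: cF.
have cc w : continuous (fun z => collapse (F z) w).
  rewrite /collapse; case: (col w == 3%N) => //; case: (w == _).
    apply: continuous_addf => //; apply: continuous_mulf; first exact: continuous_cstf.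
    exact: continuous_minf.
  by apply: continuous_subf; [apply: continuous_subf => //|]; exact: continuous_minf.
have cs w : continuous (fun z => slide_collapse (F z) w) by exact: continuous_pushforward.
have c3 : continuous (fun z => 3 * t z).
  by apply: continuous_mulf => //; exact: continuous_cstf.
have c3' (a : R) : continuous (fun z => clamp (3 * t z - a)).
  by apply: continuous_clamp; apply: continuous_subf => //; exact: continuous_cstf.
have ck (a : R) : continuous (fun _ : Z => a) by exact: continuous_cstf.
apply: continuous_addf; last first.
  by apply: continuous_mulf => //; exact: continuous_subf.
apply: continuous_addf; last first.
  by apply: continuous_mulf => //; exact: continuous_subf.
apply: continuous_addf => //.
by apply: continuous_mulf; [exact: continuous_clamp|exact: continuous_subf].
Qed.

Section Cells.
Variables (I : finType) (d : I -> nat) (c : I -> nat -> V) (i0 : I).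

(* The 2-cells are the triangles, and the 1-cells the edges with an end of
   colour 3, that avoid the base vertices [o 0], [o 1], [o 2]. *)
Hypothesis cellP : forall i,
  (d i = 2%N /\ forall r, (r < 3)%N -> col (c i r) = r /\ c i r != o r) \/
  [/\ d i = 1%N, col (c i 0%N) = 0%N, c i 0%N != o 0%N & col (c i 1%N) = 3%N].
Hypothesis triangle_cell : forall u, coloured u ->
  (forall r, (r < 3)%N -> u r != o r) ->
  exists2 i, d i = 2%N & forall r, (r < 3)%N -> c i r = u r.
Hypothesis edge_cell : forall u l, col u = 0%N -> u != o 0%N -> col l = 3%N ->
  exists i, [/\ d i = 1%N, c i 0%N = u & c i 1%N = l].
Hypothesis cell_uniq : forall i j, d i = d j ->
  (forall r, (r <= d i)%N -> c i r = c j r) -> i = j.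

Let cc i (j : 'I_(d i).+1) : V := c i j.
Let cell i : {set V} := [set cc j | j : 'I_(d i).+1]%SET.

Let cell_mem i r : (r <= d i)%N -> c i r \in cell i.
Proof. by move=> ri; apply/imsetP; exists (Ordinal (ri : (r < (d i).+1)%N)). Qed.

Let cellE i v : v \in cell i -> exists2 r, (r <= d i)%N & v = c i r.
Proof. by move=> /imsetP[j _ ->]; exists j => //; rewrite -ltnS. Qed.

Let cell_col i r r' : (r <= d i)%N -> (r' <= d i)%N ->
  col (c i r) = col (c i r') -> r = r'.
Proof.
case: (cellP i) => [[di ci]|[di c0 _ c1]]; rewrite di.
  by move=> h h'; rewrite (ci r h).1 (ci r' h').1.
by case: r r' => [|[|]] // [|[|]] // _ _; rewrite c0 c1.
Qed.

Let cc_inj i : injective (@cc i).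
Proof.
move=> j k e; apply: val_inj; apply: (@cell_col i); last exact: (congr1 col e).
  exact: (ltn_ord j).
exact: (ltn_ord k).
Qed.

Let cellK i : cell i \in K.
Proof.
apply/coloured_complexP; split; first by apply/set0Pn; exists (c i 0%N); exact: cell_mem.
move=> v w /cellE[r ri ->] /cellE[r' ri' ->]; rewrite /compatible.
case: (eqVneq r r') => [->|rr']; first by rewrite eqxx.
have -> /= : col (c i r) != col (c i r') by apply: contra_neq rr'; exact: cell_col.
apply/orP; right; move: ri ri' rr'.
case: (cellP i) => [[di ci]|[di c0 _ c1]]; rewrite di.
  move=> h h'; rewrite (ci r h).1 (ci r' h').1.
  by case: r r' h h' => [|[|[|]]] // [|[|[|]]].
by case: r r' => [|[|]] // [|[|]] //; rewrite ?c0 ?c1.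
Qed.

(** An extra vertex of a triangle would have colour 3 next to colour 1, and one of an edge would
    have colour 1 or 2 next to colour 3; the bound 3 on sums of colours excludes both. *)
Let cell_max i (s : {set V}) : s \in K -> cell i \subset s -> s = cell i.
Proof.
move=> sK cs; apply/eqP; rewrite finset.eqEsubset cs andbT.
apply/fintype.subsetP => v vs.
have mem r : (r <= d i)%N -> c i r \in s.
  by move=> ri; exact: (fintype.subsetP cs _ (cell_mem ri)).
have same r : (r <= d i)%N -> col v = col (c i r) -> v \in cell i.
  by move=> ri cv; rewrite (coloured_complex_same_col sK vs (mem r ri) cv); exact: cell_mem.
have sum r : (r <= d i)%N -> col v != col (c i r) -> (col v + col (c i r) <= 3)%N.
  by move=> ri cv; exact: (coloured_complex_col_sum sK vs (mem r ri)).
case: (cellP i) => [[di ci]|[di c0 _ c1]]; rewrite di in same sum.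
  case: (ltnP (col v) 3) => v3.
    by apply: (same (col v)); rewrite // (ci _ v3).1.
  have v3' : col v = 3%N by apply/eqP; rewrite eqn_leq col_le3.
  by have := sum 1%N isT; rewrite (ci 1%N isT).1 v3' => /(_ isT).
have := sum 1%N isT; have := same 0%N isT; have := same 1%N isT; rewrite c0 c1.
by case: (col v) (col_le3 v) => [|[|[|[|]]]] // _; auto => _ _ /(_ isT).
Qed.

Let cell_inj : injective cell.
Proof.
move=> i j e.
have mem r : (r <= d i)%N -> exists2 r', (r' <= d j)%N & c i r = c j r'.
  by move=> ri; apply: cellE; rewrite -e; exact: cell_mem.
have mem' r : (r <= d j)%N -> exists2 r', (r' <= d i)%N & c j r = c i r'.
  by move=> ri; apply: cellE; rewrite e; exact: cell_mem.
have dE : d i = d j.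
  have dcard k : #|cell k| = (d k).+1 by rewrite card_imset ?card_ord //; exact: cc_inj.
  by apply: succn_inj; rewrite -!dcard e.
apply: cell_uniq => // r ri; have [r' rj cE] := mem r ri.
rewrite cE; congr (c j _); move: ri rj (congr1 col cE); rewrite -dE.
case: (cellP i) => [[di ci]|[di c0 _ c1]]; case: (cellP j) => [[dj cj]|[dj c0' _ c1']];
  rewrite di; move: dE; rewrite di dj // => _ h h'.
  by rewrite (ci r h).1 (cj r' h').1.
by case: r r' h h' {mem mem' cE} => [|[|]] // [|[|]] // _ _; rewrite ?c0 ?c1 ?c0' ?c1'.
Qed.

Let depth i (x : V -> R) : R := face_dist (fun j : 'I_(d i).+1 => x (cc j)).
Let skeleton (x : V -> R) := realization R K x /\ forall i, depth i x = 0.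

Let depth_neq0 i x r : (forall v, 0 <= x v) -> depth i x != 0 -> (r <= d i)%N ->
  x (c i r) != 0.
Proof.
move=> x0 di ri; apply: contra_neq di => xr; apply/eqP; rewrite eq_le.
apply/andP; split; last by apply: face_dist_ge0 => j; exact: x0.
rewrite -xr.
exact: (face_dist_le (fun j => x (cc j)) (Ordinal (ri : (r < (d i).+1)%N))).
Qed.

Let depth_eq0 i x : depth i x = 0 -> exists2 r, (r <= d i)%N & x (c i r) = 0.
Proof.
rewrite /depth; have [j ->] := face_dist_attained (fun j : 'I_(d i).+1 => x (cc j)).
by move=> e; exists j => //; rewrite -ltnS.
Qed.

Let good_skeleton s x : good s -> carried s x -> skeleton x.
Proof.
move=> gs [x0 x1 xs]; split; first by apply: (realization_in K_down) (goodK gs) xs.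
move=> i; apply/eqP/negPn/negP => di.
have mem r : (r <= d i)%N -> c i r \in s by move=> ri; apply: xs; exact: depth_neq0.
case: gs mem => [[u [cu [k k3 uk] ->]]|[l cl ->]] mem.
  case: (cellP i) => [[di2 ci]|[di1 _ _ c1]].
    have /mem/(triangleP cu)[] : (k <= d i)%N by rewrite di2.
    by rewrite (ci k k3).1 uk => e _; have [_] := ci k k3; rewrite e eqxx.
  have /mem/(triangleP cu)[] : (1 <= d i)%N by rewrite di1.
  by rewrite c1.
case: (cellP i) => [[di2 ci]|[di1 c0 c0' c1]].
  have /mem : (1 <= d i)%N by rewrite di2.
  rewrite edge_mem => /orP[]/eqP e; have := (ci 1%N isT).1; rewrite e ?cl //.
  by rewrite col_o.
have /mem : (0 <= d i)%N by [].
rewrite edge_mem (negPf c0') /= => /eqP e.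
by move: c0; rewrite e cl.
Qed.

(** Colours missing from the support are filled with base vertices. If none is missing and no base
    vertex occurs, the support is a free triangle, of positive depth; likewise a vertex of colour 3
    with a non-base vertex of colour 0 would be a free edge. *)
Let skeleton_good x : skeleton x -> exists2 s, good s & carried s x.
Proof.
move=> [[x0 x1 xK] dx].
have supp v : (v \in [set v | x v != 0]%SET) = (x v != 0) by rewrite inE.
case: (boolP [exists l, (col l == 3%N) && (x l != 0)]) => [/existsP[l /andP[/eqP cl xl]]|nol].
  exists [set o 0%N; l]%SET; first by right; exists l.
  split => // v xv; rewrite edge_mem.
  have vs : v \in [set v | x v != 0]%SET by rewrite supp.
  have ls : l \in [set v | x v != 0]%SET by rewrite supp.
  case: (eqVneq (col v) (col l)) => [e|e].
    by rewrite (coloured_complex_same_col xK vs ls e) eqxx orbT.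
  have := coloured_complex_col_sum xK vs ls e; rewrite cl -{2}[3%N]add0n leq_add2r leqn0 => /eqP cv.
  apply/orP; left; apply/negPn/negP => v0.
  have [i [di e0 e1]] := edge_cell cv v0 cl.
  have [r] := depth_eq0 (dx i); rewrite di.
  by case: r => [|[|]] // _; rewrite ?e0 ?e1 => /eqP; apply/negP.
pose u r := odflt (o r) [pick v | (col v == r) && (x v != 0)].
have cu : coloured u.
  move=> r r3; rewrite /u; case: pickP => [v /andP[/eqP] //|_] /=.
  exact: col_o.
have nb r : u r != o r -> x (u r) != 0.
  by rewrite /u; case: pickP => [v /andP[] //|_] /=; rewrite eqxx.
exists (triangle u); last first.
  split => // v xv.
  have v3 : (col v < 3)%N.
    rewrite ltn_neqAle col_le3 andbT; apply: contraNneq nol => cv.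
    by apply/existsP; exists v; rewrite cv eqxx.
  suff -> : v = u (col v) by exact: triangle_mem.
  rewrite /u; case: pickP => [w /andP[/eqP cw xw]|/(_ v)] /=; last by rewrite eqxx xv.
  by apply: (coloured_complex_same_col xK); rewrite ?supp.
left; exists u; split => //.
case: (boolP [exists r : 'I_3, u r == o r]) => [/existsP[r /eqP ur]|].
  by exists r.
rewrite negb_exists => /forallP nu.
have nu' r : (r < 3)%N -> u r != o r by move=> r3; exact: (nu (Ordinal r3)).
have [i di ci] := triangle_cell cu nu'.
have [r] := depth_eq0 (dx i); rewrite di => r3; rewrite ci // => /eqP.
by rewrite (negPf (nb r (nu' r r3))).
Qed.

Theorem homotopy_equivalent_coloured_complex :
  homotopy_equivalent R (realization R coloured_complex) (sphere_wedge R d).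
Proof.
apply: (homotopy_equivalent_attach_cells (c := cc) (h := contraction) (x0 := vertex0)) => //.
- exact: contraction0.
- move=> x t /skeleton_good[s gs cx] t01.
  by have [s' gs' cs'] := contraction_good gs cx t01; exact: good_skeleton gs' cs'.
- by apply: (@good_skeleton (triangle o)); [left; exists o; split => //; exists 0%N|
    apply: vertex0_carried; exact: triangle_mem].
Qed.

End Cells.
End Contraction.

Definition nonbase r : {set V} := [set v | (col v == r) && (v != o r)]%SET.

Let free_triangles : {set V * V * V} :=
  finset.setX (finset.setX (nonbase 0%N) (nonbase 1%N)) (nonbase 2%N).

Let free_edges : {set V * V} :=
  finset.setX (nonbase 0%N) [set v | col v == 3%N]%SET.

Let corner (w : V * V * V) (r : nat) : V := nth w.1.1 [:: w.1.1; w.1.2; w.2] r.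

Let endpoint (w : V * V) (r : nat) : V := nth w.1 [:: w.1; w.2] r.

Let corner_free w r : w \in free_triangles -> (r < 3)%N ->
  col (corner w r) = r /\ corner w r != o r.
Proof.
rewrite !inE => /andP[/andP[/andP[/eqP c0 n0] /andP[/eqP c1 n1]] /andP[/eqP c2 n2]].
by case: r => [|[|[|]]].
Qed.

Let corner_inj w w' : (forall r, (r < 3)%N -> corner w r = corner w' r) -> w = w'.
Proof.
case: w w' => [[a b] e] [[a' b'] e'] h.
by have := h 0%N isT; have := h 1%N isT; have := h 2%N isT; rewrite /corner /= => -> -> ->.
Qed.

Let free_triangle u : (forall r, (r < 3)%N -> col (u r) = r) ->
  (forall r, (r < 3)%N -> u r != o r) -> (u 0%N, u 1%N, u 2%N) \in free_triangles.
Proof. by move=> cu nu; rewrite !inE /= !cu // !nu. Qed.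

Lemma homotopy_equivalent_wedge_S2 N : (0 < N)%N ->
  (#|nonbase 0%N| * #|nonbase 1%N| * #|nonbase 2%N|)%N = N ->
  (forall v, col v != 3%N) ->
  homotopy_equivalent R (realization R coloured_complex)
    (sphere_wedge R (fun _ : 'I_N => 2%N)).
Proof.
rewrite -!cardsX -/free_triangles => N0 EN no3.
pose ev (i : 'I_N) := enum_val (cast_ord (esym EN) i).
have evP i : ev i \in free_triangles by exact: enum_valP.
apply: (homotopy_equivalent_coloured_complex (c := fun i => corner (ev i))
  (Ordinal N0)).
- by move=> i; left; split => // r; exact: corner_free.
- move=> u cu nu; have uS := free_triangle cu nu.
  exists (cast_ord EN (enum_rank_in uS (u 0%N, u 1%N, u 2%N))) => //.
  by rewrite /ev cast_ordK enum_rankK_in //; case=> [|[|[|]]].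
- by move=> u l _ _ cl; move: (no3 l); rewrite cl.
move=> i j _ h; apply: (@cast_ord_inj _ _ (esym EN)); apply: enum_val_inj.
by apply: corner_inj => r r3; exact: h.
Qed.

Lemma homotopy_equivalent_wedge_S1_S2 N1 N2 : (0 < N2)%N ->
  (#|nonbase 0%N| * #|[set v | col v == 3%N]%SET|)%N = N1 ->
  (#|nonbase 0%N| * #|nonbase 1%N| * #|nonbase 2%N|)%N = N2 ->
  homotopy_equivalent R (realization R coloured_complex)
    (sphere_wedge R (fun i : 'I_N1 + 'I_N2 => if i is inl _ then 1%N else 2%N)).
Proof.
rewrite -!cardsX -/free_triangles -/free_edges => N0 EN1 EN2.
pose ev1 (i : 'I_N1) := enum_val (cast_ord (esym EN1) i).
pose ev2 (i : 'I_N2) := enum_val (cast_ord (esym EN2) i).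
have ev1P i : ev1 i \in free_edges by exact: enum_valP.
have ev2P i : ev2 i \in free_triangles by exact: enum_valP.
pose c (i : 'I_N1 + 'I_N2) :=
  match i with inl j => endpoint (ev1 j) | inr j => corner (ev2 j) end.
apply: (homotopy_equivalent_coloured_complex (c := c) (inr (Ordinal N0))).
- case=> i; last by left; split => // r; exact: corner_free.
  right; have := ev1P i; rewrite !inE => /andP[/andP[/eqP c0 n0] /eqP c1].
  by split.
- move=> u cu nu; have uS := free_triangle cu nu.
  exists (inr (cast_ord EN2 (enum_rank_in uS (u 0%N, u 1%N, u 2%N)))) => //.
  by rewrite /c /ev2 cast_ordK enum_rankK_in //; case=> [|[|[|]]].
- move=> u l cu nu cl.
  have uS : (u, l) \in free_edges by rewrite !inE /= cu nu cl.
  exists (inl (cast_ord EN1 (enum_rank_in uS (u, l)))).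
  by rewrite /c /ev1 cast_ordK enum_rankK_in.
case=> i [] j // _ h.
  congr inl; apply: (@cast_ord_inj _ _ (esym EN1)); apply: enum_val_inj.
  have := h 0%N isT; have := h 1%N isT.
  rewrite /c /= /endpoint -/(ev1 i) -/(ev1 j).
  by case: (ev1 i) (ev1 j) => [a b] [a' b'] /= -> ->.
congr inr; apply: (@cast_ord_inj _ _ (esym EN2)); apply: enum_val_inj.
by apply: corner_inj => r r3; exact: h.
Qed.

End ColouredComplex.

(** * Unitriangular matrices of size 4 *)

Section UnitriangularFour.
Variable F : finFieldType.
Local Notation gT := {'GL_4[F]}.

Definition U4 : {group gT} := unitriangular_group 4 F.

Let ix (k : nat) : 'I_4 := inord k.

Let ent (g : gT) (i j : nat) : F := GLval g (ix i) (ix j).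

(** On [U4] this is a surjective homomorphism onto the additive group of triples, the abelianization
    map. *)
Definition superdiag (g : gT) : F * F * F := (ent g 0 1, ent g 1 2, ent g 2 3).

Let sum4 (f : 'I_4 -> F) : \sum_k f k = f (ix 0) + f (ix 1) + f (ix 2) + f (ix 3).
Proof.
rewrite !big_ord_recr big_ord0 /= add0r.
by congr (f _ + f _ + f _ + f _); apply: val_inj; rewrite /= inordK.
Qed.

Let entU g i j : g \in U4 -> (j <= i)%N -> (i < 4)%N -> ent g i j = (i == j)%:R.
Proof.
rewrite inE => /'forall_'forall_implyP Ug ji i4.
have j4 : (j < 4)%N by apply: leq_ltn_trans i4.
rewrite /ent (eqP (Ug (ix i) (ix j) _)); first by rewrite -val_eqE /= !inordK.
by rewrite /= !inordK.
Qed.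

Let entM g h i j : ent (g * h)%g i j =
  ent g i 0 * ent h 0 j + ent g i 1 * ent h 1 j + ent g i 2 * ent h 2 j
  + ent g i 3 * ent h 3 j.
Proof. by rewrite /ent GL_ME mxE sum4. Qed.

Let entMs g h : g \in U4 -> h \in U4 ->
  [/\ ent (g * h)%g 0 1 = ent g 0 1 + ent h 0 1,
      ent (g * h)%g 1 2 = ent g 1 2 + ent h 1 2,
      ent (g * h)%g 2 3 = ent g 2 3 + ent h 2 3 &
  [/\ ent (g * h)%g 0 2 = ent g 0 2 + ent g 0 1 * ent h 1 2 + ent h 0 2,
      ent (g * h)%g 1 3 = ent g 1 3 + ent g 1 2 * ent h 2 3 + ent h 1 3 &
      ent (g * h)%g 0 3 =
        ent g 0 3 + ent g 0 1 * ent h 1 3 + ent g 0 2 * ent h 2 3 + ent h 0 3]].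
Proof.
move=> gU hU; have E := fun i j ji i4 => entU (i := i) (j := j) gU ji i4.
have E' := fun i j ji i4 => entU (i := i) (j := j) hU ji i4.
do ?split; rewrite entM !(E 0 0, E 1 0, E 1 1, E 2 0, E 2 1, E 2 2, E 3 3, E 3 0, E 3 1, E 3 2)%N //;
  rewrite !(E' 0 0, E' 1 0, E' 1 1, E' 2 0, E' 2 1, E' 2 2, E' 3 3, E' 3 0, E' 3 1, E' 3 2)%N //=; ring.
Qed.

Let ent_ext g h : g \in U4 -> h \in U4 ->
  ent g 0 1 = ent h 0 1 -> ent g 1 2 = ent h 1 2 -> ent g 2 3 = ent h 2 3 ->
  ent g 0 2 = ent h 0 2 -> ent g 1 3 = ent h 1 3 -> ent g 0 3 = ent h 0 3 -> g = h.
Proof.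
move=> gU hU e1 e2 e3 e4 e5 e6; apply: val_inj; apply/matrixP => i j.
have -> : i = ix i by apply: val_inj; rewrite /= inordK.
have -> : j = ix j by apply: val_inj; rewrite /= inordK.
change (ent g i j = ent h i j).
have [ji|ij] := leqP j i; first by rewrite !entU.
move: (ltn_ord i) (ltn_ord j) ij; move: (nat_of_ord i) (nat_of_ord j) => a b.
by case: a => [|[|[|[|]]]] // _; case: b => [|[|[|[|]]]].
Qed.

Lemma superdiagM g h : g \in U4 -> h \in U4 -> superdiag (g * h)%g = superdiag g + superdiag h.
Proof. by move=> gU hU; have [E1 E2 E3 _] := entMs gU hU; rewrite /superdiag E1 E2 E3. Qed.

(** The corner entry of the commutator of [[~ x, y]] with [z], as a function of the three
    superdiagonals. *)
Definition triple_form (x y z : F * F * F) : F :=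
  (x.1.1 * y.1.2 - y.1.1 * x.1.2) * z.2 - (x.1.2 * y.2 - y.1.2 * x.2) * z.1.1.

(** The entries of [[~ x, y]] are solved from [x * y = y * x * [~ x, y]], without inverting
    matrices. As its superdiagonal is 0, its products with [z] on the two sides agree outside the
    corner, where they differ by [triple_form]. *)
Lemma commute_commutator x y z : x \in U4 -> y \in U4 -> z \in U4 ->
  commute [~ x, y]%g z <-> triple_form (superdiag x) (superdiag y) (superdiag z) = 0.
Proof.
(* Each equality [c = d] to be proved differs from a known [a = b] by a [ring] identity. *)
have shift (a b c d : F) : a = b -> c - d = b - a -> c = d.
  by move=> ->; rewrite subrr => /subr0_eq.
move=> xU yU zU; set k := [~ x, y]%g.
have kU : k \in U4 by rewrite groupR.
have yxU : (y * x)%g \in U4 by rewrite groupM.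
have kE : (x * y)%g = (y * x * k)%g by rewrite -commgC.
have [a1 b1 c1 [d1 e1 f1]] := entMs xU yU.
have [a2 b2 c2 [d2 e2 f2]] := entMs yU xU.
have [a3 b3 c3 [d3 e3 f3]] := entMs yxU kU.
rewrite -kE in a3 b3 c3 d3 e3 f3.
have a0 : ent k 0 1 = 0 by move: a3; rewrite a1 a2 => /shift; apply; ring.
have b0 : ent k 1 2 = 0 by move: b3; rewrite b1 b2 => /shift; apply; ring.
have c0 : ent k 2 3 = 0 by move: c3; rewrite c1 c2 => /shift; apply; ring.
have dk : ent k 0 2 = ent x 0 1 * ent y 1 2 - ent y 0 1 * ent x 1 2.
  by move: d3; rewrite d1 d2 b0 => /shift; apply; ring.
have ek : ent k 1 3 = ent x 1 2 * ent y 2 3 - ent y 1 2 * ent x 2 3.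
  by move: e3; rewrite e1 e2 c0 => /shift; apply; ring.
have [a4 b4 c4 [d4 e4 f4]] := entMs kU zU.
have [a5 b5 c5 [d5 e5 f5]] := entMs zU kU.
rewrite /triple_form /superdiag /= -dk -ek; split => [kz|T0].
  by move: f4; rewrite kz f5 a0 c0 => /shift; apply; ring.
apply: (ent_ext (groupM kU zU) (groupM zU kU)); rewrite ?a4 ?a5 ?b4 ?b5 ?c4 ?c5 ?d4 ?d5 ?e4 ?e5 ?f4 ?f5;
  rewrite ?a0 ?b0 ?c0; try ring.
by apply: (shift _ _ _ _ (esym T0)); ring.
Qed.

(** The lower central series starts at ['L_1(H) = H], so class at most 2 means that ['L_3(H)] is
    trivial, that is, [H] centralizes the generators [[~ x, y]] of ['L_2(H)]. *)
Lemma nilpotent_familyP (H : {group gT}) :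
  reflect (H \subset U4 /\ forall x y z, x \in H -> y \in H -> z \in H ->
             triple_form (superdiag x) (superdiag y) (superdiag z) = 0)
          (H \in nilpotent_family 3 U4).
Proof.
rewrite inE; apply: (iffP and3P) => [[HU nH cH]|[HU T0]].
  split => // x y z xH yH zH; have sU := fintype.subsetP HU.
  apply/commute_commutator; rewrite ?sU //.
  have : ('L_3(H) = 1)%g by apply/(lcn_nil_classP _ nH).
  rewrite !lcnSn lcn1 => /commG1P /fintype.subsetP /(_ [~ x, y]%g).
  by rewrite mem_commg // => /(_ isT)/centP/(_ z zH).
have L3 : ('L_3(H) = 1)%g.
  rewrite !lcnSn lcn1; apply/commG1P; rewrite gen_subG.
  apply/fintype.subsetP => _ /imset2P[x y xH yH ->]; apply/centP => z zH.
  by have sU := fintype.subsetP HU; apply/commute_commutator; rewrite ?sU //; exact: T0.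
have nH : nilpotent H by apply/lcnP; exists 2%N.
by split => //; apply/(lcn_nil_classP 2 nH).
Qed.

Lemma superdiag_surj w : exists2 g, g \in U4 & superdiag g = w.
Proof.
case: w => [[a b] c].
pose M : 'M[F]_4 := \matrix_(i, j) (if i == j then 1 else
  if (i == ix 0) && (j == ix 1) then a else if (i == ix 1) && (j == ix 2) then b
  else if (i == ix 2) && (j == ix 3) then c else 0).
have ixE k l : (k < 4)%N -> (l < 4)%N -> (ix k == ix l) = (k == l).
  by move=> k4 l4; rewrite -val_eqE /= !inordK.
have low (i j : 'I_4) : (j < i)%N -> M i j = 0.
  move=> ji; rewrite mxE; case: eqP => [ij|_]; first by rewrite ij ltnn in ji.
  by do 3 (case: andP => [[/eqP ei /eqP ej]|_]; first by rewrite ei ej /= !inordK // in ji).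
have um : M \in unitmx.
  rewrite unitmxE -det_tr det_trig.
    by rewrite big1 ?unitr1 // => i _; rewrite !mxE eqxx.
  by apply/is_trig_mxP => i j ij; rewrite mxE low.
have uM : M \is a GRing.unit by exact: um.
pose g : gT := FinRing.Unit uM.
have gM : GLval g = M by [].
exists g; last first.
  by rewrite /superdiag /ent gM !mxE !ixE //.
rewrite inE gM; apply/'forall_'forall_implyP => i j; rewrite leq_eqVlt => /orP[/eqP/val_inj->|ji].
  by rewrite mxE !eqxx.
by rewrite low // -val_eqE /= gtn_eqF.
Qed.

End UnitriangularFour.

(** * Affine covers *)

Section ColouredCover.
Variables (R : realType) (T V : finType) (P : {set {set T}}).
Variables (col : V -> nat) (member : V -> {set T}) (v0 : V).

Definition minimal_cover (A : {set T}) (v : V) : bool :=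
  (A \subset member v) && [forall w, (A \subset member w) ==> (col v <= col w)%N].

Definition common (s : {set V}) : {set T} := (\bigcap_(v in s) member v)%SET.

Hypothesis covered : forall A, A \in P -> exists v, A \subset member v.
Hypothesis minimal_compatible : forall A B u v, A \in P -> B \in P ->
  A \subset B -> minimal_cover A u -> minimal_cover B v -> compatible col u v.
Hypothesis commonP : forall s, s \in coloured_complex col -> common s \in P.
Hypothesis common_minimal : forall s u, s \in coloured_complex col ->
  minimal_cover (common s) u -> u \in s.

Let phi (A : {set T}) : V := odflt v0 [pick v | minimal_cover A v].

Let phiP A : A \in P -> minimal_cover A (phi A).
Proof.
move=> AP; rewrite /phi; case: pickP => [//|none] /=.
have [v Av] := covered AP.
have := none [arg min_(w < v | A \subset member w) col w]%N.
case: arg_minnP => // w Aw wmin; rewrite /minimal_cover Aw /=.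
by move=> /negP; case; apply/'forall_implyP => u; exact: wmin.
Qed.

Lemma homotopy_equivalent_coloured_cover :
  homotopy_equivalent R
    (realization R (order_complex (fun A B : {set T} => A \subset B) P))
    (realization R (coloured_complex col)).
Proof.
have chainP (s : {set {set T}}) : s \in order_complex (fun A B : {set T} => A \subset B) P ->
    [/\ s != finset.set0, {subset s <= P} &
        forall A B, A \in s -> B \in s -> (A \subset B) || (B \subset A)].
  rewrite inE => /and3P[s0 /fintype.subsetP sP cs]; split => // A B As Bs.
  by have /'forall_implyP/(_ A As)/'forall_implyP/(_ B Bs) := cs.
apply: (@homotopy_equivalent_poset_nerve R _ _ _ P _ phi common).
- by move=> A /=; exact: fintype.subxx.
- by move=> A B /andP[AB BA]; apply/eqP; rewrite finset.eqEsubset AB.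
- by move=> B A C /= AB BC; exact: (fintype.subset_trans AB BC).
- exact: order_complex_down_closed.
- by rewrite inE eqxx.
- move=> s sD; have [s0 sP cs] := chainP s sD.
  rewrite inE finset.subsetT /= imset_eq0 s0 /=.
  apply/'forall_implyP => _ /imsetP[A As ->]; apply/'forall_implyP => _ /imsetP[B Bs ->].
  by case/orP: (cs A B As Bs) => AB; apply/orP; [left|right];
    apply: (minimal_compatible _ _ AB); do ?apply: phiP; exact: sP.
- exact: commonP.
- move=> s s' _ _ ss'; apply/bigcapsP => v vs.
  by apply: (finset.bigcap_inf v); exact: (fintype.subsetP ss').
- move=> s A s' sD As s'0 ss'; have [_ sP _] := chainP s sD.
  apply/bigcapsP => v /(fintype.subsetP ss')/imsetP[B Bs ->].
  by apply: fintype.subset_trans (As B Bs) _; case/andP: (phiP (sP _ Bs)).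
- by move=> s sK; apply: common_minimal => //; apply: phiP; exact: commonP.
Qed.

End ColouredCover.

Section AffineCover.
Variables (R : realType) (F : finFieldType) (V : finType) (col : V -> nat).
Variables (eqns : V -> seq ((F * F * F) * F)) (v0 : V).

Definition lin (e w : F * F * F) : F :=
  e.1.1 * w.1.1 + e.1.2 * w.1.2 + e.2 * w.2.

Lemma linD e w w' : lin e (w + w') = lin e w + lin e w'.
Proof. by rewrite /lin /=; ring. Qed.

Lemma lin0 e : lin e 0 = 0.
Proof. by rewrite /lin /=; ring. Qed.

Definition solves v (w : F * F * F) : bool := all (fun q => lin q.1 w == q.2) (eqns v).

Definition solves0 v (w : F * F * F) : bool := all (fun q => lin q.1 w == 0) (eqns v).

Definition solutions v : {set F * F * F} := [set w | solves v w]%SET.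

Hypothesis solves0_isotropic : forall v x y z,
  solves0 v x -> solves0 v y -> solves0 v z -> triple_form x y z = 0.
Hypothesis isotropic_solves : forall (S : {set F * F * F}) (x : F * F * F), 0 \in S ->
  {in S & &, forall y z t, triple_form y z t = 0} ->
  exists v, forall y, y \in S -> solves v (x + y).
Hypothesis minimal_compatible : forall (S S' : {set F * F * F}) u v, S != finset.set0 -> S \subset S' ->
  minimal_cover col solutions S u -> minimal_cover col solutions S' v ->
  compatible col u v.
Hypothesis complex_solution : forall s, s \in coloured_complex col ->
  exists w, forall v, v \in s -> solves v w.
Hypothesis common_minimal : forall s u, s \in coloured_complex col ->
  minimal_cover col solutions (common solutions s) u -> u \in s.

Let G := U4 F.

Let coset v : {set {'GL_4[F]}} := [set g in G | solves v (superdiag g)]%SET.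
Let direction v : {set {'GL_4[F]}} := [set g in G | solves0 v (superdiag g)]%SET.

Let in_coset v g : (g \in coset v) = (g \in G) && solves v (superdiag g).
Proof. by rewrite finset.in_set. Qed.

Let in_direction v g : (g \in direction v) = (g \in G) && solves0 v (superdiag g).
Proof. by rewrite finset.in_set. Qed.

Let in_solutions v w : (w \in solutions v) = solves v w.
Proof. by rewrite finset.in_set. Qed.

Let mem_affine := (in_coset, in_direction, in_solutions).

Let direction_group_set v : group_set (direction v).
Proof.
apply/group_setP; split => [|x y].
  rewrite !mem_affine group1 /=.
  have s1 : superdiag (1%g : {'GL_4[F]}) = 0.
    have := superdiagM (group1 (U4 F)) (group1 (U4 F)); rewrite mulg1 => e.
    by apply: (@addrI _ (superdiag (1%g : {'GL_4[F]}))); rewrite addr0 -e.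
  by rewrite s1; apply/allP => q _; rewrite lin0.
rewrite !mem_affine => /andP[xG /allP sx] /andP[yG /allP sy]; rewrite groupM //=.
apply/allP => q qv; rewrite superdiagM // linD.
by rewrite (eqP (sx q qv)) (eqP (sy q qv)) addr0.
Qed.

Let direction_group v := Group (direction_group_set v).

Let coset_shift v x h : x \in coset v -> h \in G ->
  ((x * h)%g \in coset v) = (h \in direction v).
Proof.
rewrite !mem_affine => /andP[xG /allP sx] hG; rewrite groupM //= hG /=.
apply: eq_in_all => q qv; rewrite superdiagM // linD (eqP (sx q qv)).
by rewrite -{2}[q.2]addr0 (inj_eq (addrI _)).
Qed.

Let image_sub (A : {set {'GL_4[F]}}) v : A \subset G ->
  (A \subset coset v) = ((@superdiag F @: A)%SET \subset solutions v).
Proof.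
move=> /fintype.subsetP AG; apply/fintype.subsetP/fintype.subsetP => h.
  by move=> _ /imsetP[g gA ->]; have := h g gA; rewrite !mem_affine => /andP[].
move=> g gA; rewrite !mem_affine AG //=; have := h (superdiag g).
by rewrite imset_f // in_solutions; apply.
Qed.

Let image_minimal (A : {set {'GL_4[F]}}) v : A \subset G ->
  minimal_cover col coset A v = minimal_cover col solutions (@superdiag F @: A)%SET v.
Proof.
move=> AG; rewrite /minimal_cover image_sub //; congr (_ && _).
by apply: eq_forallb => w; rewrite image_sub.
Qed.

Let P := coset_poset (nilpotent_family 3 G) G.

Let P_sub A : A \in P -> A \subset G /\ A != finset.set0.
Proof.
move=> /imset2P[x H xG /nilpotent_familyP[HG _] ->]; split.
  by apply/fintype.subsetP => g /lcosetP[h hH ->]; rewrite groupM // (fintype.subsetP HG).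
by apply/set0Pn; exists x; rewrite lcoset_refl.
Qed.

Let K_neq0 s : s \in coloured_complex col -> s != finset.set0.
Proof. by rewrite inE => /and3P[]. Qed.

(** A common solution lifts to an element [x] of all the cosets, and cosets through one element
    intersect in the coset of the intersected subgroups. That intersection lies in a single
    [direction v], which makes it isotropic. *)
Let common_coset s : s \in coloured_complex col -> common coset s \in P.
Proof.
move=> sK; have [v vs] := set0Pn _ (K_neq0 sK).
have [w sw] := complex_solution sK; have [x xG xw] := superdiag_surj w.
have xc u : u \in s -> x \in coset u by move=> us; rewrite !mem_affine xG xw sw.
apply/imset2P; exists x [group of (\bigcap_(u in s) direction_group u)%SET] => //.
  apply/nilpotent_familyP; split.
    by apply: fintype.subset_trans (finset.bigcap_inf v vs) _;
      apply/fintype.subsetP => g; rewrite !mem_affine => /andP[].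
  move=> a b c /bigcapP/(_ v vs) + /bigcapP/(_ v vs) + /bigcapP/(_ v vs).
  by rewrite !mem_affine => /andP[_ ha] /andP[_ hb] /andP[_ hc]; exact: solves0_isotropic ha hb hc.
apply/setP => g; rewrite mem_lcoset; apply/bigcapP/bigcapP => h u us.
  have gG : g \in G by have := h u us; rewrite !mem_affine => /andP[].
  by rewrite /= -(coset_shift (xc u us)) ?groupM ?groupV // mulKVg; exact: h.
have := h u us => /= hu.
have xgG : (x^-1 * g)%g \in G by move: hu; rewrite !mem_affine => /andP[].
by rewrite -[g](mulKVg x) (coset_shift (xc u us)).
Qed.

Let image_common s : s \in coloured_complex col ->
  (@superdiag F @: common coset s)%SET = common solutions s.
Proof.
move=> sK; apply/setP => w; apply/imsetP/bigcapP => [[g /bigcapP gs ->] v vs|ws].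
  by have := gs v vs; rewrite !mem_affine => /andP[].
have [g gG gw] := superdiag_surj w; exists g => //; apply/bigcapP => v vs.
by rewrite !mem_affine gG gw; have := ws v vs; rewrite !mem_affine.
Qed.

(** The covering cosets are full preimages under [superdiag], so covering depends only on images,
    and the image of a common part is the common part of the solution sets. The cover conditions
    thus become affine geometry in [F * F * F]. *)
Lemma homotopy_equivalent_affine_cover :
  homotopy_equivalent R (coset_space R (nilpotent_family 3 (U4 F)) (U4 F))
    (realization R (coloured_complex col)).
Proof.
apply: (homotopy_equivalent_coloured_cover R (member := coset) v0).
- move=> A /imset2P[x H xG /nilpotent_familyP[HG T0] ->].
  have inS h : h \in H -> superdiag h \in (@superdiag F @: H)%SET by exact: imset_f.
  have S0 : 0 \in (@superdiag F @: H)%SET.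
    apply/imsetP; exists 1%g; first exact: group1.
    have := superdiagM (group1 (U4 F)) (group1 (U4 F)); rewrite mulg1 => e.
    by apply: (@addrI _ (superdiag (1%g : {'GL_4[F]}))); rewrite addr0 -e.
  have [|v sv] := isotropic_solves (superdiag x) S0.
    by move=> _ _ _ /imsetP[a aH ->] /imsetP[b bH ->] /imsetP[c cH ->]; exact: T0.
  exists v; apply/fintype.subsetP => g /lcosetP[h hH ->].
  have hG := fintype.subsetP HG _ hH.
  by rewrite !mem_affine groupM //= superdiagM // sv // imset_f.
- move=> A B u v AP BP AB; have [AG A0] := P_sub AP; have [BG _] := P_sub BP.
  rewrite !image_minimal //; apply: minimal_compatible; last exact: imsetS.
  by rewrite imset_eq0.
- exact: common_coset.
move=> s u sK; have [cG _] := P_sub (common_coset sK).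
by rewrite image_minimal // image_common //; exact: common_minimal.
Qed.

End AffineCover.

(** * Odd characteristic *)

Section IsotropicSets.
Variables (F : fieldType) (S : pred (F * F * F)).
Hypothesis iso : forall x y z, S x -> S y -> S z ->
  (x.1.1 * y.1.2 - y.1.1 * x.1.2) * z.2 = (x.1.2 * y.2 - y.1.2 * x.2) * z.1.1.

(** Suppose no coordinate vanishes on [S]. If all minors of the first two coordinates vanish, so do
    those of the last two, and [S] lies on a line. Otherwise one minor [d != 0], with its
    counterpart [e], forces the third coordinate to be [e / d] times the first; computing [e] from
    this relation gives [e = - e] with [e != 0], hence characteristic 2. *)
Lemma isotropic_classification :
  [\/ forall x, S x -> x.1.1 = 0, forall x, S x -> x.1.2 = 0,
      forall x, S x -> x.2 = 0 |
   (exists b c, [/\ b != 0, c != 0 & forall x, S x -> x.1.2 = b * x.1.1 /\ x.2 = c * x.1.1]) \/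
   ((2 : F) = 0 /\ exists2 k, k != 0 & forall x, S x -> x.2 = k * x.1.1)].
Proof.
have dec (f : F * F * F -> F) :
    (forall x, S x -> f x = 0) \/ (exists2 x, S x & f x != 0).
  case: (pselect (exists2 x, S x & f x != 0)) => h; [by right|left => x Sx].
  by apply/eqP/negPn/negP => fx; apply: h; exists x.
case: (dec (fun x => x.1.1)) => [|[x1 S1 a1]]; first by constructor 1.
case: (dec (fun x => x.1.2)) => [|[x2 S2 b2]]; first by constructor 2.
case: (dec (fun x => x.2)) => [|[x3 S3 c3]]; first by constructor 3.
constructor 4.
case: (pselect (forall x y, S x -> S y -> x.1.1 * y.1.2 - y.1.1 * x.1.2 = 0)) => D0.
  have E0 x y : S x -> S y -> x.1.2 * y.2 - y.1.2 * x.2 = 0.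
    move=> Sx Sy; have := iso Sx Sy S1; rewrite D0 // mul0r => /esym/eqP.
    by rewrite mulf_eq0 (negPf a1) orbF => /eqP.
  have aE x : S x -> x.1.1 = x2.1.1 / x2.1.2 * x.1.2.
    move=> Sx; rewrite mulrAC; apply: (mulIf b2); rewrite mulfVK //.
    exact/subr0_eq/D0.
  have cE x : S x -> x.2 = x2.2 / x2.1.2 * x.1.2.
    move=> Sx; rewrite mulrAC; apply: (mulIf b2); rewrite mulfVK //.
    have := E0 _ _ S2 Sx => /subr0_eq e.
    by rewrite mulrC e mulrC.
  have a2 : x2.1.1 != 0.
    by apply: contra_neq a1 => e; rewrite (aE _ S1) e !mul0r.
  have c2 : x2.2 != 0.
    by apply: contra_neq c3 => e; rewrite (cE _ S3) e !mul0r.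
  left; exists (x2.1.2 / x2.1.1), (x2.2 / x2.1.1); split.
  - by rewrite mulf_neq0 ?invr_eq0.
  - by rewrite mulf_neq0 ?invr_eq0.
  move=> x Sx; rewrite (cE _ Sx) (aE _ Sx); split; field; by rewrite ?a2 ?b2.
have [x [y [Sx Sy D]]] : exists x y, [/\ S x, S y &
    x.1.1 * y.1.2 - y.1.1 * x.1.2 != 0].
  apply/not_existsP => h; apply: D0 => x y Sx Sy; apply/eqP/negPn/negP => D.
  by apply: (h x); exists y.
set d := x.1.1 * y.1.2 - y.1.1 * x.1.2 in D.
set e := x.1.2 * y.2 - y.1.2 * x.2.
have E : e != 0.
  apply: contra_neq c3 => e0; have := iso Sx Sy S3; rewrite -/d -/e e0 mul0r.
  by move/eqP; rewrite mulf_eq0 (negPf D) => /eqP.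
have cE z : S z -> z.2 = e / d * z.1.1.
  move=> Sz; rewrite mulrAC; apply: (mulIf D); rewrite mulfVK //.
  by rewrite mulrC; exact: iso.
right; split; last by exists (e / d) => //; rewrite mulf_neq0 ?invr_eq0.
have e2 : 2 * e = 0.
  have : e = - e.
    have kd : e / d * d = e by rewrite mulfVK.
    rewrite {1}/e (cE _ Sx) (cE _ Sy) -[in RHS]kd.
    by move: (e / d) => k; rewrite /d; ring.
  by move=> h; rewrite mulr_natl mulr2n {1}h addNr.
by apply/eqP; move/eqP: e2; rewrite mulf_eq0 (negPf E) orbF.
Qed.

End IsotropicSets.

Section MinimalCover.
Variables (T V : finType) (col : V -> nat) (member : V -> {set T}) (S : {set T}) (u : V).
Hypothesis Su : minimal_cover col member S u.

Lemma minimal_cover_mem x : x \in S -> x \in member u.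
Proof. by case/andP: Su => /fintype.subsetP Suu _; exact: Suu. Qed.

Lemma minimal_cover_le v : (forall x, x \in S -> x \in member v) -> (col u <= col v)%N.
Proof.
move=> Sv; case/andP: Su => _ /'forall_implyP; apply.
exact/fintype.subsetP.
Qed.

End MinimalCover.

Section OddCharacteristic.
Variables (R : realType) (F : finFieldType).
Hypothesis two_neq0 : (2 : F) != 0.

(* [((b, c), (j, k))] encodes the affine line [y = b x + j, z = c x + k]; these
   lines are the maximal isotropic cosets not contained in a coordinate plane. *)
Definition skew_line : finType :=
  {l : (F * F) * (F * F) | (l.1.1 != 0) && (l.1.2 != 0)}.

Definition odd_vertex : finType := ('I_3 * F + skew_line)%type.

Definition odd_col (v : odd_vertex) : nat :=
  match v with inl ri => nat_of_ord ri.1 | inr _ => 3%N end.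

Let e (r : 'I_3) : F * F * F := ((r == 0%N :> nat)%:R, (r == 1%N :> nat)%:R, (r == 2%N :> nat)%:R).

Definition odd_eqns (v : odd_vertex) : seq ((F * F * F) * F) :=
  match v with
  | inl ri => [:: (e ri.1, ri.2)]
  | inr l => [:: ((- (val l).1.1, 1, 0), (val l).2.1);
                 ((- (val l).1.2, 0, 1), (val l).2.2)]
  end.

Let crd (r : 'I_3) (w : F * F * F) : F := nth 0 [:: w.1.1; w.1.2; w.2] r.

Let crdE r w : lin (e r) w = crd r w.
Proof.
by rewrite /lin /e /crd; case: r => -[|[|[|]]] //= _; rewrite !mul1r !mul0r ?addr0 ?add0r.
Qed.

Let solves_plane r i w : solves odd_eqns (inl (r, i)) w = (crd r w == i).
Proof. by rewrite /solves /= andbT crdE. Qed.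

Let solves_line l w : solves odd_eqns (inr l) w =
  (w.1.2 == (val l).1.1 * w.1.1 + (val l).2.1) &&
  (w.2 == (val l).1.2 * w.1.1 + (val l).2.2).
Proof.
rewrite /solves /lin /= andbT !mul1r !mul0r addr0 addr0.
by rewrite !mulNr ![- _ + _]addrC !subr_eq ![_ + (val l).2.1]addrC ![_ + (val l).2.2]addrC.
Qed.

Let r0 : 'I_3 := ord0.

Let slope (l : skew_line) : (val l).1.1 != 0 /\ (val l).1.2 != 0.
Proof. by case: l => l /= /andP. Qed.

Let line_point (l : skew_line) (t : F) : F * F * F :=
  (t, (val l).1.1 * t + (val l).2.1, (val l).1.2 * t + (val l).2.2).

Let line_pointP l t : solves odd_eqns (inr l) (line_point l t).
Proof. by rewrite solves_line /= !eqxx. Qed.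

Let sol := solutions odd_eqns.

Let in_sol v w : (w \in sol v) = solves odd_eqns v w.
Proof. by rewrite finset.in_set. Qed.

Let line_eq l l' x y : x.1.1 != y.1.1 ->
  solves odd_eqns (inr l) x -> solves odd_eqns (inr l) y ->
  solves odd_eqns (inr l') x -> solves odd_eqns (inr l') y -> l = l'.
Proof.
have lineq (b j b' j' s t : F) : s != t -> b * s + j = b' * s + j' ->
    b * t + j = b' * t + j' -> b = b' /\ j = j'.
  move=> st h1 h2.
  have : (b - b') * (s - t) = 0.
    transitivity ((b * s + j) - (b' * s + j') - ((b * t + j) - (b' * t + j'))).
      by ring.
    by rewrite h1 h2 !subrr.
  move/eqP; rewrite mulf_eq0 [s - t == 0]subr_eq0 (negPf st) orbF subr_eq0 => /eqP bb.
  by split => //; move: h1; rewrite bb => /addrI.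
rewrite !solves_line => xy /andP[/eqP a1 /eqP a2] /andP[/eqP a3 /eqP a4].
move=> /andP[/eqP b1 /eqP b2] /andP[/eqP b3 /eqP b4].
have [h1 h2] := lineq _ _ _ _ _ _ xy (etrans (esym a1) b1) (etrans (esym a3) b3).
have [h3 h4] := lineq _ _ _ _ _ _ xy (etrans (esym a2) b2) (etrans (esym a4) b4).
apply: val_inj; move: h1 h2 h3 h4.
by case: (val l) (val l') => [[? ?] [? ?]] [[? ?] [? ?]] /= -> -> -> ->.
Qed.

Let K := coloured_complex odd_col.

Let line_other s l v : s \in K -> inr l \in s -> v \in s ->
  v = inr l \/ exists i, v = inl (r0, i).
Proof.
move=> sK ls vs; case: v vs => [[r i]|l'] vs; last first.
  by left; exact: (coloured_complex_same_col sK vs ls).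
right; exists i; have := coloured_complex_col_sum sK vs ls.
rewrite /= ltn_eqF // => /(_ isT); rewrite -[X in (_ <= X)%N]add0n leq_add2r leqn0 => /eqP r0E.
by congr (inl (_, _)); exact: val_inj.
Qed.

(** A plane of [s] may prescribe coordinate [r]; otherwise it is copied from [w], so that a
    coordinate left free by [s] can be given any value. *)
Let plane_pick (s : {set odd_vertex}) (w : F * F * F) (r : 'I_3) : F :=
  odflt (crd r w) [pick i | inl (r, i) \in s].

Let plane_point (s : {set odd_vertex}) (w : F * F * F) : F * F * F :=
  (plane_pick s w ord0, plane_pick s w (inord 1), plane_pick s w (inord 2)).

Let crd_plane_point s w r : crd r (plane_point s w) = plane_pick s w r.
Proof.
rewrite /crd /plane_point /=; case: r => -[|[|[|]]] //= h; congr plane_pick;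
  by apply: val_inj; rewrite /= ?inordK.
Qed.

Let plane_pointP s w : s \in K -> (forall l, inr l \notin s) ->
  forall v, v \in s -> solves odd_eqns v (plane_point s w).
Proof.
move=> sK nol [[r i]|l] vs; last by move: (nol l); rewrite vs.
rewrite solves_plane crd_plane_point /plane_pick.
case: pickP => [j js|/(_ i)]; last by rewrite vs.
by apply/eqP; have [] := coloured_complex_same_col sK js vs erefl.
Qed.

Let line_or_not (s : {set odd_vertex}) :
  (exists l, inr l \in s) \/ (forall l, inr l \notin s).
Proof.
case: (boolP [exists l, inr l \in s]) => [/existsP|]; first by left.
by rewrite negb_exists => /forallP; right.
Qed.

Let odd_solution s : s \in K -> exists w, forall v, v \in s -> solves odd_eqns v w.
Proof.
move=> sK; case: (line_or_not s) => [[l ls]|nol]; last first.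
  by exists (plane_point s 0); exact: plane_pointP.
(* A line is parametrized by its first coordinate. The only other kind of vertex that [s] may
   contain prescribes just that coordinate. *)
exists (line_point l (plane_pick s 0 r0)) => v vs.
case: (line_other sK ls vs) => [->|[i vE]]; first exact: line_pointP.
rewrite vE solves_plane /crd /= /plane_pick; case: pickP => [j js|/(_ i)].
  by apply/eqP; rewrite vE in vs; have [] := coloured_complex_same_col sK js vs erefl.
by rewrite -vE vs.
Qed.

Let in_common s w : (w \in common sol s) = [forall v in s, solves odd_eqns v w].
Proof.
apply/bigcapP/'forall_implyP => h v vs; have := h v vs; by rewrite in_sol.
Qed.

Let odd_isotropic v x y z : solves0 odd_eqns v x -> solves0 odd_eqns v y ->
  solves0 odd_eqns v z -> triple_form x y z = 0.
Proof.
rewrite /solves0; case: v => [[[r hr] i]|l] /=; rewrite !andbT ?crdE.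
  case: r hr => [|[|[|]]] // hr; rewrite /crd /= => /eqP hx /eqP hy /eqP hz;
    rewrite /triple_form ?hx ?hy ?hz; ring.
have E (w : F * F * F) (b c : F) : lin (- b, 1, 0) w == 0 -> lin (- c, 0, 1) w == 0 ->
    w.1.2 = b * w.1.1 /\ w.2 = c * w.1.1.
  rewrite /lin /= !mul1r !mul0r !addr0 !mulNr ![- _ + _]addrC !subr_eq0.
  by move=> /eqP -> /eqP ->.
move=> /andP[x1 x2] /andP[y1 y2] /andP[z1 z2]; rewrite /triple_form.
have [-> ->] := E _ _ _ x1 x2; have [-> ->] := E _ _ _ y1 y2.
have [_ ->] := E _ _ _ z1 z2; ring.
Qed.

Let odd_cover (S : {set F * F * F}) (x : F * F * F) : 0 \in S ->
  {in S & &, forall y z t, triple_form y z t = 0} ->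
  exists v, forall y, y \in S -> solves odd_eqns v (x + y).
Proof.
move=> _ T0; have [|h|h|h|] := @isotropic_classification F (mem S).
- by move=> a b c Sa Sb Sc; apply/subr0_eq; exact: T0.
- by exists (inl (r0, x.1.1)) => y /h yE; rewrite solves_plane /crd /= yE addr0.
- exists (inl (inord 1, x.1.2)) => y /h yE.
  by rewrite solves_plane /crd /= inordK //= yE addr0.
- exists (inl (inord 2, x.2)) => y /h yE.
  by rewrite solves_plane /crd /= inordK //= yE addr0.
case=> [[b [c [b0 c0 h]]]|[/eqP]]; last by rewrite (negPf two_neq0).
have bc : (b != 0) && (c != 0) by rewrite b0 c0.
pose l : skew_line := exist (fun l : (F * F) * (F * F) => (l.1.1 != 0) && (l.1.2 != 0))
  ((b, c), (x.1.2 - b * x.1.1, x.2 - c * x.1.1)) bc.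
exists (inr l) => y /h[yb yc]; rewrite solves_line /= yb yc.
by apply/andP; split; apply/eqP; ring.
Qed.

(** A set inside a line and inside a plane of the second or third coordinate is a single point, as
    the slopes are non-zero; it then lies in a plane of the first coordinate, against minimality.
    Two lines through [S] coincide unless the first coordinate is constant on [S], which is excluded
    in the same way. *)
Let odd_compatible (S S' : {set F * F * F}) u v : S != finset.set0 -> S \subset S' ->
  minimal_cover odd_col sol S u -> minimal_cover odd_col sol S' v ->
  compatible odd_col u v.
Proof.
move=> /set0Pn[x xS] /fintype.subsetP SS' Su Sv.
have su y : y \in S -> solves odd_eqns u y.
  by move=> yS; rewrite -in_sol; exact: (minimal_cover_mem Su).
have sv y : y \in S -> solves odd_eqns v y.
  by move=> yS; rewrite -in_sol; apply: (minimal_cover_mem Sv); exact: SS'.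
have minu w : (forall y, y \in S -> solves odd_eqns w y) -> (odd_col u <= odd_col w)%N.
  by move=> h; apply: (minimal_cover_le Su) => y /h; rewrite in_sol.
case: u v Su Sv su sv minu => [[r i]|l] [[r' i']|l'] _ _ su sv minu.
- rewrite /compatible /=; case: (eqVneq r r') => [rr|rr].
    suff -> : i = i' by rewrite rr eqxx.
    have := su x xS; have := sv x xS; rewrite !solves_plane rr.
    by move=> /eqP <- /eqP <-.
  rewrite val_eqE rr /= orbC.
  by case: r r' rr {su sv minu} => -[|[|[|]]] // ? [[|[|[|]]]].
- case: (posnP r) => [r0E|r_gt0]; first by rewrite /compatible /= r0E.
  exfalso; have [b0 c0] := slope l'.
  suff [j hj] : exists j, forall y, y \in S -> y.1.1 = j.
    have := minu (inl (r0, j)); rewrite /= leqNgt r_gt0 => h.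
    by have : false by apply: h => y /hj <-; rewrite solves_plane.
  case: r r_gt0 su {minu} => -[|[|[|]]] // hr _ su.
    exists ((i - (val l').2.1) / (val l').1.1) => y yS.
    have := su y yS; have := sv y yS; rewrite solves_line solves_plane /crd /=.
    by move=> /andP[/eqP -> _] /eqP <-; rewrite addrK mulrC mulKf.
  exists ((i - (val l').2.2) / (val l').1.2) => y yS.
  have := su y yS; have := sv y yS; rewrite solves_line solves_plane /crd /=.
  by move=> /andP[_ /eqP ->] /eqP <-; rewrite addrK mulrC mulKf.
- have := minu (inl (r', i')) sv; rewrite leqNgt /= => /negP; case.
  exact: ltn_ord.
suff -> : l = l' by rewrite /compatible eqxx.
case: (boolP [forall y in S, y.1.1 == x.1.1]) => [/'forall_implyP h|].
  have : (3 <= 0)%N by apply: (minu (inl (r0, x.1.1))) => y /h; rewrite solves_plane.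
  by [].
rewrite negb_forall => /existsP[y]; rewrite negb_imply => /andP[yS yx].
exact: (line_eq yx (su y yS) (su x xS) (sv y yS) (sv x xS)).
Qed.

(** A minimal cover outside [s] is refuted by common solutions that it misses: its coordinate is
    either free, or [s] is a single line along which it varies. If the cover is a line, its colour
    forces [s] to be a single line too, and two points identify them. *)
Let odd_minimal s u : s \in K -> minimal_cover odd_col sol (common sol s) u -> u \in s.
Proof.
move=> sK Su; have [w0 w0P] := odd_solution sK.
have su w : (forall v, v \in s -> solves odd_eqns v w) -> solves odd_eqns u w.
  move=> h; rewrite -in_sol; apply: (minimal_cover_mem Su); rewrite in_common.
  exact/'forall_implyP.
have le v : v \in s -> (odd_col u <= odd_col v)%N.
  move=> vs; apply: (minimal_cover_le Su) => w; rewrite in_common.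
  by move=> /'forall_implyP/(_ v vs); rewrite in_sol.
have only_line l w : inr l \in s -> (forall i, inl (r0, i) \notin s) ->
    solves odd_eqns (inr l) w -> forall v, v \in s -> solves odd_eqns v w.
  move=> ls no0 lw v vs; case: (line_other sK ls vs) => [-> //|[i vE]].
  by move: (no0 i); rewrite -vE vs.
case: u {Su} su le => [[r i]|l] su le.
  case: (boolP [exists j, inl (r, j) \in s]) => [/existsP[j js]|].
    have := su w0 w0P; have := w0P _ js; rewrite !solves_plane => /eqP -> /eqP <-.
    by [].
  rewrite negb_exists => /forallP nor; exfalso.
  case: (line_or_not s) => [[l ls]|nol].
    have no0 j : inl (r0, j) \notin s.
      apply/negP => js; have := le _ js; rewrite /= leqn0 => /eqP rE.
      by move: (nor j); rewrite (_ : r = r0) ?js //; exact: val_inj.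
    have [b0 c0] := slope l.
    have h0 := su _ (only_line l _ ls no0 (line_pointP l 0)).
    have h1 := su _ (only_line l _ ls no0 (line_pointP l 1)).
    move: h0 h1; rewrite !solves_plane => /eqP <-.
    case: (r) => -[|[|[|]]] // ?; rewrite /crd /= ?oner_eq0 // mulr0 mulr1 add0r.
      by rewrite -subr_eq0 addrK (negPf b0).
    by rewrite -subr_eq0 addrK (negPf c0).
  (* All coordinates of [w] differ from [i], and [s] leaves coordinate [r] free, so
     [plane_point s w] lies off the plane [u]. *)
  pose w : F * F * F := (i + 1, i + 1, i + 1).
  have := su _ (@plane_pointP s w sK nol); rewrite solves_plane crd_plane_point.
  rewrite /plane_pick; case: pickP => [j js|_] /=; first by move: (nor j); rewrite js.
  have -> : crd r w = i + 1 by rewrite /crd; case: (r) => -[|[|[|]]].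
  by rewrite -subr_eq0 addrC addKr oner_eq0.
have [v vs] : exists v, v \in s by apply/set0Pn; case/coloured_complexP: sK.
case: v vs (le _ vs) => [[r i]|l'] vs /= le3; first by move: (ltn_ord r); rewrite ltnNge le3.
have no0 j : inl (r0, j) \notin s by apply/negP => js; have := le _ js.
have h0 := su _ (only_line l' _ vs no0 (line_pointP l' 0)).
have h1 := su _ (only_line l' _ vs no0 (line_pointP l' 1)).
suff -> : l = l' by [].
apply: (line_eq _ h0 h1 (line_pointP l' 0) (line_pointP l' 1)).
by rewrite eq_sym oner_eq0.
Qed.

Let odd_base (r : nat) : odd_vertex := inl (inord r, 0).

Let card_nonbase r : (r < 3)%N -> #|nonbase odd_col odd_base r| = #|F|.-1.
Proof.
move=> r3; rewrite -[RHS](cardC1 (0 : F)) -(card_imset _ (_ : injective (fun i => inl (inord r, i) : odd_vertex))).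
  apply: eq_card => -[[k i]|l]; last first.
    rewrite !inE /= gtn_eqF //=; apply/esym/negbTE/negP => /imsetP[? _ //].
  rewrite !inE /=; apply/idP/imsetP => [/andP[/eqP kr n0]|[j j0 [-> ->]]].
    have kE : k = inord r by apply: val_inj; rewrite /= inordK.
    exists i; last by rewrite kE.
    by rewrite !inE; apply: contra_neq n0 => ->; rewrite kE.
  rewrite inordK // eqxx /=; move: j0; rewrite !inE; apply: contra_neq.
  by case.
by move=> i j [].
Qed.

Let card_lines : #|[set v | odd_col v == 3%N]%SET| = (#|F| ^ 2 * #|F|.-1 ^ 2)%N.
Proof.
have inr_inj : injective (inr : skew_line -> odd_vertex) by move=> l l' [].
transitivity #|{: skew_line}|.
  rewrite -(card_imset _ inr_inj); apply: eq_card => -[[r i]|l]; rewrite !inE /=.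
    by rewrite ltn_eqF //; apply/esym/negbTE/negP => /imsetP[? _ //].
  by rewrite imset_f.
rewrite card_sig.
transitivity #|finset.setX (finset.setX [set~ (0 : F)]%SET [set~ (0 : F)]%SET) [set: F * F]%SET|.
  apply: eq_card => -[[b c] [j k]]; by rewrite !inE /= andbT.
by rewrite !cardsX cardsC1 cardsT card_prod mulnC -!mulnn.
Qed.

Lemma homotopy_equivalent_odd N1 N2 :
  (#|F| ^ 2 * #|F|.-1 ^ 3)%N = N1 -> (#|F|.-1 ^ 3)%N = N2 ->
  homotopy_equivalent R (coset_space R (nilpotent_family 3 (U4 F)) (U4 F))
    (sphere_wedge R (fun i : 'I_N1 + 'I_N2 => if i is inl _ then 1%N else 2%N)).
Proof.
move=> EN1 EN2; apply: homotopy_equivalent_trans.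
  apply: (homotopy_equivalent_affine_cover R (col := odd_col) (eqns := odd_eqns) (odd_base 0)).
  - exact: odd_isotropic.
  - exact: odd_cover.
  - exact: odd_compatible.
  - exact: odd_solution.
  - exact: odd_minimal.
apply: (homotopy_equivalent_wedge_S1_S2 R (o := odd_base)).
- by case=> [[r i]|l] //=; exact: ltnW (ltn_ord r).
- by move=> r r3; rewrite /= inordK.
- by rewrite -EN2 expn_gt0 -subn1 subn_gt0 card_finNzRing_gt1.
- by rewrite card_nonbase // card_lines -EN1 mulnCA -expnS.
- by rewrite !card_nonbase // -EN2 !expnS expn0 muln1 mulnA.
Qed.

End OddCharacteristic.

(** * The field with two elements *)

Section FieldOfTwoElements.
Variables (R : realType) (F : finFieldType).
Hypothesis F2 : forall x : F, x != 0 -> x = 1.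

(* The cosets of [x + z = 0], [x = 0], [z = 0] and [y = 0], in this order. *)
Definition even_vertex : finType := (F + F + (F + F))%type.

(** The planes of the first and of the third coordinate share colour 1: a set inside one of each
    lies in a plane of their sum, which has the smaller colour 0, so the two are never both needed
    in a simplex. *)
Definition even_col (v : even_vertex) : nat :=
  match v with inl (inl _) => 0%N | inl (inr _) => 1%N
             | inr (inl _) => 1%N | inr (inr _) => 2%N end.

Definition even_eqns (v : even_vertex) : seq ((F * F * F) * F) :=
  match v with
  | inl (inl l) => [:: ((1, 0, 1), l)]
  | inl (inr i) => [:: ((1, 0, 0), i)]
  | inr (inl k) => [:: ((0, 0, 1), k)]
  | inr (inr j) => [:: ((0, 1, 0), j)]
  end.

Let solvesE v w : solves even_eqns v w =
  match v with
  | inl (inl l) => w.1.1 + w.2 == l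
  | inl (inr i) => w.1.1 == i
  | inr (inl k) => w.2 == k
  | inr (inr j) => w.1.2 == j
  end.
Proof.
by case: v => [[]|[]] i; rewrite /solves /lin /= andbT !(mul1r, mul0r, addr0, add0r).
Qed.

Let sol := solutions even_eqns.
Let K := coloured_complex even_col.

Let in_sol v w : (w \in sol v) = solves even_eqns v w.
Proof. by rewrite finset.in_set. Qed.

Let vs_ l : even_vertex := inl (inl l).
Let vx i : even_vertex := inl (inr i).
Let vz k : even_vertex := inr (inl k).
Let vy j : even_vertex := inr (inr j).

Let value (mk : F -> even_vertex) (s : {set even_vertex}) : F :=
  odflt 0 [pick i | mk i \in s].

Let valueE mk s i : s \in K -> injective mk ->
  (forall i j, even_col (mk i) = even_col (mk j)) -> mk i \in s -> value mk s = i.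
Proof.
move=> sK imk cmk iS; rewrite /value; case: pickP => [j jS|/(_ i)]; last by rewrite iS.
exact/imk/(coloured_complex_same_col sK jS iS).
Qed.

Let solves_s l w : solves even_eqns (vs_ l) w = (w.1.1 + w.2 == l).
Proof. exact: solvesE. Qed.
Let solves_x i w : solves even_eqns (vx i) w = (w.1.1 == i).
Proof. exact: solvesE. Qed.
Let solves_z i w : solves even_eqns (vz i) w = (w.2 == i).
Proof. exact: solvesE. Qed.
Let solves_y i w : solves even_eqns (vy i) w = (w.1.2 == i).
Proof. exact: solvesE. Qed.

Let vertexP (Q : even_vertex -> Prop) : (forall i, Q (vs_ i)) -> (forall i, Q (vx i)) ->
  (forall i, Q (vz i)) -> (forall i, Q (vy i)) -> forall v, Q v.
Proof. by move=> ? ? ? ? [[]|[]]. Qed.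

Let vx_vz s i k : s \in K -> vx i \in s -> vz k \in s -> False.
Proof. by move=> sK xs zs; have := coloured_complex_same_col sK xs zs erefl. Qed.

Let has_or_not (mk : F -> even_vertex) (s : {set even_vertex}) :
  (exists i, mk i \in s) \/ (forall i, mk i \notin s).
Proof.
case: (boolP [exists i, mk i \in s]) => [/existsP|]; first by left.
by rewrite negb_exists => /forallP; right.
Qed.

Let common_y s w : s \in K -> w.1.2 = value vy s -> forall j, vy j \in s ->
  solves even_eqns (vy j) w.
Proof. by move=> sK wy j js; rewrite solves_y wy (valueE sK _ _ js) // => ? ? []. Qed.

(** [s] fixes at most one of the first and third coordinates, and the other one adjusts to the
    prescribed sum. *)
Let point_sum s l : s \in K -> (forall l', vs_ l' \in s -> l' = l) ->
  exists2 w, forall v, v \in s -> solves even_eqns v w & w.1.1 + w.2 = l.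
Proof.
move=> sK sl; case: (has_or_not vx s) => [[i iS]|nox].
  exists (i, value vy s, l - i); last by rewrite /= addrC subrK.
  elim/vertexP => j js.
  - by rewrite solves_s /= addrC subrK (sl _ js).
  - by rewrite solves_x /=; have [->] := coloured_complex_same_col sK iS js erefl.
  - by case: (vx_vz sK iS js).
  - by apply: (common_y sK _ js).
exists (l - value vz s, value vy s, value vz s); last by rewrite /= subrK.
elim/vertexP => j js.
- by rewrite solves_s /= subrK (sl _ js).
- by move: (nox j); rewrite js.
- by rewrite solves_z /= (valueE sK _ _ js) // => ? ? [].
- by apply: (common_y sK _ js).
Qed.

Let point_x s t : s \in K -> (forall l, vs_ l \notin s) -> (forall i, vx i \notin s) ->
  exists2 w, forall v, v \in s -> solves even_eqns v w & w.1.1 = t.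
Proof.
move=> sK nos nox; exists (t, value vy s, value vz s) => //.
elim/vertexP => j js.
- by move: (nos j); rewrite js.
- by move: (nox j); rewrite js.
- by rewrite solves_z /= (valueE sK _ _ js) // => ? ? [].
- by apply: (common_y sK _ js).
Qed.

Let point_z s t : s \in K -> (forall l, vs_ l \notin s) -> (forall i, vz i \notin s) ->
  exists2 w, forall v, v \in s -> solves even_eqns v w & w.2 = t.
Proof.
move=> sK nos noz; exists (value vx s, value vy s, t) => //.
elim/vertexP => j js.
- by move: (nos j); rewrite js.
- by rewrite solves_x /= (valueE sK _ _ js) // => ? ? [].
- by move: (noz j); rewrite js.
- by apply: (common_y sK _ js).
Qed.

Let even_solution s : s \in K -> exists w, forall v, v \in s -> solves even_eqns v w.
Proof.
move=> sK; have [|w ws _] := @point_sum s (value vs_ s) sK; last by exists w.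
by move=> l ls; rewrite (valueE sK _ _ ls) // => ? ? [].
Qed.

Let in_common s w : (w \in common sol s) = [forall v in s, solves even_eqns v w].
Proof.
apply/bigcapP/'forall_implyP => h v vs; have := h v vs; by rewrite in_sol.
Qed.

Hypothesis two0 : (1 + 1 : F) = 0.

Let oppF (x : F) : - x = x.
Proof. by apply/eqP; rewrite eq_sym -addr_eq0 -{1}[x]mul1r -{2}[x]mul1r -mulrDl two0 mul0r. Qed.

Let even_isotropic v x y z : solves0 even_eqns v x -> solves0 even_eqns v y ->
  solves0 even_eqns v z -> triple_form x y z = 0.
Proof.
rewrite /solves0 /triple_form; case: v => [[]|[]] i /=;
  rewrite !andbT /lin /= !(mul1r, mul0r, addr0, add0r).
- rewrite !addr_eq0 !oppF => /eqP -> /eqP -> /eqP ->.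
  transitivity ((1 + 1) * ((x.2 * y.1.2 + y.2 * x.1.2) * z.2)); first by ring.
  by rewrite two0 mul0r.
- by move=> /eqP -> /eqP -> /eqP ->; ring.
- by move=> /eqP -> /eqP -> /eqP ->; ring.
- by move=> /eqP -> /eqP -> _; ring.
Qed.

Let even_cover (S : {set F * F * F}) (x : F * F * F) : 0 \in S ->
  {in S & &, forall y z t, triple_form y z t = 0} ->
  exists v, forall y, y \in S -> solves even_eqns v (x + y).
Proof.
move=> _ T0.
(* The only non-zero scalar is 1, so skew lines and skew planes alike satisfy [y.2 = y.1.1]. *)
have diag : (forall y, y \in S -> y.2 = y.1.1) ->
    exists v, forall y, y \in S -> solves even_eqns v (x + y).
  move=> h; exists (vs_ (x.1.1 + x.2)) => y /h yE; rewrite solves_s /= yE.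
  by rewrite addrACA -{2}[y.1.1]oppF subrr addr0.
have [|h|h|h|] := @isotropic_classification F (mem S).
- by move=> a b c Sa Sb Sc; apply/subr0_eq; exact: T0.
- by exists (vx x.1.1) => y /h yE; rewrite solves_x /= yE addr0.
- by exists (vy x.1.2) => y /h yE; rewrite solves_y /= yE addr0.
- by exists (vz x.2) => y /h yE; rewrite solves_z /= yE addr0.
case=> [[b [c [_ /F2-> h]]]|[_ [k /F2-> h]]]; apply: diag => y /h.
  by case=> _; rewrite mul1r.
by rewrite mul1r.
Qed.

Let even_compatible (S S' : {set F * F * F}) u v : S != finset.set0 -> S \subset S' ->
  minimal_cover even_col sol S u -> minimal_cover even_col sol S' v ->
  compatible even_col u v.
Proof.
move=> /set0Pn[x xS] /fintype.subsetP SS' Su Sv.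
have su y : y \in S -> solves even_eqns u y.
  by move=> yS; rewrite -in_sol; exact: (minimal_cover_mem Su).
have sv y : y \in S -> solves even_eqns v y.
  by move=> yS; rewrite -in_sol; apply: (minimal_cover_mem Sv); exact: SS'.
have minu w : (forall y, y \in S -> solves even_eqns w y) -> (even_col u <= even_col w)%N.
  by move=> h; apply: (minimal_cover_le Su) => y /h; rewrite in_sol.
(* Fixing both the first and the third coordinate fixes their sum, whose plane has colour 0. *)
have xz i k : (forall y, y \in S -> y.1.1 == i /\ y.2 == k) -> (even_col u <= 0)%N.
  move=> h; apply: (minu (vs_ (i + k))) => y /h[/eqP yi /eqP yk].
  by rewrite solves_s yi yk.
move: su sv minu xz {Su Sv}; elim/vertexP: u => i; elim/vertexP: v => j su sv minu xz //;
  have := su x xS; have := sv x xS; rewrite !solvesE => /eqP ex /eqP ex';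
  rewrite /compatible; try by rewrite -ex -ex' eqxx.
- suff: (1 <= 0)%N by [].
  by apply: (xz i j) => y yS; have := su y yS; have := sv y yS; rewrite !solvesE.
- suff: (1 <= 0)%N by [].
  by apply: (xz j i) => y yS; have := su y yS; have := sv y yS; rewrite !solvesE.
Qed.

(** If [s] has no plane of the same kind as [u], some common solution takes the value [i + 1]
    instead of [i]. For the planes of colour 1, minimality of the colour rules out a sum plane in
    [s], which frees the coordinate. *)
Let even_minimal s u : s \in K -> minimal_cover even_col sol (common sol s) u -> u \in s.
Proof.
move=> sK Su; have [w0 w0P] := even_solution sK.
have su w : (forall v, v \in s -> solves even_eqns v w) -> solves even_eqns u w.
  move=> h; rewrite -in_sol; apply: (minimal_cover_mem Su); rewrite in_common.
  exact/'forall_implyP.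
have le v : v \in s -> (even_col u <= even_col v)%N.
  move=> vs; apply: (minimal_cover_le Su) => w; rewrite in_common.
  by move=> /'forall_implyP/(_ v vs); rewrite in_sol.
have absurd (x : F) : x + 1 = x -> False.
  by move/eqP; rewrite -subr_eq0 addrC addKr oner_eq0.
move: su le {Su}; elim/vertexP: u => i su le.
- case: (has_or_not vs_ s) => [[l ls]|nos].
    by have := su w0 w0P; have := w0P _ ls; rewrite !solves_s => /eqP -> /eqP <-.
  have [|w ws e] := @point_sum s (i + 1) sK; first by move=> l; rewrite (negPf (nos l)).
  by have := su w ws; rewrite solves_s e => /eqP/absurd.
- have nos l : vs_ l \notin s by apply/negP => ls; have := le _ ls.
  case: (has_or_not vx s) => [[l ls]|nox].
    by have := su w0 w0P; have := w0P _ ls; rewrite !solves_x => /eqP -> /eqP <-.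
  have [w ws e] := @point_x s (i + 1) sK nos nox.
  by have := su w ws; rewrite solves_x e => /eqP/absurd.
- have nos l : vs_ l \notin s by apply/negP => ls; have := le _ ls.
  case: (has_or_not vz s) => [[l ls]|noz].
    by have := su w0 w0P; have := w0P _ ls; rewrite !solves_z => /eqP -> /eqP <-.
  have [w ws e] := @point_z s (i + 1) sK nos noz.
  by have := su w ws; rewrite solves_z e => /eqP/absurd.
have [v vs] : exists v, v \in s by apply/set0Pn; case/coloured_complexP: sK.
move: vs (le _ vs); elim/vertexP: v => j js //= _.
by have := su w0 w0P; have := w0P _ js; rewrite !solves_y => /eqP -> /eqP <-.
Qed.

Let even_base (r : nat) : even_vertex :=
  match r with 0 => vs_ 0 | 1 => vx 0 | _ => vy 0 end.

Let card_F : #|F| = 2%N.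
Proof.
rewrite -cardsT (_ : [set: F]%SET = [set 0; 1]%SET); first by rewrite cards2 eq_sym oner_eq0.
apply/setP => x; rewrite !inE; case: (eqVneq x 0) => //= /F2 ->.
by rewrite eqxx.
Qed.

Let card_one (mk : F -> even_vertex) (r : nat) : injective mk ->
  (nonbase even_col even_base r = [set mk i | i in [set~ 0]])%SET ->
  #|nonbase even_col even_base r| = 1%N.
Proof. by move=> imk ->; rewrite card_imset // cardsC1 card_F. Qed.

(** Of the four planes of colour 1 only [vx 0] is a base vertex. This is the factor 3 in the number
    of free triangles; each of the other two colours contributes 1. *)
Let card_nonbase1 : #|nonbase even_col even_base 1| = 3%N.
Proof.
have ix : injective vx by move=> ? ? [].
have iz : injective vz by move=> ? ? [].
rewrite (_ : nonbase _ _ _ = [set vx i | i in [set~ 0]]%SET :|: [set vz i | i in [set: F]]%SET).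
  rewrite cardsU (_ : _ :&: _ = finset.set0); last first.
    apply/setP => v; rewrite !inE; apply/negP => /andP[/imsetP[i _ ->] /imsetP[j _]].
    by [].
  by rewrite cards0 subn0 !card_imset // cardsC1 cardsT card_F.
apply/setP; elim/vertexP => i; rewrite !inE /=.
- by apply/esym/negbTE; rewrite negb_or; apply/andP; split; apply/imsetP => -[].
- apply/idP/orP => [ni|[/imsetP[j j0 [->]]|/imsetP[j _] //]].
    by left; apply: imset_f; rewrite !inE; apply: contra_neq ni => ->.
  by move: j0; rewrite !inE; apply: contra_neq => -[].
- by rewrite orbC imset_f.
- by apply/esym/negbTE; rewrite negb_or; apply/andP; split; apply/imsetP => -[].
Qed.

Lemma homotopy_equivalent_even :
  homotopy_equivalent R (coset_space R (nilpotent_family 3 (U4 F)) (U4 F))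
    (sphere_wedge R (fun _ : 'I_3 => 2%N)).
Proof.
apply: homotopy_equivalent_trans.
  apply: (homotopy_equivalent_affine_cover R (col := even_col) (eqns := even_eqns) (vx 0)).
  - exact: even_isotropic.
  - exact: even_cover.
  - exact: even_compatible.
  - exact: even_solution.
  - exact: even_minimal.
apply: (homotopy_equivalent_wedge_S2 R (o := even_base)) => //.
- by elim/vertexP.
- by case=> [|[|[|]]].
- rewrite card_nonbase1 (@card_one vs_) ?(@card_one vy) //.
  + by move=> ? ? [].
  + apply/setP; elim/vertexP => i; rewrite !inE /=; try by apply/esym/imsetP => -[].
    apply/idP/imsetP => [ni|[j j0 [->]]].
      by exists i => //; rewrite !inE; apply: contra_neq ni => ->.
    by move: j0; rewrite !inE; apply: contra_neq => -[].
  + by move=> ? ? [].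
  + apply/setP; elim/vertexP => i; rewrite !inE /=; try by apply/esym/imsetP => -[].
    apply/idP/imsetP => [ni|[j j0 [->]]].
      by exists i => //; rewrite !inE; apply: contra_neq ni => ->.
    by move: j0; rewrite !inE; apply: contra_neq => -[].
- by elim/vertexP.
Qed.

End FieldOfTwoElements.

(** * Specialization to prime fields *)

Local Open Scope nat_scope.

Theorem theorem4p1 (R : realType) (p : nat) (p_prime : prime p) :
  let U4 : {group {'GL_4['F_p]}} := unitriangular_group 4 'F_p in
  let C := coset_space R (nilpotent_family 3 U4) U4 in
  (p = 2 -> homotopy_equivalent R C (sphere_wedge R (fun _ : 'I_3 => 2))) /\
  (2 < p ->
    homotopy_equivalent R C
      (sphere_wedge R (fun i : 'I_(p ^ 2 * (p - 1) ^ 3) + 'I_((p - 1) ^ 3) =>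
                         if i is inl _ then 1 else 2))).
Proof.
move=> U4 C; split => [p2|p2].
  apply: (@homotopy_equivalent_even R 'F_p).
    by rewrite p2 => -[[|[|]]] //= h _; apply: val_inj.
  by rewrite p2; apply: val_inj.
apply: (@homotopy_equivalent_odd R 'F_p).
- apply/negP => /eqP e2; have := dvdn_pcharf (pchar_Fp p_prime) 2.
  rewrite (_ : (2%:R : 'F_p)%R = 0%R) // eqxx => /(dvdn_leq (ltn0Sn 1)).
  by rewrite leqNgt p2.
- by rewrite card_Fp // subn1.
- by rewrite card_Fp // subn1.
Qed.
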